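(* Let $(A,A^+)=\bigoplus_{\lambda\in\Lambda}(A_\lambda,A_\lambda^+)$ be the canonical decomposition of a right-angled Artin group into its irreducible factors, and suppose that no factor of this decomposition is isomorphic to $(\mathbb Z,\mathbb N)$. For each ideal $\mathcal B$ of the partially ordered set $\mathcal P(\Lambda_f)$, let $\phi(\mathcal B)$ denote the (closed, two-sided) ideal $$\phi(\mathcal B)=\Big\langle \prod_{s\in S_B}(1-1_s) : B\in\mathcal B\Big\rangle$$ of $C^*(A,A^+)$. Then $\phi$ is an order isomorphism from the lattice of ideals of $\mathcal P(\Lambda_f)$ onto the lattice of closed two-sided ideals of the C*-algebra $C^*(A,A^+)$, and it maps the principal ideal of $\mathcal P(\Lambda_f)$ generated by a finite set $B\subset\Lambda_f$ to the principal ideal of $C^*(A,A^+)$ generated by $\prod_{s\in S_B}(1-1_s)$.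
   Context: Right-angled Artin groups: for a simplicial graph $\Gamma$ with countable vertex set $S$, $A=A_\Gamma=\langle S \mid ab=ba \text{ if } \{a,b\}\text{ is an edge of }\Gamma\rangle$ and $A^+$ is the submonoid generated by $S$. The opposite graph $\Gamma^{\rm opp}$ has vertex set $S$, two distinct vertices being joined in $\Gamma^{\rm opp}$ iff they are not joined in $\Gamma$. The irreducible factors $(A_\lambda,A_\lambda^+)$ are the right-angled Artin groups generated by the vertex sets $S_\lambda$ ($\lambda\in\Lambda$) of the connected components of $\Gamma^{\rm opp}$; $(A,A^+)$ is their direct sum. Put $\Lambda_f=\{\lambda\in\Lambda: S_\lambda\text{ finite}\}$ and, for a finite $B\subset\Lambda_f$, $S_B=\bigcup_{\lambda\in B}S_\lambda$ (so $S_\emptyset=\emptyset$, and the empty product is $1$). $\mathcal P(\Lambda_f)$ is the set of finite subsets of $\Lambda_f$ ordered by reverse inclusion ($B\le C$ iff $C\subseteq B$). An ideal of a partially ordered set is a hereditary (downward closed) subset; the empty subset is allowed. Ideals are ordered by inclusion (meets and joins are intersections and unions). The ideal generated by a subset is the smallest ideal containing it; it is principal if it is generated by one element. Toeplitz algebra: $(G,P)=(A,A^+)$ is quasi-lattice ordered: $P\cap P^{-1}=\{e\}$, and with $x\le y\iff x^{-1}y\in P$ every two elements with a common upper bound have a least upper bound $x\vee y$. The Nica spectrum $\Omega$ is the set of $\omega\subset G$ with $e\in\omega$ that are hereditary ($\omega P^{-1}\subset\omega$) and directed ($x\vee y$ exists and lies in $\omega$ for $x,y\in\omega$), with the topology from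 $\{0,1\}^G$. $G$ acts partially on $\Omega$ by $\theta_t:U_{t^{-1}}\to U_t$, $\omega\mapsto t\omega$, where $U_t=\{\omega:t\in\omega\}$. $C^*(A,A^+):=C(\Omega)\rtimes A$ is the full partial crossed product: the universal C*-completion of finite sums $\sum f_t\delta_t$, $f_t\in C_0(U_t)$, with $(f\delta_s)(g\delta_t)=\alpha_s(\alpha_{s^{-1}}(f)g)\delta_{st}$, $(f\delta_t)^*=\alpha_{t^{-1}}(\bar f)\delta_{t^{-1}}$, where $\alpha_t(f)=f\circ\theta_{t^{-1}}$ for $f\in C_0(U_{t^{-1}})$. Here $1_s\in C(\Omega)\subset C(\Omega)\rtimes A$ is the characteristic function of $U_s$. *)

(* Defs.v *)
From HB Require Import structures.
From mathcomp Require Import all_boot all_order all_algebra.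
From mathcomp Require Import complex.
From mathcomp Require Import all_classical all_reals all_analysis.

Set Implicit Arguments.
Unset Strict Implicit.
Unset Printing Implicit Defensive.

Import Order.TTheory GRing.Theory Num.Theory numFieldNormedType.Exports.

Local Open Scope quotient_scope.
Local Open Scope classical_set_scope.
Local Open Scope complex_scope.
Local Open Scope ring_scope.

(* The letter (s, true) stands for the generator s, (s, false) for its        *)
(* inverse. [raag_rel e] is the congruence on words that presents             *)
(* < T | ab = ba if e a b >.                                                  *)
Inductive raag_rel (T : Type) (e : rel T) :
    seq (T * bool) -> seq (T * bool) -> Prop :=
| raag_refl u : raag_rel e u u
| raag_sym u v : raag_rel e u v -> raag_rel e v u
| raag_trans u v w : raag_rel e u v -> raag_rel e v w -> raag_rel e u w
| raag_cat u u' v v' :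
    raag_rel e u u' -> raag_rel e v v' -> raag_rel e (u ++ v) (u' ++ v')
| raag_cancel a b : raag_rel e [:: (a, b); (a, ~~ b)] [::]
| raag_comm a b : e a b ->
    raag_rel e [:: (a, true); (b, true)] [:: (b, true); (a, true)].

Section RightAngledArtinGroup.
Variables (T : choiceType) (e : rel T).

Definition raag_relb : rel (seq (T * bool)) := fun u v => `[< raag_rel e u v >].

Lemma raag_relb_refl : reflexive raag_relb.
Proof. by move=> u; apply/asboolP; exact: raag_refl. Qed.

Lemma raag_relb_sym : symmetric raag_relb.
Proof. by move=> u v; apply/asboolP/asboolP; exact: raag_sym. Qed.

Lemma raag_relb_trans : transitive raag_relb.
Proof.
by move=> v u w /asboolP uv /asboolP vw; apply/asboolP; exact: raag_trans vw.
Qed.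

Canonical raag_equiv :=
  EquivRel raag_relb raag_relb_refl raag_relb_sym raag_relb_trans.

Definition raag : Type := {eq_quot raag_equiv}.

HB.instance Definition _ := Choice.on raag.

Definition raag_word (u : seq (T * bool)) : raag := \pi_({eq_quot raag_equiv}) u.

Definition word_inv (u : seq (T * bool)) : seq (T * bool) :=
  rev [seq (x.1, ~~ x.2) | x <- u].

Definition raag_one : raag := raag_word [::].
Definition raag_mul (x y : raag) : raag :=
  raag_word (repr (x : {eq_quot raag_equiv}) ++ repr (y : {eq_quot raag_equiv})).
Definition raag_inv (x : raag) : raag :=
  raag_word (word_inv (repr (x : {eq_quot raag_equiv}))).

Lemma raag_wordP u v : raag_rel e u v <-> raag_word u = raag_word v.
Proof.
split=> [uv|/eqmodP]; last by move/asboolP.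
by apply/eqmodP; apply/asboolP.
Qed.

Lemma raag_word_surj (x : raag) : exists u, x = raag_word u.
Proof. by exists (repr (x : {eq_quot raag_equiv})); rewrite /raag_word reprK. Qed.

Lemma raag_repr u : raag_rel e (repr (raag_word u : {eq_quot raag_equiv})) u.
Proof. by apply/raag_wordP; rewrite /raag_word reprK. Qed.

Lemma raag_mulE u v : raag_mul (raag_word u) (raag_word v) = raag_word (u ++ v).
Proof. by apply/raag_wordP; apply: raag_cat; exact: raag_repr. Qed.

Lemma word_inv_cat u v : word_inv (u ++ v) = word_inv v ++ word_inv u.
Proof. by rewrite /word_inv map_cat rev_cat. Qed.

Lemma word_invK u : word_inv (word_inv u) = u.
Proof.
rewrite /word_inv map_rev revK -map_comp -[RHS]map_id.
by apply: eq_map => -[a b] /=; rewrite negbK.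
Qed.

Lemma word_mulV u : raag_rel e (u ++ word_inv u) [::].
Proof.
elim: u => [|[a b] u IHu]; first exact: raag_refl.
rewrite -cat1s word_inv_cat catA -(catA [:: _]).
apply: (@raag_trans _ _ _ ([:: (a, b)] ++ [::] ++ word_inv [:: (a, b)])).
  rewrite -catA; apply: raag_cat; first exact: raag_refl.
  by apply: raag_cat => //; exact: raag_refl.
exact: raag_cancel.
Qed.

Lemma word_mulVl u : raag_rel e (word_inv u ++ u) [::].
Proof. by rewrite -{2}(word_invK u); exact: word_mulV. Qed.

Lemma word_inv_rel u v : raag_rel e u v -> raag_rel e (word_inv u) (word_inv v).
Proof.
move=> uv; apply: (@raag_trans _ _ _ (word_inv u ++ v ++ word_inv v)).
  rewrite -[X in raag_rel _ X _]cats0; apply: raag_cat; first exact: raag_refl.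
  by apply: raag_sym; exact: word_mulV.
apply: (@raag_trans _ _ _ (word_inv u ++ u ++ word_inv v)).
  apply: raag_cat; first exact: raag_refl.
  by apply: raag_cat; [exact: raag_sym|exact: raag_refl].
rewrite catA -[X in raag_rel _ _ X]cat0s; apply: raag_cat.
  exact: word_mulVl.
exact: raag_refl.
Qed.

Lemma raag_invE u : raag_inv (raag_word u) = raag_word (word_inv u).
Proof. by apply/raag_wordP; apply: word_inv_rel; exact: raag_repr. Qed.

Lemma raag_mulA : associative raag_mul.
Proof.
move=> x y z; have [u ->] := raag_word_surj x.
have [v ->] := raag_word_surj y; have [w ->] := raag_word_surj z.
by rewrite !raag_mulE catA.
Qed.

Lemma raag_mul1 : left_id raag_one raag_mul.
Proof. by move=> x; have [u ->] := raag_word_surj x; rewrite raag_mulE. Qed.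

Lemma raag_mulr1 : right_id raag_one raag_mul.
Proof.
by move=> x; have [u ->] := raag_word_surj x; rewrite raag_mulE cats0.
Qed.

Lemma raag_mulV : left_inverse raag_one raag_inv raag_mul.
Proof.
move=> x; have [u ->] := raag_word_surj x; rewrite raag_invE raag_mulE.
by apply/raag_wordP; exact: word_mulVl.
Qed.

Lemma raag_mulrV : right_inverse raag_one raag_inv raag_mul.
Proof.
move=> x; have [u ->] := raag_word_surj x; rewrite raag_invE raag_mulE.
by apply/raag_wordP; exact: word_mulV.
Qed.

HB.instance Definition _ :=
  isGroup.Build raag raag_mulA raag_mul1 raag_mulr1 raag_mulV raag_mulrV.

Definition raag_gen (s : T) : raag := raag_word [:: (s, true)].

Definition raag_pos : set raag :=
  smallest [set M | M 1%g /\ forall x y, M x -> M y -> M (x * y)%g]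
           (range raag_gen).

End RightAngledArtinGroup.

Section Factors.
Variables (S : choiceType) (e : rel S).

Definition opp_graph : rel S := fun s t => (s != t) && ~~ e s t.

Definition component (s : S) : set S :=
  [set t | exists2 p, path opp_graph s p & last s p = t].

(* An index lambda of an irreducible factor is identified with the vertex set *)
(* S_lambda of the corresponding component of the opposite graph.             *)
Definition factors : set (set S) := range component.

Definition induced_graph (lam : set S) : rel lam := fun s t => e (val s) (val t).

Definition finite_factors : set (set S) :=
  [set lam | factors lam /\ finite_set lam].

Definition factor_sets : set (set (set S)) :=
  [set B | finite_set B /\ B `<=` finite_factors].

Definition factor_le (B C : set (set S)) : Prop := C `<=` B.

Definition factor_ideal : set (set (set (set S))) :=
  [set I | I `<=` factor_sets /\
    forall B C, I B -> factor_sets C -> factor_le C B -> I C].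

Definition factor_ideal_gen (X : set (set (set S))) : set (set (set S)) :=
  smallest factor_ideal X.

Definition vertices (B : set (set S)) : set S := \bigcup_(lam in B) lam.

End Factors.

Definition iso_Z_N (G : groupType) (P : set G) : Prop :=
  exists f : G -> int,
    [/\ bijective f, {morph f : x y / (x * y)%g >-> x + y} &
        f @` P = range Posz].

HB.mixin Record isCStarAlgebra (R : realType) V & CompleteNormedModule R[i] V := {
  cmul : V -> V -> V;
  cstar : V -> V;
  cmulA : associative cmul;
  cmulDl : left_distributive cmul +%R;
  cmulDr : right_distributive cmul +%R;
  cmulZl : forall (k : R[i]) x y, cmul (k *: x) y = k *: cmul x y;
  cmulZr : forall (k : R[i]) x y, cmul x (k *: y) = k *: cmul x y;
  cstarK : involutive cstar;
  cstarD : {morph cstar : x y / x + y};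
  cstarZ : forall (k : R[i]) x, cstar (k *: x) = Num.conj k *: cstar x;
  cstarM : forall x y, cstar (cmul x y) = cmul (cstar y) (cstar x);
  cnormM : forall x y, `|cmul x y| <= `|x| * `|y|;
  cnorm_star : forall x, `|cmul (cstar x) x| = `|x| ^+ 2
}.

#[short(type="cstarAlgType")]
HB.structure Definition CStarAlgebra (R : realType) :=
  {V of isCStarAlgebra R V & CompleteNormedModule R[i] V}.

Definition closed_ideal (R : realType) (E : cstarAlgType R) : set (set E) :=
  [set I | [/\ closed I, I 0,
      forall x y, I x -> I y -> I (x + y),
      forall (k : R[i]) x, I x -> I (k *: x) &
      forall a x, I x -> I (cmul a x) /\ I (cmul x a)]].

Definition closed_ideal_gen (R : realType) (E : cstarAlgType R) (X : set E) :
  set E := smallest (@closed_ideal R E) X.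

Section Toeplitz.
Variables (R : realType) (G : groupType) (P : set G).

Definition qle (x y : G) : Prop := P (x^-1 * y)%g.

Definition is_join (x y z : G) : Prop :=
  [/\ qle x z, qle y z & forall w, qle x w -> qle y w -> qle z w].

Local Notation subsets := {ptws G -> bool}.

Definition nica_spectrum : set subsets :=
  [set w | [/\ w 1%g,
      forall x p, w x -> P p -> w (x * p^-1)%g &
      forall x y, w x -> w y -> exists2 z, is_join x y z & w z]].

Definition nica_cyl (t : G) : set subsets := [set w | nica_spectrum w /\ w t].

Definition translate (t : G) (w : subsets) : subsets :=
  fun g => w (t^-1 * g)%g.

(* A function on Omega is represented by its extension by zero to all subsets *)
(* of G. As Omega is compact, C_0(U) for an open subset U of Omega is the     *)
(* space of continuous functions on Omega that vanish off U.                  *)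
Local Notation fct := (subsets -> R[i]^o).

Definition C0 (t : G) : set fct :=
  [set f | {within nica_spectrum, continuous f} /\
           forall w, ~ nica_cyl t w -> f w = 0].

Definition alpha (t : G) (f : fct) : fct :=
  fun w => if w \in nica_cyl t then f (translate t^-1%g w) else 0.

(* a : G -> fct stands for the formal sum of the (a t) delta_t. The           *)
(* operations below are meaningful on [finite_sums] only.                     *)
Definition finite_sums : set (G -> fct) :=
  [set a | finite_set [set t | a t <> 0] /\ forall t, C0 t (a t)].

Definition single (t : G) (f : fct) : G -> fct :=
  fun s => if s == t then f else 0.

(* coefficient of delta_r in the sum of the (a s delta_s) (b t delta_t) *)
Definition sums_mul (a b : G -> fct) : G -> fct := fun r w =>
  \sum_(s \in [set: G])
    alpha s (fun v => alpha s^-1%g (a s) v * b (s^-1 * r)%g v) w.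

Definition sums_star (a : G -> fct) : G -> fct := fun t =>
  alpha t (fun v => Num.conj (a t^-1%g v)).

Definition cstar_seminorm (p : (G -> fct) -> R[i]) : Prop :=
  [/\ forall a, finite_sums a -> 0 <= p a,
      forall a b, finite_sums a -> finite_sums b -> p (a + b) <= p a + p b,
      forall (k : R[i]) a, finite_sums a -> p (k *: a) = `|k| * p a,
      forall a b, finite_sums a -> finite_sums b ->
        p (sums_mul a b) <= p a * p b &
      forall a, finite_sums a -> p (sums_mul (sums_star a) a) = p a ^+ 2].

(* E, together with the canonical map iota from the *-algebra of finite sums, *)
(* is the completion of that *-algebra for its largest C*-seminorm.           *)
Definition is_crossed_product (E : cstarAlgType R) (iota : (G -> fct) -> E) :
    Prop :=
  [/\ forall (k : R[i]) a b, finite_sums a -> finite_sums b ->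
        iota (k *: a + b) = k *: iota a + iota b,
      forall a b, finite_sums a -> finite_sums b ->
        iota (sums_mul a b) = cmul (iota a) (iota b),
      forall a, finite_sums a -> iota (sums_star a) = cstar (iota a),
      closure (iota @` finite_sums) = [set: E] &
      forall p, cstar_seminorm p ->
        forall a, finite_sums a -> p a <= `|iota a|].

End Toeplitz.

Section Phi.
Variables (R : realType) (S : choiceType) (e : rel S).
Local Notation A := (raag e).
Local Notation Aplus := (@raag_pos S e).

Local Notation Omega := (nica_spectrum Aplus).

Definition one_gen (s : S) : {ptws A -> bool} -> R[i]^o :=
  \1_(nica_cyl Aplus (raag_gen e s)).

(* the product of the 1 - 1_s over s in S_B, taken in C(Omega), whose unit is *)
(* \1_Omega                                                                   *)
Definition defect_fun (B : set (set S)) : {ptws A -> bool} -> R[i]^o := fun w =>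
  \1_Omega w *
  \big[*%R/1]_(s \in vertices B) (\1_Omega w - one_gen s w).

Variables (E : cstarAlgType R) (iota : (A -> {ptws A -> bool} -> R[i]^o) -> E).

Definition defect (B : set (set S)) : E := iota (single 1%g (defect_fun B)).

Definition phi (I : set (set (set S))) : set E :=
  closed_ideal_gen (defect @` I).

End Phi.

(* Main.v *)
(* Write P for A^+ and Omega for the Nica spectrum. A point w of Omega lies in  *)
(* the orbit of {v : v avoids S_B} iff s notin r^-1 w for all s in S_B and some *)
(* r in w; an ideal I of P(Lambda_f) thus defines the closed invariant set      *)
(* W_I of the points lying in no such orbit for B in I. Every neighbourhood of  *)
(* w contains, for some B such that w lies in the orbit of {v : v avoids S_B},  *)
(* a translate of each v avoiding S_B; hence a closed ideal J containing some   *)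
(* f in C(Omega) with f(w) != 0 contains the defect of such a B. As no factor   *)
(* is Z, the action of A is free on a dense subset of every W_I, so that        *)
(* compressing an element of J by the indicator of a small clopen set           *)
(* brings it near a multiple of that indicator. This shows that J is contained  *)
(* in the ideal L_I of the x such that the delta_1-coefficients of all b x c    *)
(* vanish on W_I, where I = {B : the defect of B lies in J}.                    *)
(*                                                                              *)
(* Conversely L_I is contained in phi(I). This is amenability: if p_k(w) is     *)
(* the largest element of w in P whose degrees are bounded by k, then the       *)
(* multipliers [p_k(w) = t p_k'(t^-1 w)] are contractive, being products of     *)
(* averages over signs; together with the Fejer kernels of the gauge action     *)
(* they approximate every element of L_I by finite sums with coefficients       *)
(* that vanish on W_I, up to an element of phi(I) (Exel's approximation         *)
(* property). Injectivity of phi follows as every B has a point w avoiding S_B  *)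
(* and lying in the orbit of {v : v avoids S_C} only for C contained in B.      *)

Require Import Defs.
From HB Require Import structures.
From mathcomp Require Import all_boot all_order all_algebra.
From mathcomp Require Import zify ring complex.
From mathcomp Require Import all_classical all_reals all_analysis.

Set Implicit Arguments.
Unset Strict Implicit.
Unset Printing Implicit Defensive.

Import Order.TTheory GRing.Theory Num.Theory numFieldNormedType.Exports.

Local Open Scope classical_set_scope.
Local Open Scope complex_scope.
Local Open Scope ring_scope.

(** * Normal forms in right-angled Artin groups *)

(** The proof compares three things attached to an ideal [I] of finite sets of factors: the
    invariant set [points I] of the spectrum, the closed ideal [phi iota I], and the ideal
    [residual P iota (points I)] of the elements whose [delta_1]-coefficients, also after
    multiplication on both sides, vanish on [points I]. It shows that the last two coincide and that
    every closed ideal is of this kind.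

    Geometry of the spectrum. By [spectrum_core], a neighbourhood of a point contains a translate of
    all points avoiding some finite set [B] of finite factors. Finitely many membership conditions
    reduce to a list of forbidden positive elements; those with a letter in a fully listed factor
    are excluded by avoiding [B], and the others by multiplying with a walk in the opposite graph.
    [spectrum_witness] supplies, for each [B], a point lying in the orbits of subsets of [B] only.
    Both rest on the solution of the word problem ([reduced_uniq]), on the existence of joins
    ([is_join_exists]) and on generators having upper bounds in common only if they commute
    ([gen_le2]).

    Every ideal is contained in a residual. If an element of a closed ideal [J] had a large
    coefficient at a point, compression by the indicator of a small cylinder would bring it near a
    multiple of that indicator, because nontrivial group elements move some nearby cylinder off
    itself ([spectrum_free], [free_cylinder]; here the absence of factors $(\mathbb Z,\mathbb N)$
    enters). The indicator, and then a defect, would lie in [J] ([ideal_point]). This gives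
    [ideal_residual].

    Every residual is contained in the ideal generated by its defects. This is amenability
    ([residual_sub], [residual_phi]): contractive multipliers of finite support ([contractive_psi]),
    combined with Fejer means of the gauge action ([good_degk]), approximate the identity, and a
    finite sum whose coefficients are small on [points I] is close to [phi iota I] by compactness
    ([phi_small]).

    Hence [phi_ideal_sets], which is surjectivity. For [phi_subset], the coefficients of the regular
    representations ([crossed_product_coef]) separate the ideals at the points of
    [spectrum_witness]. *)

Section Words.
Variables (T : choiceType) (e : rel T).
Hypotheses (e_sym : symmetric e) (e_irr : irreflexive e).
Local Notation letter := (T * bool)%type.
Local Notation wd := (@raag_word T e).

Definition linv (a : letter) : letter := (a.1, ~~ a.2).

Lemma linvK : involutive linv.
Proof. by case=> s b; rewrite /linv /= negbK. Qed.

Definition pair_proj (s c : T) (u : seq letter) :=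
  [seq x <- u | (x.1 == s) || (x.1 == c)].

(* Trace equivalence: two words have the same image in the free monoid on     *)
(* every pair of non-commuting generators.                                    *)
Definition treq (u v : seq letter) : Prop :=
  forall s c, ~~ e s c -> pair_proj s c u = pair_proj s c v.

Lemma pair_proj_cat s c u v :
  pair_proj s c (u ++ v) = pair_proj s c u ++ pair_proj s c v.
Proof. exact: filter_cat. Qed.

Lemma treq_sym u v : treq u v -> treq v u.
Proof. by move=> uv s c /uv. Qed.

Lemma treq_trans v u w : treq u v -> treq v w -> treq u w.
Proof. by move=> uv vw s c sc; rewrite uv ?vw. Qed.

Lemma treq_cat u u' v v' : treq u u' -> treq v v' -> treq (u ++ v) (u' ++ v').
Proof. by move=> uu vv s c sc; rewrite !pair_proj_cat uu ?vv. Qed.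

Lemma treq_cons a u v : treq u v -> treq (a :: u) (a :: v).
Proof. by move=> uv; rewrite -cat1s -(cat1s a v); exact: treq_cat. Qed.

Lemma treq_cons_inj a u v : treq (a :: u) (a :: v) -> treq u v.
Proof. by move=> uv s c /uv /=; case: ifP => // _ []. Qed.

Lemma treq_nil u : treq [::] u -> u = [::].
Proof.
by case: u => // x u /(_ x.1 x.1); rewrite e_irr /= eqxx => /(_ isT).
Qed.

(** Partial left division by a letter: it succeeds only if every letter before the first [a]
    commutes with [a]. The inverse of [a] blocks it, since [e] is irreflexive. *)
Fixpoint strip (a : letter) (w : seq letter) : option (seq letter) :=
  if w is x :: w' then
    if x == a then Some w'
    else if e a.1 x.1 then omap (cons x) (strip a w') else None
  else None.

Lemma treq_swap a x u : e a.1 x.1 -> treq (a :: x :: u) (x :: a :: u).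
Proof.
move=> ax s c sc /=; case: ifP => // /orP a_sc; case: ifP => // /orP x_sc.
have cs : e c s = false by rewrite e_sym (negPf sc).
by case: a_sc => /eqP as_; case: x_sc => /eqP xs; move: ax;
  rewrite as_ xs ?e_irr ?cs ?(negPf sc).
Qed.

Lemma strip_treq a w w' : strip a w = Some w' -> treq w (a :: w').
Proof.
elim: w w' => // x w IHw w' /=; case: eqP => [-> [->] //|_].
case: ifP => // ax; case E: strip => [w1|] // [<-].
exact/(treq_trans (treq_cons x (IHw _ E)))/treq_sym/treq_swap.
Qed.

(** A letter that blocks [a] would be the head of the projection on the pair formed by the two
    generators. The pair [a.1], [a.1] ensures that [a] occurs and that its inverse does not come
    first. *)
Lemma strip_head a w :
  (forall c, ~~ e a.1 c -> ohead (pair_proj a.1 c w) = Some a) ->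
  strip a w != None.
Proof.
elim: w => [/(_ a.1)|x w IHw hd]; first by rewrite e_irr => /(_ isT).
rewrite /=; case: (x =P a) => // xa; have [ax|ax] := boolP (e a.1 x.1); last first.
  by have /= := hd _ ax; rewrite eqxx orbT /= => -[/xa].
suff : strip a w != None by case: strip.
apply: IHw => c ac; have := hd c ac; rewrite /=; case: ifP => // /orP[] /eqP xc.
  by rewrite xc e_irr in ax.
by rewrite xc (negPf ac) in ax.
Qed.

Lemma treq_strip a w w2 : treq w (a :: w2) ->
  exists2 w', strip a w = Some w' & treq w' w2.
Proof.
move=> ww; have /strip_head : forall c, ~~ e a.1 c ->
  ohead (pair_proj a.1 c w) = Some a by move=> c /ww->; rewrite /= eqxx.
case E: strip => [w'|] // _; exists w' => //.
exact/(treq_cons_inj (a := a))/(treq_trans _ ww)/treq_sym/strip_treq.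
Qed.

Lemma strip_cat a u v : strip a (u ++ v) =
  if strip a u is Some u' then Some (u' ++ v)
  else if all (fun x => (x != a) && e a.1 x.1) u then
    omap (cat u) (strip a v) else None.
Proof.
elim: u => [|x u IHu] /=; first by case: strip.
case: (x =P a) => //= _; case: (e a.1 x.1) => //=; rewrite IHu.
by case: (strip a u) => //=; case: ifP => //; case: (strip a v).
Qed.

(** The condition ranges over all rearrangements of [u], so that no cancellation is hidden by
    commutations. *)
Definition reduced (u : seq letter) : Prop :=
  forall u1 a u2, ~ treq u (u1 ++ a :: linv a :: u2).

Lemma reduced_treq u v : treq u v -> reduced u -> reduced v.
Proof. by move=> uv ru u1 a u2 /(treq_trans uv) /ru. Qed.

Lemma reduced_behead a u : reduced (a :: u) -> reduced u.
Proof. by move=> ru u1 b u2 /(treq_cons a) /(ru (a :: u1)). Qed.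

Lemma reduced_strip a u : reduced (a :: u) -> strip (linv a) u = None.
Proof.
move=> ru; case E: strip => [u'|] //.
by case: (ru [::] a u'); apply: treq_cons; exact: strip_treq.
Qed.

Lemma treq_pull a u v : all (fun x => (x != a) && e a.1 x.1) u ->
  treq (u ++ a :: v) (a :: u ++ v).
Proof.
elim: u => [|x u IHu] //= /andP[/andP[_ ax] /IHu auv].
exact/(treq_trans (treq_cons x auv))/treq_sym/treq_swap.
Qed.

(** In a rearrangement of [a :: w] with a cancelling pair, remove the letter [a]: either the pair
    survives in a rearrangement of [w], or [a] belonged to it and its partner can be brought to the
    front of [w]. *)
Lemma reduced_cons a w :
  reduced w -> strip (linv a) w = None -> reduced (a :: w).
Proof.
move=> rw sw u1 b u2 aw; have [w2] := treq_strip (treq_sym aw).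
rewrite strip_cat; case E: strip => [u1'|].
  by move=> [<-] /treq_sym /rw.
case: ifP => // au1 /=; case: eqP => [ba|ba]; last first.
  case: ifP => // ab /=; case: eqP => [ba'|_].
    by rewrite -ba' e_irr in ab.
  by case: ifP => //=; case: strip => //= u3 _ [<-] /treq_sym /rw.
move=> [<-]; rewrite ba => /treq_sym w1.
have /treq_strip[u3] : treq w (linv a :: u1 ++ u2).
  apply: (treq_trans w1); apply: treq_pull; apply: sub_all au1 => x /andP[_].
  by move=> /[dup] ax -> /=; case: eqP ax => // -> ; rewrite e_irr.
by rewrite sw.
Qed.

Definition push (a : letter) (w : seq letter) : seq letter :=
  if strip (linv a) w is Some w' then w' else a :: w.

Definition pushes (u w : seq letter) : seq letter := foldr push w u.

Lemma reduced_push a w : reduced w -> reduced (push a w).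
Proof.
move=> rw; rewrite /push; case E: strip => [w'|]; last exact: reduced_cons.
exact/reduced_behead/(reduced_treq (strip_treq E)).
Qed.

Lemma reduced_pushes u w : reduced w -> reduced (pushes u w).
Proof. by move=> rw; elim: u => //= a u; exact: reduced_push. Qed.

Lemma treq_push a u v : treq u v -> treq (push a u) (push a v).
Proof.
move=> uv; rewrite /push; case Eu: (strip _ u) => [u'|].
  have /treq_strip[v' -> v'u'] := treq_trans (treq_sym uv) (strip_treq Eu).
  exact: treq_sym.
case Ev: (strip _ v) => [v'|]; last exact: treq_cons.
by have /treq_strip[u'] := treq_trans uv (strip_treq Ev); rewrite Eu.
Qed.

Lemma treq_pushes u v w : treq v w -> treq (pushes u v) (pushes u w).
Proof. by move=> vw; elim: u => //= a u; exact: treq_push. Qed.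

Lemma push_linv a w : reduced w -> treq (push a (push (linv a) w)) w.
Proof.
move=> rw; rewrite {2}/push linvK; case E: strip => [w'|].
  have r' := reduced_treq (strip_treq E) rw.
  rewrite /push (reduced_strip r').
  exact/treq_sym/strip_treq.
by rewrite /push /= eqxx.
Qed.

Lemma strip_comm_cons a b w : e a.1 b.1 ->
  strip a (b :: w) = omap (cons b) (strip a w).
Proof. by move=> ab /=; case: eqP ab => [->|_ -> //]; rewrite e_irr. Qed.

Lemma push_comm a b w : e a.1 b.1 ->
  treq (push a (push b w)) (push b (push a w)).
Proof.
move=> ab; have ba : e b.1 a.1 by rewrite e_sym.
have commute_some c d v v' : e c.1 d.1 -> strip (linv c) v = Some v' ->
    treq (push c (push d v)) (push d v').
  move=> cd Ev; have vv := strip_treq Ev; apply: treq_trans (treq_push c _) _.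
    exact: (treq_push d vv).
  rewrite /push strip_comm_cons; last by rewrite /= e_sym.
  case: (strip (linv d) v') => [v2|] /=; first by rewrite eqxx.
  by rewrite (_ : (d == linv c) = false) ?cd ?eqxx //;
    case: eqP cd => // ->; rewrite e_irr.
case Ea: (strip (linv a) w) => [w1|].
  by rewrite (_ : push a w = w1) ?/push ?Ea //; exact: commute_some.
case Eb: (strip (linv b) w) => [w1|].
  rewrite (_ : push b w = w1) ?/push ?Eb //; apply: treq_sym.
  exact: commute_some.
rewrite /push Ea Eb !strip_comm_cons // Ea Eb /=.
exact: treq_swap.
Qed.

(** Van der Waerden's argument: the letters act by [push] on reduced words up to commutation, and
    the action respects the defining relations. Acting on the empty word then shows that a reduced
    word is determined, up to commutation, by its group element. *)
Lemma raag_rel_pushes u v w : raag_rel e u v -> reduced w ->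
  treq (pushes u w) (pushes v w).
Proof.
move=> uv; elim: uv w => {u v}.
- by [].
- by move=> u v _ IH w /IH /treq_sym.
- by move=> u v w _ IH1 _ IH2 x rx; exact: treq_trans (IH1 _ rx) (IH2 _ rx).
- move=> u u' v v' _ IH1 _ IH2 w rw; rewrite /pushes !foldr_cat.
  apply: treq_trans (treq_pushes u (IH2 _ rw)) _.
  by apply: IH1; exact: reduced_pushes.
- by move=> a b w rw; exact: (@push_linv (a, b)).
- by move=> a b ab w _; exact: (@push_comm (a, true) (b, true)).
Qed.

Lemma pushes_reduced u : reduced u -> treq (pushes u [::]) u.
Proof.
elim: u => //= a u IHu ru.
apply: treq_trans (treq_push a (IHu (reduced_behead ru))) _.
by rewrite /push reduced_strip.
Qed.

Lemma reduced_nil : reduced [::].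
Proof. by move=> u1 a u2 /treq_nil; case: u1. Qed.

Lemma reduced_uniq u v : reduced u -> reduced v -> wd u = wd v -> treq u v.
Proof.
move=> ru rv /raag_wordP uv.
apply: treq_trans (treq_sym (pushes_reduced ru)) _.
apply: treq_trans (pushes_reduced rv).
by apply: raag_rel_pushes uv _; exact: reduced_nil.
Qed.

Lemma raag_word_cat u v : wd (u ++ v) = (wd u * wd v)%g.
Proof. by rewrite -raag_mulE. Qed.

Lemma raag_word_cons a u : wd (a :: u) = (wd [:: a] * wd u)%g.
Proof. by rewrite -cat1s raag_word_cat. Qed.

Lemma raag_word1 a :
  wd [:: a] = if a.2 then raag_gen e a.1 else ((raag_gen e a.1)^-1)%g.
Proof.
by case: a => s [] //=; apply: esym; exact: (@raag_invE T e [:: (s, true)]).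
Qed.

Lemma raag_word_inv u : wd (word_inv u) = ((wd u)^-1)%g.
Proof. by apply: esym; exact: raag_invE. Qed.

Lemma raag_gen_comm s t : e s t -> commute (raag_gen e s) (raag_gen e t).
Proof.
move=> st; rewrite /commute /raag_gen -!raag_word_cat.
exact/raag_wordP/raag_comm.
Qed.

Lemma raag_letter_comm a b : e a.1 b.1 -> commute (wd [:: a]) (wd [:: b]).
Proof.
move=> /raag_gen_comm ab; rewrite !raag_word1.
by case: a.2 b.2 => -[] //; [exact: commuteV|apply/commute_sym/commuteV/commute_sym
  |apply/commuteV/commute_sym/commuteV/commute_sym].
Qed.

Lemma strip_word a w w' : strip a w = Some w' -> wd w = wd (a :: w').
Proof.
elim: w w' => // x w IHw w' /=; case: eqP => [-> [->] //|_].
case: ifP => // ax; case E: strip => [w1|] // [<-].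
have cons2 y z : wd (y :: z :: w1) = (wd [:: y] * wd [:: z] * wd w1)%g.
  by rewrite raag_word_cons (raag_word_cons z) mulgA.
by rewrite raag_word_cons (IHw _ E) -raag_word_cons !cons2 (raag_letter_comm ax).
Qed.

Lemma treq_word u v : treq u v -> wd u = wd v.
Proof.
elim: u v => [v /treq_nil -> //|a u IHu v /treq_sym /treq_strip[v' Ev vu]].
by rewrite (strip_word Ev) raag_word_cons (IHu v') ?(raag_word_cons a v') //; exact: treq_sym.
Qed.

End Words.

(** * The positive monoid: degrees, common upper bounds and joins *)

Section Positive.
Variables (T : choiceType) (e : rel T).
Hypotheses (e_sym : symmetric e) (e_irr : irreflexive e).
Local Notation G := (raag e).
Local Notation letter := (T * bool)%type.
Local Notation wd := (@raag_word T e).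
Local Notation gen := (raag_gen e).
Local Notation P := (@raag_pos T e).
Local Notation le := (qle P).

Definition pos_word (u : seq T) : seq letter := [seq (s, true) | s <- u].

Lemma wd_pos_cons s u : wd (pos_word (s :: u)) = (gen s * wd (pos_word u))%g.
Proof. exact: raag_word_cons. Qed.

Lemma wd_pos_cat u v :
  wd (pos_word (u ++ v)) = (wd (pos_word u) * wd (pos_word v))%g.
Proof. by rewrite /pos_word map_cat raag_word_cat. Qed.

Lemma raag_pos1 : P 1%g. Proof. by move=> M [[]]. Qed.

Lemma raag_posM x y : P x -> P y -> P (x * y)%g.
Proof.
move=> Px Py M MP; have [[_ MM] _] := MP.
by apply: MM; [exact: Px|exact: Py].
Qed.

Lemma raag_pos_gen s : P (gen s).
Proof. by move=> M [_]; apply; exists s. Qed.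

Lemma raag_pos_word u : P (wd (pos_word u)).
Proof.
elim: u => [|s u IHu]; first exact: raag_pos1.
by rewrite wd_pos_cons; apply: raag_posM => //; exact: raag_pos_gen.
Qed.

Lemma raag_posP x : P x -> exists u, x = wd (pos_word u).
Proof.
move=> /(_ [set y | exists u, y = wd (pos_word u)]); apply.
split=> [|_ [s _ <-]]; last by exists [:: s].
split=> [|_ _ [u ->] [v ->]]; first by exists [::].
by exists (u ++ v); rewrite wd_pos_cat.
Qed.

Lemma raag_pos_case x : P x -> x = 1%g \/ exists s y, P y /\ x = (gen s * y)%g.
Proof.
move=> /raag_posP[[|s u] ->]; [by left|right].
by exists s, (wd (pos_word u)); rewrite wd_pos_cons; split=> //; exact: raag_pos_word.
Qed.

Definition wdeg (f : T -> int) (u : seq letter) : int :=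
  \sum_(a <- u) (if a.2 then f a.1 else - f a.1).

Lemma wdeg_cat f u v : wdeg f (u ++ v) = wdeg f u + wdeg f v.
Proof. exact: big_cat. Qed.

Lemma wdeg_rel f u v : raag_rel e u v -> wdeg f u = wdeg f v.
Proof.
elim=> {u v} [//|//|u v w _ -> _ -> //|u u' v v' _ uu _ vv|a b|a b _].
- by rewrite !wdeg_cat uu vv.
- by rewrite /wdeg !big_cons big_nil /=; case: b; rewrite /= addr0 ?subrr ?addNr.
- by rewrite /wdeg !big_cons big_nil /= !addr0 addrC.
Qed.

Definition raag_deg (f : T -> int) (x : G) : int := wdeg f (repr x).

Lemma raag_deg_word f u : raag_deg f (wd u) = wdeg f u.
Proof. exact/wdeg_rel/raag_repr. Qed.

Lemma raag_degM f x y : raag_deg f (x * y)%g = raag_deg f x + raag_deg f y.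
Proof.
have [u ->] := raag_word_surj x; have [v ->] := raag_word_surj y.
by rewrite -raag_word_cat !raag_deg_word wdeg_cat.
Qed.

Lemma raag_deg1 f : raag_deg f 1%g = 0.
Proof. by rewrite (_ : 1%g = wd [::]) // raag_deg_word /wdeg big_nil. Qed.

Lemma raag_degV f x : raag_deg f (x^-1)%g = - raag_deg f x.
Proof.
apply/eqP; rewrite -addr_eq0 -raag_degM.
by rewrite mulVg raag_deg1.
Qed.

Lemma raag_deg_gen f s : raag_deg f (gen s) = f s.
Proof. by rewrite raag_deg_word /wdeg big_seq1. Qed.

(** The exponent sum of [s], a coordinate of the abelianisation. On positive elements it counts the
    occurrences of [s]. *)
Definition ab (s : T) : G -> int := raag_deg (fun t => (t == s)%:Z).
Definition len : G -> int := raag_deg (fun=> 1%:Z).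

Lemma ab_gen s t : ab s (gen t) = (t == s)%:Z.
Proof. exact: raag_deg_gen. Qed.

Lemma ab_genM t s x : ab t (gen s * x)%g = (s == t)%:Z + ab t x.
Proof. by rewrite /ab raag_degM raag_deg_gen. Qed.

Lemma lenM x y : len (x * y)%g = len x + len y.
Proof. exact: raag_degM. Qed.

Lemma abM s x y : ab s (x * y)%g = ab s x + ab s y.
Proof. exact: raag_degM. Qed.

Lemma abV s x : ab s (x^-1)%g = - ab s x.
Proof. exact: raag_degV. Qed.

Lemma ab_word s u : ab s (wd (pos_word u)) = (count_mem s u)%:Z.
Proof.
elim: u => [|t u IHu]; first by rewrite [LHS]raag_deg1.
by rewrite wd_pos_cons ab_genM IHu /= PoszD.
Qed.

Lemma len_word u : len (wd (pos_word u)) = (size u)%:Z.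
Proof.
elim: u => [|t u IHu]; first by rewrite [LHS]raag_deg1.
by rewrite wd_pos_cons lenM IHu [len _]raag_deg_gen /= -PoszD.
Qed.

Lemma ab_ge0 s x : P x -> 0 <= ab s x.
Proof. by move=> /raag_posP[u ->]; rewrite ab_word. Qed.

Lemma len_ge0 x : P x -> 0 <= len x.
Proof. by move=> /raag_posP[u ->]; rewrite len_word. Qed.

Lemma len_eq0 x : P x -> len x = 0 -> x = 1%g.
Proof. by move=> /raag_posP[[|s u] ->]; rewrite len_word. Qed.

Lemma ab_eq0 x : P x -> (forall s, ab s x = 0) -> x = 1%g.
Proof.
move=> /raag_posP[[|s u] ->] // /(_ s).
by rewrite ab_word /= eqxx.
Qed.

Lemma qle_refl x : le x x.
Proof. by rewrite /qle mulVg; exact: raag_pos1. Qed.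

Lemma qle_trans y x z : le x y -> le y z -> le x z.
Proof.
by move=> xy yz; have := raag_posM xy yz; rewrite -mulgA mulVKg.
Qed.

Lemma qle_mulr x p : P p -> le x (x * p)%g.
Proof. by rewrite /qle mulKg. Qed.

Lemma qle_mulr_word x u : le x (x * wd (pos_word u))%g.
Proof. by apply: qle_mulr; exact: raag_pos_word. Qed.

Lemma qle_mulr_gen x s : le x (x * gen s)%g.
Proof. by apply: qle_mulr; exact: raag_pos_gen. Qed.

Lemma qleM2l g x y : le (g * x)%g (g * y)%g = le x y.
Proof. by rewrite /qle invgM -mulgA mulKg. Qed.

Lemma qle_divl g x y : le x (g^-1 * y)%g = le (g * x)%g y.
Proof. by rewrite -(qleM2l g x) mulVKg. Qed.

Lemma qle1 x : le 1%g x = P x.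
Proof. by rewrite /qle invg1 mul1g. Qed.

Lemma qle_pos x y : P x -> le x y -> P y.
Proof. by rewrite -!qle1; exact: qle_trans. Qed.

Lemma qle_exists x y : le x y -> exists2 p, P p & y = (x * p)%g.
Proof. by move=> xy; exists (x^-1 * y)%g => //; rewrite mulVKg. Qed.

Lemma qle_ab s x y : le x y -> ab s x <= ab s y.
Proof.
by move=> /qle_exists[p /(ab_ge0 s) p0 ->]; rewrite /ab raag_degM lerDl.
Qed.

Lemma qle_len x y : le x y -> len x <= len y.
Proof.
by move=> /qle_exists[p /len_ge0 p0 ->]; rewrite /len raag_degM lerDl.
Qed.

Lemma qle_len_eq x y : le x y -> len y <= len x -> x = y.
Proof.
move=> /qle_exists[p Pp ->]; rewrite /len raag_degM gerDl => p0.
rewrite (len_eq0 Pp) ?mulg1 //; apply/eqP.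
by rewrite eq_le p0 len_ge0.
Qed.

Lemma qle_anti x y : le x y -> le y x -> x = y.
Proof. by move=> xy /qle_len; exact: qle_len_eq. Qed.

Lemma is_join_uniq x y z z' : is_join P x y z -> is_join P x y z' -> z = z'.
Proof.
by move=> [xz yz zm] [xz' yz' zm']; apply: qle_anti; [exact: zm|exact: zm'].
Qed.

Lemma treq_mem u v x : treq e u v -> (x \in u) = (x \in v).
Proof.
have mem w : (x \in w) = (x \in pair_proj x.1 x.1 w).
  by rewrite mem_filter eqxx.
by move=> uv; rewrite mem [in RHS]mem uv // e_irr.
Qed.

Lemma strip_mem a w w' : strip e a w = Some w' -> {subset a :: w' <= w}.
Proof.
elim: w w' => // x w IHw w' /=; case: (x =P a) => [<- [<-] //|_].
case: ifP => // _; case E: strip => [w1|] // [<-] y.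
rewrite !inE => /or3P[/eqP->|->//|yw1]; apply/orP; right; apply: (IHw _ E).
  exact: mem_head.
by rewrite inE yw1 orbT.
Qed.

Lemma pos_word_sub w u : {subset w <= pos_word u} -> exists v, w = pos_word v.
Proof.
elim: w => [|x w IHw] sub; first by exists [::].
have [|v ->] := IHw; first by move=> y yw; apply: sub; rewrite inE yw orbT.
by have /mapP[s _ ->] := sub x (mem_head _ _); exists (s :: v).
Qed.

Lemma strip_pos s u w : strip e (s, true) (pos_word u) = Some w ->
  le (gen s) (wd (pos_word u)).
Proof.
move=> E; have [v wv] : exists v, w = pos_word v.
  apply: (@pos_word_sub _ u) => x xw.
  by apply: (strip_mem E); rewrite inE xw orbT.
rewrite (strip_word E) wv -/(pos_word (s :: v)) wd_pos_cons.
exact: qle_mulr_word.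
Qed.

Lemma reduced_pos u : reduced e (pos_word u).
Proof.
move=> u1 a u2 /treq_mem eq_mem.
have neg s : (s, false) \notin pos_word u by apply/negP => /mapP[].
have /negP := neg a.1; apply; rewrite eq_mem mem_cat !inE.
by case: a {eq_mem} => s [] /=; rewrite !eqxx ?orbT.
Qed.

(** Positive words are reduced, so two of them for [z] differ by commutations only; two distinct
    letters can both be brought to the front only if they commute. *)
Lemma gen_le2 s t z : s != t -> le (gen s) z -> le (gen t) z ->
  e s t /\ le (gen s * gen t)%g z.
Proof.
move=> st /qle_exists[_ /raag_posP[u ->] ->] /qle_exists[_ /raag_posP[v ->]].
rewrite -!wd_pos_cons => /(reduced_uniq e_sym e_irr (@reduced_pos _) (@reduced_pos _)).
move=> /(treq_strip e_sym e_irr)[w' + _]; rewrite wd_pos_cons qleM2l.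
rewrite -[pos_word (s :: u)]/((s, true) :: pos_word u) /= xpair_eqE (negPf st) /=.
rewrite e_sym; case: (e s t) => //; case E: strip => [w1|] // _.
by split=> //; exact: strip_pos E.
Qed.

(** Peel off the letters of [b]: each differs from [s], hence commutes with it by [gen_le2], and
    cancelling it keeps [s] below the bound. *)
Lemma gen_le_disjoint s b z : P b -> ab s b = 0 -> le (gen s) z -> le b z ->
  (forall c, 0 < ab c b -> e s c) /\ le (gen s * b)%g z.
Proof.
move=> /raag_posP[u ->]; elim: u z => [z _|t u IHu z].
  split; last by rewrite (_ : wd _ = 1%g) ?mulg1.
  by move=> c; rewrite ab_word.
rewrite ab_word /=; case: eqP => //= /eqP ts u0 sz.
rewrite wd_pos_cons => uz.
have tz : le (gen t) z by apply: qle_trans uz; exact: qle_mulr_word.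
have [est stz] := gen_le2 ts tz sz.
have [||| euc suz] := IHu ((gen t)^-1 * z)%g.
- by rewrite ab_word.
- by rewrite qle_divl.
- by rewrite qle_divl.
split=> [c|].
  rewrite -wd_pos_cons ab_word /=; case: (t =P c) => [<- _|_].
    by rewrite e_sym.
  by move=> uc; apply: euc; rewrite ab_word.
move: suz; rewrite qle_divl mulgA -(raag_gen_comm (e := e)) ?mulgA //.
by rewrite e_sym.
Qed.

Lemma commute_content s b : P b -> (forall c, 0 < ab c b -> e s c) ->
  commute (gen s) b.
Proof.
move=> /raag_posP[u ->]; elim: u => [_|c u IHu sc]; first exact: commute1.
rewrite wd_pos_cons; apply: commuteM.
  by apply/raag_gen_comm/sc; rewrite ab_word /= eqxx.
by apply: IHu => d d0; apply: sc; rewrite ab_word; move: d0; rewrite ab_word /= ; case: eqP.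
Qed.

(** The letters of [b] before the first [s] commute with [s] by [gen_le2], so this [s] can be pulled
    to the front. *)
Lemma gen_le_or s b z : P b -> le (gen s) z -> le b z ->
  le (gen s) b \/ ab s b = 0.
Proof.
move=> /raag_posP[u ->]; elim: u z => [z _ _|t u IHu z sz]; first by right; rewrite ab_word.
rewrite wd_pos_cons => uz.
have tz : le (gen t) z by apply: qle_trans uz; exact: qle_mulr_word.
case: (s =P t) => [->|/eqP st]; first by left; exact: qle_mulr_word.
have [est stz] := gen_le2 st sz tz.
have stC := raag_gen_comm est.
have [||su|su] := IHu ((gen t)^-1 * z)%g.
- by rewrite qle_divl -stC.
- by rewrite qle_divl.
- left; apply: (@qle_trans (gen t * gen s)%g); last by rewrite qleM2l.
  by rewrite -stC; exact: qle_mulr_gen.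
- right; rewrite -wd_pos_cons ab_word /= eq_sym (negPf st) add0n.
  by rewrite -ab_word.
Qed.

(** Peel generators off [p]: one that divides [q] is shared, and one that does not occurs nowhere in
    [q] and commutes with it. No existence of joins is presupposed. *)
Lemma qle_bound_ab p q z : P p -> P q -> le p z -> le q z ->
  exists z', [/\ le p z', le q z' & forall s, ab s z' = Num.max (ab s p) (ab s q)].
Proof.
move=> /raag_posP[u ->]; elim: u q z => [q z Pq _ qz|s u IHu q z Pq uz qz].
  rewrite (_ : wd _ = 1%g) //; exists q; split; rewrite ?qle1 //; first exact: qle_refl.
  by move=> s; rewrite /ab raag_deg1 -/(ab s _) max_r ?ab_ge0.
rewrite wd_pos_cons in uz *.
have sz : le (gen s) z by apply: qle_trans uz; exact: qle_mulr_word.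
have uz' : le (wd (pos_word u)) ((gen s)^-1 * z)%g by rewrite qle_divl.
have [sq|sq0] := gen_le_or Pq sz qz.
  have [q' Pq' qE] := qle_exists sq.
  have [|z' [uz1 qz1 abz]] := IHu q' ((gen s)^-1 * z)%g Pq' uz'.
    by rewrite qle_divl -qE.
  exists (gen s * z')%g; split; rewrite ?qE ?qleM2l // => t.
  by rewrite !ab_genM abz addr_maxr.
have [sc sqz] := gen_le_disjoint Pq sq0 sz qz.
have [|z' [uz1 qz1 abz]] := IHu q ((gen s)^-1 * z)%g Pq uz'.
  by rewrite qle_divl.
exists (gen s * z')%g; split; rewrite ?qleM2l //.
  apply: (@qle_trans (gen s * q)%g); last by rewrite qleM2l.
  by rewrite (commute_content Pq sc); exact: qle_mulr_gen.
move=> t; rewrite !ab_genM abz; case: (s =P t) => [<-|_]; last by rewrite !add0r.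
by rewrite sq0 !max_l ?addr_ge0 ?ab_ge0 //; exact: raag_pos_word.
Qed.

Lemma join_pos x y z : is_join P x y z -> P x -> P z.
Proof. by move=> [xz _ _] /qle_pos; apply. Qed.

Lemma join_ab p q z s : P p -> P q -> is_join P p q z ->
  ab s z = Num.max (ab s p) (ab s q).
Proof.
move=> Pp Pq [pz qz zm]; have [z' [pz' qz' abz]] := qle_bound_ab Pp Pq pz qz.
rewrite -abz.
apply/eqP; rewrite eq_le (qle_ab s (zm _ pz' qz')) abz ge_max /=.
by rewrite (qle_ab s pz) (qle_ab s qz).
Qed.

Definition left_coprime (p q : G) : Prop :=
  forall s, ~ (le (gen s) p /\ le (gen s) q).

Lemma word_inv_rcons u y :
  word_inv (pos_word (rcons u y)) = (y, false) :: word_inv (pos_word u).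
Proof. by rewrite /word_inv /pos_word map_rcons map_rcons rev_rcons. Qed.

Lemma mem_word_inv x u :
  (x \in word_inv (pos_word u)) = (linv x \in pos_word u).
Proof.
rewrite mem_rev; apply/mapP/idP => [[y yu ->]|xu]; first by rewrite linvK.
by exists (linv x) => //; exact/esym/linvK.
Qed.

(** A letter [y] of [u] can cancel the leading inverse letter only by commuting past all of [v]; it
    would then divide both positive words on the left. *)
Lemma reduced_frac v u : left_coprime (wd (pos_word v)) (wd (pos_word u)) ->
  reduced e (word_inv (pos_word v) ++ pos_word u).
Proof.
elim/last_ind: v => [_|v y IHv cop]; first exact: reduced_pos.
have vE : wd (pos_word (rcons v y)) = (wd (pos_word v) * gen y)%g.
  by rewrite -cats1 wd_pos_cat.
rewrite word_inv_rcons /=; apply: reduced_cons => //.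
  apply: IHv => s [sv su]; apply: (cop s); split=> //; apply: (qle_trans sv).
  by rewrite vE; exact: qle_mulr_gen.
rewrite strip_cat /linv /=; case E: strip => [w|].
  have := strip_mem E (mem_head _ _).
  by rewrite mem_word_inv => /mapP[].
case: ifP => // /allP comm; case E' : strip => [w|] //.
case: (cop y); split; last exact: strip_pos E'.
rewrite vE -(commute_content (s := y)); first exact: qle_mulr_word.
  exact: raag_pos_word.
move=> c; rewrite ab_word ltz_nat -has_count has_pred1 => cv.
have /comm /andP[] // : (c, false) \in word_inv (pos_word v).
by rewrite mem_word_inv; apply/mapP; exists c.
Qed.

Lemma treq_filter (Q : pred letter) u v : treq e u v ->
  treq e [seq x <- u | Q x] [seq x <- v | Q x].
Proof.
have swap s c w : pair_proj s c [seq x <- w | Q x] = [seq x <- pair_proj s c w | Q x].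
  by rewrite /pair_proj -!filter_predI; apply: eq_filter => x /=; rewrite andbC.
by move=> uv s c /uv uv'; rewrite !swap uv'.
Qed.

(** Both fractions are reduced words, so they agree up to commutations. Keeping only the inverse
    letters recovers the denominators. *)
Lemma frac_uniq p u q v : P p -> P u -> P q -> P v ->
  left_coprime p u -> left_coprime q v ->
  (p^-1 * u = q^-1 * v)%g -> p = q.
Proof.
move=> /raag_posP[p' ->] /raag_posP[u' ->] /raag_posP[q' ->] /raag_posP[v' ->].
move=> /reduced_frac pu /reduced_frac qv.
rewrite -!raag_word_inv -!raag_word_cat => /(reduced_uniq e_sym e_irr pu qv).
move=> /(treq_filter (fun x => ~~ x.2)).
have filt a b : [seq x <- word_inv (pos_word a) ++ pos_word b | ~~ x.2] =
    word_inv (pos_word a).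
  rewrite filter_cat [X in _ ++ X](_ : _ = [::]) ?cats0; last first.
    by elim: b.
  apply/all_filterP/allP => x; rewrite mem_word_inv => /mapP[s _].
  by case: x => t [].
by rewrite !filt => /(treq_word e_sym e_irr); rewrite !raag_word_inv => /invg_inj.
Qed.

Lemma left_reduce p u : P p -> P u -> exists c p' u',
  [/\ P c, P p' & P u'] /\
  [/\ left_coprime p' u', p = (c * p')%g & u = (c * u')%g].
Proof.
move=> Pp; have [n] := ubnP `|len p|%N; elim: n p u Pp => // n IHn p u Pp pn Pu.
have [[s [/qle_exists[p1 Pp1 pE] /qle_exists[u1 Pu1 uE]]]|cop] :=
  pselect (exists s, le (gen s) p /\ le (gen s) u); last first.
  exists 1%g, p, u; rewrite !mul1g; split; split=> //; first exact: raag_pos1.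
  by move=> s su; apply: cop; exists s.
have [|c [p2 [u2 [[Pc Pp2 Pu2] [cop p1E u1E]]]]] := IHn p1 u1 Pp1 _ Pu1.
  move: pn (len_ge0 Pp1); rewrite pE lenM [len (gen s)]raag_deg_gen.
  by move: (len p1) => k; lia.
exists (gen s * c)%g, p2, u2; split; split=> //.
- by apply: raag_posM => //; exact: raag_pos_gen.
- by rewrite pE p1E mulgA.
- by rewrite uE u1E mulgA.
Qed.

Lemma right_reduce p u : P p -> P u -> exists c p' u',
  [/\ P p', P u', p = (p' * c)%g, u = (u' * c)%g &
     forall d p2 u2, P d -> P p2 -> P u2 -> p' = (p2 * d)%g -> u' = (u2 * d)%g ->
       d = 1%g].
Proof.
move=> Pp; have [n] := ubnP `|len p|%N; elim: n p u Pp => // n IHn p u Pp pn Pu.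
have [[d [p1 [u1 [[Pd Pp1 Pu1] [d1 pE uE]]]]]|cop] := pselect (exists d p2 u2,
  [/\ P d, P p2 & P u2] /\ [/\ d <> 1%g, p = (p2 * d)%g & u = (u2 * d)%g]); last first.
  exists 1%g, p, u; rewrite !mulg1; split=> // d p2 u2 Pd Pp2 Pu2 pE uE.
  apply: contrapT => d1; apply: cop.
  by exists d, p2, u2.
have [|c [p2 [u2 [Pp2 Pu2 p1E u1E cop]]]] := IHn p1 u1 Pp1 _ Pu1.
  have : len d <> 0 by move=> /(len_eq0 Pd).
  move: pn (len_ge0 Pp1) (len_ge0 Pd); rewrite pE lenM.
  move: (len p1) (len d) => k l; lia.
exists (c * d)%g, p2, u2; split=> //; first by rewrite pE p1E mulgA.
by rewrite uE u1E mulgA.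
Qed.

(** Remove from [w] a maximal common right factor of $x^{-1}w$ and $y^{-1}w$ to obtain [z]. For any
    other bound [v], the denominator of the reduced fraction $z^{-1}v$ divides both $x^{-1}z$ and
    $y^{-1}z$ on the right, hence is trivial. *)
Lemma is_join_exists x y w : le x w -> le y w -> exists z, is_join P x y z.
Proof.
move=> xw yw; have [c [p [q [Pp Pq pE qE cop]]]] := right_reduce xw yw.
have zx : (w * c^-1 = x * p)%g by rewrite -[w in LHS](mulVKg x) pE -mulgA mulgK.
have zy : (w * c^-1 = y * q)%g by rewrite -[w in LHS](mulVKg y) qE -mulgA mulgK.
exists (w * c^-1)%g; split.
- by rewrite zx; exact: qle_mulr.
- by rewrite zy; exact: qle_mulr.
move=> v xv yv; have [c1 [p1 [a1 [[Pc1 Pp1 Pa1] [cop1 pE1 aE1]]]]] := left_reduce Pp xv.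
have [c2 [q1 [b1 [[Pc2 Pq1 Pb1] [cop2 qE1 bE1]]]]] := left_reduce Pq yv.
have pa : (p1^-1 * a1 = (w * c^-1)^-1 * v)%g.
  by rewrite zx invgM -mulgA aE1 pE1 invgM !mulgA mulgVK.
have qb : (q1^-1 * b1 = (w * c^-1)^-1 * v)%g.
  by rewrite zy invgM -mulgA bE1 qE1 invgM !mulgA mulgVK.
have pq1 := frac_uniq Pp1 Pa1 Pq1 Pb1 cop1 cop2 (etrans pa (esym qb)).
rewrite -pq1 in qE1; have p1_1 := cop _ _ _ Pp1 Pc1 Pc2 pE1 qE1.
by rewrite /qle -pa p1_1 invg1 mul1g.
Qed.

End Positive.

(** * Factors as components of the opposite graph *)

Section Components.
Variables (S : choiceType) (e : rel S).
Hypothesis e_sym : symmetric e.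

Lemma opp_graph_sym : symmetric (opp_graph e).
Proof. by move=> s t; rewrite /opp_graph eq_sym e_sym. Qed.

Lemma component_refl s : component e s s. Proof. by exists [::]. Qed.

Lemma component_trans s t u : component e s t -> component e t u -> component e s u.
Proof.
move=> [p ps <-] [q qs <-]; exists (p ++ q); last by rewrite last_cat.
by rewrite cat_path ps.
Qed.

Lemma component_edge s t : opp_graph e s t -> component e s t.
Proof. by move=> st; exists [:: t]; rewrite //= st. Qed.

Lemma component_sym s t : component e s t -> component e t s.
Proof.
move=> [p ps <-]; elim: p s ps => [s _|u p IHp s /= /andP[su /IHp pu]].
  exact: component_refl.
by apply: (component_trans pu); apply: component_edge; rewrite opp_graph_sym.
Qed.

Lemma component_eq s t : component e s t -> component e s = component e t.
Proof.
move=> st; apply/seteqP; split=> u; apply: component_trans => //.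
exact: component_sym.
Qed.

Lemma factorsE lam s : factors e lam -> lam s -> lam = component e s.
Proof. by move=> [t _ <-] ts; exact: component_eq. Qed.

Definition saturated (Y : set S) : Prop := forall s t, Y s -> ~ Y t -> e s t.

Lemma vertices_saturated B : factor_sets e B -> saturated (vertices B).
Proof.
move=> [_ BF] s t [lam Blam lams] tB; apply: contrapT => /negP est.
apply: (tB); exists lam => //; have [lamF _] := BF _ Blam.
rewrite (factorsE lamF lams); apply: component_edge; rewrite /opp_graph est andbT.
by apply/eqP => st; case: tB; exists lam => //; rewrite -st.
Qed.

End Components.

(** * Factors isomorphic to the integers *)

Section NoInteger.

Lemma raag_singleton (T : choiceType) (e : rel T) (s : T) :
  (forall t, t = s) -> iso_Z_N (@raag_pos T e).
Proof.
move=> sT; pose g := raag_gen e s.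
pose h (z : int) : raag e :=
  match z with Posz n => (g ^+ n)%g | Negz n => (g ^- n.+1)%g end.
have hS z : h (1 + z) = (g * h z)%g.
  case: z => n; first by rewrite /= expgS.
  case: n => [|n]; first by rewrite /h /= mulgV.
  rewrite (_ : 1 + Negz n.+1 = Negz n); last by lia.
  by rewrite /h [in RHS]expgSr invgM mulVKg.
have hP z : h (- 1 + z) = (g^-1 * h z)%g.
  by rewrite -[in RHS](addrK 1 z) (addrC z) -addrA hS mulKg addrC.
have lenE u : raag_word e u = h (wdeg (fun=> 1) u).
  elim: u => [|[t b] u IHu]; first by rewrite /wdeg big_nil.
  rewrite raag_word_cons IHu /wdeg big_cons raag_word1 /= (sT t).
  by case: b; rewrite /= ?hS ?hP.
exists (@len T e); split.
- exists h => [x|z].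
    have [u ->] := raag_word_surj x.
    by rewrite /len raag_deg_word -lenE.
  have lenX n : len (g ^+ n)%g = n%:Z.
    elim: n => [|n IHn]; first exact: raag_deg1.
    by rewrite expgS lenM IHn [len g]raag_deg_gen; lia.
  case: z => n; rewrite /h ?lenX //.
  by rewrite /len raag_degV -/(len _) lenX NegzE.
- exact: lenM.
- apply/seteqP; split=> [_ [x Px <-]|_ [n _ <-]].
    by have := len_ge0 Px; case: (len x) => // n _; exists n.
  exists (raag_word e (pos_word (nseq n s))); last by rewrite len_word size_nseq.
  exact: raag_pos_word.
Qed.

(** An isolated vertex of the opposite graph is a component by itself, and its group is infinite
    cyclic. In this form the hypothesis on the factors enters the freeness argument. *)
Lemma no_isolated (S : choiceType) (e : rel S) :
  (forall lam, factors e lam -> ~ iso_Z_N (@raag_pos lam (@induced_graph S e lam))) ->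
  forall s, exists t, opp_graph e s t.
Proof.
move=> noZN s; apply: contrapT => s_isol.
have lamE : component e s = [set s].
  apply/seteqP; split=> [t [[|u p] /=]|_ ->]; [by move=> _ ->| |exact: component_refl].
  by move=> /andP[su _]; case: s_isol; exists u.
have s_in : s \in component e s by rewrite lamE inE.
apply: (noZN (component e s)); first by exists s.
apply: (@raag_singleton _ _ (exist _ s s_in)) => -[t t_in].
by apply: val_inj; move: t_in => /= /[dup]; rewrite {1}lamE inE.
Qed.

End NoInteger.

(** * The Nica spectrum *)

Section Spectrum.
Variables (G : groupType) (P : set G).
Local Notation subsets := {ptws G -> bool}.
Local Notation Om := (nica_spectrum P).
Local Notation le := (qle P).

(* the partial homeomorphism theta_(t^-1), on the [w] containing [t] *)
Definition gshift (t : G) (w : subsets) : subsets := fun g => w (t * g)%g.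

Lemma gshift1 w : gshift 1%g w = w.
Proof. by apply/funext => g; rewrite /gshift mul1g. Qed.

Lemma gshiftM s t w : gshift t (gshift s w) = gshift (s * t)%g w.
Proof. by apply/funext => g; rewrite /gshift mulgA. Qed.

Lemma gshiftK t w : gshift t^-1 (gshift t w) = w.
Proof. by rewrite gshiftM mulgV gshift1. Qed.

Lemma translate_gshift t w : translate t^-1 w = gshift t w.
Proof. by apply/funext => g; rewrite /translate invgK. Qed.

Lemma spectrum_le w x y : Om w -> w y -> le x y -> w x.
Proof.
move=> [_ her _] wy xy; have := her _ _ wy xy.
by rewrite invgM invgK mulVKg.
Qed.

Lemma spectrum1 w : Om w -> w 1%g. Proof. by case. Qed.

Lemma spectrum_bound w x y : Om w -> w x -> w y -> exists2 z, is_join P x y z & w z.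
Proof. by move=> [_ _]; apply. Qed.

Lemma spectrum_shift w t : Om w -> w t -> Om (gshift t w).
Proof.
move=> Ow wt; have [w1 her dir] := Ow; split; first by rewrite /gshift mulg1.
  by move=> x p wx Pp; rewrite /gshift mulgA; exact: her.
move=> x y wx wy; have [z [xz yz zm] wz] := dir _ _ wx wy.
exists (t^-1 * z)%g; last by rewrite /gshift mulVKg.
have leV u v : le u (t^-1 * v)%g = le (t * u)%g v.
  by rewrite /qle invgM !mulgA.
split; rewrite ?leV // => v xv yv; rewrite /qle invgM invgK -mulgA.
by apply: zm; rewrite /qle invgM -mulgA mulKg.
Qed.

End Spectrum.

(** * Points that avoid the generators of some factors, and their orbits *)

Section RaagSpectrum.
Variables (S : choiceType) (e : rel S).
Hypotheses (e_sym : symmetric e) (e_irr : irreflexive e).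
Local Notation G := (raag e).
Local Notation gen := (raag_gen e).
Local Notation P := (@raag_pos S e).
Local Notation Om := (nica_spectrum P).
Local Notation le := (qle P).
Local Notation subsets := {ptws G -> bool}.

Definition avoids (Y : set S) (w : subsets) : Prop := forall s, Y s -> ~ w (gen s).

Definition orbit_avoids (B : set (set S)) (w : subsets) : Prop :=
  exists r, [/\ P r, w r & avoids (vertices B) (gshift r w)].

Lemma content_word s u : (0 < ab s (raag_word e (pos_word u))) = (s \in u).
Proof. by rewrite ab_word ltz_nat -has_count has_pred1. Qed.

(** Letters outside [Y] commute with those in [Y], so the first letter from [Y] moves to the
    front. *)
Lemma content_first (Y : set S) y s : saturated e Y -> P y -> Y s -> 0 < ab s y ->
  exists2 t, Y t & le (gen t) y.
Proof.
move=> satY /raag_posP[u ->] Ys; elim: u => [|t u IHu]; first by rewrite content_word.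
have [Yt|Yt] := pselect (Y t).
  by move=> _; exists t => //; rewrite wd_pos_cons; exact: qle_mulr_word.
rewrite content_word inE => /predU1P[st|su]; first by rewrite -st in Yt.
have [|t' Yt' t'u] := IHu; first by rewrite content_word.
exists t' => //; rewrite wd_pos_cons.
apply: (@qle_trans _ _ (gen t * gen t')%g); last by rewrite qleM2l.
by rewrite -(raag_gen_comm (satY _ _ Yt' Yt)); exact: qle_mulr_gen.
Qed.

(** By [content_first], [y] has no letter in [Y], so it commutes with each [s] in [Y]; then
    $ys=sy\in w$ would give $s\in w$. *)
Lemma avoids_shift Y w y : saturated e Y -> Om w -> P y -> w y ->
  avoids Y w -> avoids Y (gshift y w).
Proof.
move=> satY Ow Py wy avw s Ys wys; apply: (avw s Ys).
have yY c : 0 < ab c y -> ~ Y c.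
  move=> cy Yc; have [t Yt ty] := content_first satY Py Yc cy.
  exact: (avw t Yt (spectrum_le Ow wy ty)).
have comm : commute (gen s) y.
  by apply: commute_content => // c /yY; exact: satY.
apply: (spectrum_le Ow wys); rewrite -comm.
exact: qle_mulr.
Qed.

(** If $s\in xw$, then [s] and [x] have a common bound in $xw$; as [s] does not occur in [x], they
    commute and $xs\in xw$, that is $s\in w$. *)
Lemma avoids_extend Y w x : saturated e Y -> Om w -> P x ->
  (forall s, 0 < ab s x -> ~ Y s) -> avoids Y w -> avoids Y (gshift x^-1 w).
Proof.
move=> satY Ow Px xY avw s Ys ws; apply: (avw s Ys).
have wx : gshift x^-1 w x by rewrite /gshift mulVg; exact: spectrum1 Ow.
have wV : w x^-1%g by have [w1 her _] := Ow; rewrite -[(x^-1)%g]mul1g; exact: her.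
have Ox := spectrum_shift Ow wV.
have [z [sz xz _] wz] := spectrum_bound Ox ws wx.
have x0 : ab s x = 0.
  apply/eqP; rewrite eq_le ab_ge0 // andbT leNgt; apply/negP => /xY; exact.
have [sc sxz] := gen_le_disjoint e_sym e_irr Px x0 sz xz.
have := spectrum_le Ox wz sxz.
by rewrite (commute_content Px sc) /gshift mulKg.
Qed.

Lemma orbit_avoids_shift B w t : factor_sets e B -> Om w -> w t ->
  orbit_avoids B w -> orbit_avoids B (gshift t w).
Proof.
move=> FB Ow wt [r [Pr wr avr]].
have [z [tz rz _] wz] := spectrum_bound Ow wt wr.
exists (t^-1 * z)%g; split=> //; first by rewrite /gshift mulVKg.
have [y Py zE] := qle_exists rz.
rewrite gshiftM mulVKg zE -gshiftM; apply: avoids_shift => //.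
- exact: vertices_saturated FB.
- exact: spectrum_shift.
- by rewrite /gshift -zE.
Qed.

Lemma spectrum_inv w p : Om w -> P p -> w p^-1%g.
Proof. by move=> [w1 her _] Pp; rewrite -[(p^-1)%g]mul1g; exact: her. Qed.

Lemma spectrum_unshift w p : Om w -> P p -> Om (gshift p^-1 w).
Proof. by move=> Ow Pp; apply: spectrum_shift => //; exact: spectrum_inv. Qed.

Lemma orbit_avoids_unshift B w t : factor_sets e B -> Om w -> w t ->
  orbit_avoids B (gshift t w) -> orbit_avoids B w.
Proof.
move=> FB Ow wt Bw; rewrite -[w](gshiftK t).
apply: orbit_avoids_shift => //; first exact: spectrum_shift.
by rewrite /gshift mulgV; exact: spectrum1 Ow.
Qed.

Lemma len_ab_lt x y t : P x -> P y -> (forall s, ab s x <= ab s y) ->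
  ab t x < ab t y -> len x < len y.
Proof.
move=> /raag_posP[u ->] /raag_posP[v ->] uv.
have /count_subseqP[u' u'v uu'] : forall s, (count_mem s u <= count_mem s v)%N.
  by move=> s; have := uv s; rewrite !ab_word lez_nat.
rewrite !len_word !ab_word !ltz_nat (perm_size uu') => ut.
rewrite (ltn_leqif (size_subseq_leqif u'v)); apply: contraTN ut => /eqP <-.
by rewrite (permP uu') ltnn.
Qed.

(** The remainder $r^{-1}(x\vee r)$ is what [r] lacks to dominate [x]. Extending [r] by [y]
    subtracts the degrees of [y] from it, truncated at 0. *)
Lemma join_remainder x r u y u' s : P y -> is_join P x r u ->
  is_join P x (r * y)%g u' ->
  P (r^-1 * u)%g /\ P ((r * y)^-1 * u')%g /\
  (ab s ((r * y)^-1 * u')%g <= ab s (r^-1 * u)%g - ab s y \/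
   ab s ((r * y)^-1 * u')%g <= 0).
Proof.
move=> Py [xu ru um] [xu' ryu' um'].
have ru' : le r u' by apply: qle_trans ryu'; exact: qle_mulr.
have uu' := um _ xu' ru'.
have bu : le (r^-1 * u)%g (r^-1 * u')%g by rewrite qleM2l.
have yu : le y (r^-1 * u')%g by rewrite qle_divl.
have [z [bz yz abz]] := qle_bound_ab e_sym e_irr ru Py bu yu.
have u'z : le u' (r * z)%g.
  apply: um'; last by rewrite qleM2l.
  by apply: (qle_trans xu); rewrite -(qleM2l r^-1%g) mulKg.
split=> //; split=> //.
have : le ((r * y)^-1 * u')%g (y^-1 * z)%g 
  by rewrite invgM -mulgA qleM2l -(qleM2l r) mulVKg.
move=> /(qle_ab s); rewrite [ab s (y^-1 * z)%g]abM abV abz.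
by case: (leP (ab s (r^-1 * u)%g) (ab s y)) => _ ?; [right|left]; lia.
Qed.

End RaagSpectrum.

(** * Neighbourhoods of a point of the spectrum *)

Section Core.
Variables (S : choiceType) (e : rel S).
Hypotheses (e_sym : symmetric e) (e_irr : irreflexive e).
Local Notation G := (raag e).
Local Notation gen := (raag_gen e).
Local Notation P := (@raag_pos S e).
Local Notation Om := (nica_spectrum P).
Local Notation le := (qle P).
Local Notation subsets := {ptws G -> bool}.

Lemma le_sub_or (a b c : int) :
  0 <= b -> 0 <= c -> a <= b - c \/ a <= 0 -> a <= b.
Proof. by lia. Qed.

Lemma lt_sub_or (a b c : int) :
  0 < b -> c != 0 -> 0 <= c -> a <= b - c \/ a <= 0 -> a < b.
Proof. by lia. Qed.

Definition stable (w : subsets) (r b : G) : Prop :=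
  forall y s, P y -> w (r * y)%g -> 0 < ab s b -> ab s y = 0.

(** The membership of [x] in [w] is settled at [r]: for [x] outside [w], the join with [r] is
    missing, or no letter of its remainder can be supplied by going further up in [w]. *)
Definition resolved (w : subsets) (x r : G) : Prop :=
  [/\ P r, w r & w x /\ le x r \/
   ~ w x /\ ((forall u, ~ is_join P x r u) \/
             exists2 u, is_join P x r u & stable w r (r^-1 * u)%g)].

(** If [x] is outside [w] and all joins exist, take [r] with a remainder of minimal length: by
    [join_remainder], an extension inside [w] using one of its letters would shorten it. *)
Lemma resolved_exists w x : Om w -> exists r, resolved w x r.
Proof.
move=> Ow; have [wx|nwx] := pselect (w x).
  have [z [z1 xz _] wz] := spectrum_bound Ow (spectrum1 Ow) wx.
  by exists z; split; [rewrite -qle1|exact: wz|left].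
have [[r [Pr wr nor]]|allr] := pselect
    (exists r, [/\ P r, w r & forall u, ~ is_join P x r u]).
  by exists r; split=> //; right; split=> //; left.
have joinr r : P r -> w r -> exists u, is_join P x r u.
  move=> Pr wr; apply: contrapT => nou; apply: allr; exists r; split=> // u ju.
  by apply: nou; exists u.
pose Q n := `[< exists r u, [/\ P r, w r, is_join P x r u & len (r^-1 * u)%g = n%:Z] >].
have exQ : exists n, Q n.
  have [u ju] := joinr _ (@raag_pos1 _ e) (spectrum1 Ow).
  have := len_ge0 (let: And3 _ uu _ := ju in uu).
  case El : (len (1^-1 * u)%g) => [n|//] _; exists n; apply/asboolP.
  by exists 1%g, u; split=> //; [exact: raag_pos1|exact: spectrum1 Ow].
case: (ex_minnP exQ) => n /asboolP[r [u [Pr wr ju lenE]]] min_n.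
exists r; split=> //; right; split=> //; right; exists u => // y s Py wy sb.
have Pb : P (r^-1 * u)%g by have [_ ru _] := ju.
have [u' ju'] := joinr _ (raag_posM Pr Py) wy.
have rem t := join_remainder e_sym e_irr t Py ju ju'.
have [_ [Pb' _]] := rem s.
apply/eqP/negPn/negP => y0.
have lt_len : len ((r * y)^-1 * u')%g < len (r^-1 * u)%g.
  apply: (@len_ab_lt _ _ _ _ s) => // [t|].
    by have [_ [_]] := rem t; apply: le_sub_or; exact: ab_ge0.
  by have [_ [_]] := rem s; apply: lt_sub_or => //; exact: ab_ge0.
have := len_ge0 Pb'; case El : (len ((r * y)^-1 * u')%g) => [m|//] _.
have /min_n : Q m.
  apply/asboolP; exists (r * y)%g, u'; split=> //; exact: raag_posM.
by move: lt_len; rewrite El lenE; lia.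
Qed.

Lemma resolved_mono w x r y : Om w -> P y -> w (r * y)%g -> resolved w x r ->
  resolved w x (r * y)%g.
Proof.
move=> Ow Py wy [Pr wr rx]; split=> //; first exact: raag_posM.
case: rx => [[wx xr]|[nwx [nou|[u ju stu]]]].
- by left; split=> //; apply: qle_trans xr _; exact: qle_mulr.
- right; split=> //; left => u' [xu ru um].
  have ru' : le r u' by apply: qle_trans ru; exact: qle_mulr.
  by have [z /nou] := is_join_exists e_sym e_irr xu ru'.
right; split=> //.
have [[u' ju']|nou] := pselect (exists u', is_join P x (r * y)%g u'); last first.
  by left=> u' ju'; apply: nou; exists u'.
right; exists u' => // y' s Py' wy' sb'.
have yy0 : ab s (y * y')%g = 0.
  apply: stu; [exact: raag_posM|by rewrite mulgA|].
  have [Pb [_ le_b]] := join_remainder e_sym e_irr s Py ju ju'.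
  by apply: lt_le_trans sb' _; apply: le_sub_or le_b; exact: ab_ge0.
move: yy0; rewrite abM => yy0; apply/eqP; rewrite eq_le ab_ge0 // andbT.
by rewrite -yy0 lerDr ab_ge0.
Qed.

Lemma resolved_all w (X : seq G) : Om w ->
  exists2 r : G, P r /\ w r & forall x : G, x \in X -> resolved w x r.
Proof.
move=> Ow; elim: X => [|x X [r [Pr wr] rX]].
  by exists 1%g => //; split; [exact: raag_pos1|exact: spectrum1 Ow].
have [r' [Pr' wr' rx]] := resolved_exists x Ow.
have [z [rz r'z _] wz] := spectrum_bound Ow wr wr'.
exists z => [|y]; first by split=> //; exact: qle_pos rz.
have [q Pq zE] := qle_exists rz; have [q' Pq' zE'] := qle_exists r'z.
rewrite inE => /predU1P[->|/rX yr].
  by rewrite zE'; apply: resolved_mono => //; rewrite -zE'.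
by rewrite zE; apply: resolved_mono => //; rewrite -zE.
Qed.

(** The list [bs] consists of the remainders of the [x] outside [w]: if [v] contained such an [x]
    together with [r], it would contain their join [r b]. *)
Lemma core_constraints w (X : seq G) : Om w -> exists (r : G) (bs : seq G),
  [/\ P r, w r,
    forall b : G, b \in bs -> [/\ P b, b <> 1%g & stable w r b] &
    forall v, Om v -> v r -> (forall b : G, b \in bs -> ~ v (r * b)%g) ->
      forall x : G, x \in X -> v x = w x].
Proof.
move=> Ow; have [r [Pr wr] rX] := resolved_all X Ow; exists r.
elim: X rX => [_|x X IHX rX]; first by exists [::].
have [|bs [_ _ Pbs bsX]] := IHX; first by move=> y yX; apply: rX; rewrite inE yX orbT.
have [_ _ [[wx xr]|[nwx [nou|[u [xu ru um] stu]]]]] := rX x (mem_head _ _).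
- exists bs; split=> // v Ov vr nb y; rewrite inE => /predU1P[->|]; last exact: bsX.
  by rewrite wx (spectrum_le Ov vr xr).
- exists bs; split=> // v Ov vr nb y; rewrite inE => /predU1P[->|]; last exact: bsX.
  case: (w x) nwx => // _; apply/negP => vx.
  by have [z /nou] := spectrum_bound Ov vx vr.
exists ((r^-1 * u)%g :: bs); split=> // [b|v Ov vr nb y].
  rewrite inE => /predU1P[->|]; last exact: Pbs.
  split=> // ru1; apply: nwx; apply: (spectrum_le Ow wr).
  by rewrite -[r]mulg1 -ru1 mulVKg.
rewrite inE => /predU1P[->|]; last first.
  by apply: bsX => // b bbs; apply: nb; rewrite inE bbs orbT.
case: (w x) nwx => // _; apply/negP => vx.
have [z [xz rz _] vz] := spectrum_bound Ov vx vr.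
apply: (nb _ (mem_head _ _)); rewrite mulVKg.
by apply: (spectrum_le Ov vz); exact: um.
Qed.

Lemma content_seq (bs : seq G) : (forall b : G, b \in bs -> P b) ->
  exists Y : seq S, forall s, s \in Y <-> exists2 b : G, b \in bs & 0 < ab s b.
Proof.
elim: bs => [_|b bs IHbs Pbs]; first by exists [::] => s; split=> // -[].
have [|Y YE] := IHbs; first by move=> c cbs; apply: Pbs; rewrite inE cbs orbT.
have [u bE] := raag_posP (Pbs _ (mem_head _ _)).
exists (u ++ Y) => s; rewrite mem_cat -(content_word e) -bE; split.
  case/orP => [sb|/YE[c cbs sc]]; first by exists b; rewrite ?mem_head.
  by exists c; rewrite // inE cbs orbT.
move=> [c]; rewrite inE => /predU1P[-> ->//|cbs sc].
by apply/orP; right; apply/YE; exists c.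
Qed.

Local Notation gens u := (raag_word e (pos_word u)).

(** A generator absent from [b] but compatible with it commutes with all letters of [b]; the next
    vertex of the walk does not commute with it, so it is absent from [b] as well. *)
Lemma walk_disjoint s p q b z : path (opp_graph e) s p -> P b -> ab s b = 0 ->
  le (gens (s :: p) * q)%g z -> P q -> le b z ->
  (forall t, t \in s :: p -> ab t b = 0) /\ exists2 z', le q z' & le b z'.
Proof.
elim: p s z => [|t p IHp] s z; rewrite wd_pos_cons -mulgA => ps Pb sb uz Pq bz.
all: have sz : le (gen s) z by apply: qle_trans uz; apply: qle_mulr; apply: raag_posM => //; exact: raag_pos_word.
all: have [sc sbz] := gen_le_disjoint e_sym e_irr Pb sb sz bz.
all: have bz' : le b ((gen s)^-1 * z)%g by rewrite qle_divl.
  split; first by move=> t; rewrite inE => /eqP->.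
  by exists ((gen s)^-1 * z)%g => //; rewrite qle_divl; rewrite -[q]mul1g.
move: ps => /= /andP[st tp].
have tb : ab t b = 0.
  apply/eqP; rewrite eq_le ab_ge0 // andbT leNgt; apply/negP => /sc.
  by move: st => /andP[_ /negPf->].
have [|disj [z' qz' bz'']] := IHp t ((gen s)^-1 * z)%g tp Pb tb _ Pq bz'.
  by rewrite qle_divl.
split; last by exists z'.
by move=> u; rewrite inE => /predU1P[->//|]; exact: disj.
Qed.

(* A finite neighbourhood of a point [w] of the spectrum contains, up to a    *)
(* translation, all points avoiding the generators of some finite [B] whose   *)
(* factors no longer occur in [w].                                            *)
Lemma spectrum_core w (X : seq G) : Om w -> exists (r q : G) B,
  [/\ P r, P q, w r & factor_sets e B] /\
  [/\ avoids (vertices B) (gshift r w), (forall s, 0 < ab s q -> ~ vertices B s) &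
    forall v, Om v -> avoids (vertices B) v ->
      forall x : G, x \in X -> gshift (r * q)^-1 v x = w x].
Proof.
move=> Ow; have [r [bs [Pr wr Pbs core]]] := core_constraints X Ow.
have [Y YE] : exists Y : seq S, forall s, s \in Y <-> exists2 b : G, b \in bs & 0 < ab s b.
  by apply: content_seq => b /Pbs[].
(* The factors all of whose generators occur in the constraints: finitely many, and each finite
   because [Y] is. *)
pose B : set (set S) := [set lam | factors e lam /\ lam `<=` [set` Y]].
have FB : factor_sets e B.
  split=> [|lam [Flam lamY]].
    apply: (@sub_finite_set _ _ (component e @` [set` Y])); last first.
      exact/finite_image/finite_seq.
    move=> _ [[s _ <-] sY]; exists s => //.
    by apply: sY; exact: component_refl.
  by split=> //; apply: sub_finite_set lamY _; exact: finite_seq.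
have satB := vertices_saturated e_sym FB.
have avB : avoids (vertices B) (gshift r w).
  move=> s [lam [_ lamY] lams] ws; have /YE[b bbs sb] := lamY _ lams.
  have [_ _ /(_ (gen s) s (raag_pos_gen s) ws sb)] := Pbs _ bbs.
  by rewrite ab_gen eqxx.
(* A single [q], with letters off [B], is made incompatible with all constraints that have no letter
   in [B]. *)
have [q [Pq qB qbs]] : exists q, [/\ P q, (forall s, 0 < ab s q -> ~ vertices B s) &
    forall b : G, b \in bs -> (forall s, 0 < ab s b -> ~ vertices B s) ->
      forall z, le q z -> ~ le b z].
  have : {subset bs <= bs} by [].
  elim: {1 3}bs => [_|b bs' IH sub].
    exists 1%g; split=> //; first exact: raag_pos1.
    by move=> s; rewrite /ab raag_deg1.
  have [|q [Pq qB qbs]] := IH; first by move=> c cbs; apply: sub; rewrite inE cbs orbT.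
  have bbs := sub _ (mem_head _ _); have [Pb b1 _] := Pbs _ bbs.
  have [bB|bB] := pselect (forall s, 0 < ab s b -> ~ vertices B s); last first.
    exists q; split=> // c; rewrite inE => /predU1P[->//|]; exact: qbs.
  have [y yb] : exists y, 0 < ab y b.
    apply: contrapT => noy; apply: b1; apply: ab_eq0 => // s.
    apply/eqP; rewrite eq_le ab_ge0 // andbT leNgt; apply/negP => sb.
    by apply: noy; exists s.
  (* The factor of [y] is not in [B], so it has a generator [s] outside all constraints. Prefixing
     [q] with a walk from [s] to [y] makes it incompatible with [b]: by [walk_disjoint], a common
     bound would remove the letter [y] from [b]. *)
  have [s ys sY] : exists2 s, component e y s & s \notin Y.
    apply: contrapT => nos; apply: (bB _ yb); exists (component e y).
      split=> [|s ys]; first by exists y.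
      by apply: contrapT => /negP sY; apply: nos; exists s.
    exact: component_refl.
  have [p ps py] := component_sym e_sym ys.
  have pB t : t \in s :: p -> ~ vertices B t.
    move=> tp [lam Blam lamt]; apply: (bB _ yb); exists lam => //.
    have [Flam _] := Blam; rewrite (factorsE e_sym Flam lamt).
    apply: (@component_trans _ e t s y); last by exists p.
    apply: component_sym => //; move: tp; rewrite inE => /predU1P[->|]; first exact: component_refl.
    move=> /splitPr E; move: ps; case: E => p1 p2; rewrite cat_path => /= /and3P[p1p tl _].
    by exists (rcons p1 t); rewrite ?last_rcons // rcons_path p1p.
  have disj0 c : c \in bs -> ab s c = 0.
    move=> cbs; have [Pc _ _] := Pbs _ cbs.
    apply/eqP; rewrite eq_le ab_ge0 // andbT leNgt; apply/negP => sc.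
    by move: sY => /negP; apply; apply/YE; exists c.
  exists (gens (s :: p) * q)%g; split.
  - by apply: raag_posM => //; exact: raag_pos_word.
  - move=> t; rewrite abM => tq; have [/pB//|tp] := boolP (t \in s :: p).
    apply: qB; move: tq; have := content_word e t (s :: p); rewrite (negPf tp).
    have := ab_ge0 t (@raag_pos_word _ e (s :: p)).
    by move: (ab t (gens _)) => k; lia.
  move=> c; rewrite inE => /predU1P[->|cbs'] cB z qz cz.
    have [disj _] := walk_disjoint ps Pb (disj0 _ bbs) qz Pq cz.
    by move: yb; rewrite disj // -py; exact: mem_last.
  have cbs : c \in bs by apply: sub; rewrite inE cbs' orbT.
  have [Pc _ _] := Pbs _ cbs.
  have [_ [z' qz' cz']] := walk_disjoint ps Pc (disj0 _ cbs) qz Pq cz.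
  exact: qbs cbs' cB _ qz' cz'.
exists r, q, B; split; split=> // v Ov avv; apply: core.
- exact: (spectrum_unshift Ov (raag_posM Pr Pq)).
- rewrite /gshift invgM -mulgA mulVg mulg1; exact: spectrum_inv.
move=> b bbs; have [Pb _ _] := Pbs _ bbs.
rewrite /gshift invgM -mulgA mulKg => vb.
have Ov' := spectrum_unshift Ov Pq.
(* A constraint without letters in [B] has no common bound with [q], which lies in $qv$; one with a
   letter in [B] cannot lie in $qv$, which still avoids [B]. *)
have [bB|[s [sb sB]]] : (forall s, 0 < ab s b -> ~ vertices B s) \/
    exists s, 0 < ab s b /\ vertices B s.
  have [bB|bB] := pselect (exists s, 0 < ab s b /\ vertices B s); first by right.
  by left => s sb sB; apply: bB; exists s.
  have v'q : gshift q^-1 v q by rewrite /gshift mulVg; exact: spectrum1 Ov.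
  have [z [bz qz _] _] := spectrum_bound Ov' vb v'q.
  exact: qbs bbs bB _ qz bz.
have [t Bt tb] := content_first satB Pb sB sb.
apply: (avoids_extend e_sym e_irr satB Ov Pq qB avv Bt).
exact: spectrum_le Ov' vb tb.
Qed.

End Core.

(** * Moving a point off the fixed points of a group element *)

Section Freeness.
Variables (S : choiceType) (e : rel S).
Hypotheses (e_sym : symmetric e) (e_irr : irreflexive e).
Local Notation G := (raag e).
Local Notation gen := (raag_gen e).
Local Notation P := (@raag_pos S e).
Local Notation Om := (nica_spectrum P).
Local Notation le := (qle P).

(* A fixed point of [t] contains [1 \/ t] and [1 \/ t^-1], one of which is    *)
(* nontrivial; extending by a generator that does not commute with its first  *)
(* letter removes it.                                                         *)
Lemma spectrum_free w (X : seq G) (t : G) :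
  (forall s, exists s', opp_graph e s s') -> Om w -> t <> 1%g ->
  exists v, [/\ Om v, (forall x : G, x \in X -> v x = w x),
    ~ (v t /\ gshift t v = v) &
    forall B, factor_sets e B -> orbit_avoids B v -> orbit_avoids B w].
Proof.
move=> no_isol Ow t1.
have [r [q [B [[Pr Pq wr FB] [avB qB core]]]]] := spectrum_core e_sym e_irr X Ow.
have satB := vertices_saturated e_sym FB.
have Ow' := spectrum_shift Ow wr.
(* The candidates $rq\,x\,r^{-1}w$, for positive [x] with letters off [B], all agree with [w] on
   [X]. If none of them works, [t] fixes them all. *)
pose v x := gshift (r * q)^-1 (gshift x^-1 (gshift r w)).
have Ov x : P x -> Om (v x).
  by move=> Px; apply: spectrum_unshift; [exact: spectrum_unshift|exact: raag_posM].
have vX x : P x -> (forall s, 0 < ab s x -> ~ vertices B s) ->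
    forall y : G, y \in X -> v x y = w y.
  move=> Px xB; apply: core; first exact: spectrum_unshift.
  exact: avoids_extend.
have vB x B' : P x -> factor_sets e B' -> orbit_avoids B' (v x) -> orbit_avoids B' w.
  move=> Px FB' Bv; have wrV : gshift r w r^-1%g by rewrite /gshift mulgV; exact: spectrum1 Ow.
  rewrite -[w](gshiftK r); apply: orbit_avoids_shift => //.
  have xw : gshift x^-1 (gshift r w) x by rewrite /gshift mulVg mulg1.
  have Ox : Om (gshift x^-1 (gshift r w)) by exact: spectrum_unshift.
  rewrite -[gshift r w](gshiftK x^-1%g) invgK; apply: orbit_avoids_shift => //.
  rewrite -[gshift x^-1 _](gshiftK (r * q)^-1%g) invgK; apply: orbit_avoids_shift => //.
    exact: Ov.
  by rewrite /v {1}/gshift mulVg; exact: spectrum1 Ox.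
apply: contrapT => nov.
have fixv x : P x -> (forall s, 0 < ab s x -> ~ vertices B s) ->
    v x t /\ gshift t (v x) = v x.
  move=> Px xB; apply: contrapT => nfix; apply: nov; exists (v x); split=> //.
  - exact: Ov.
  - exact: vX.
  - by move=> B'; exact: vB.
pose tau := ((r * q)^-1 * t * (r * q))%g.
have fixu x : P x -> (forall s, 0 < ab s x -> ~ vertices B s) ->
    let u := gshift x^-1 (gshift r w) in u tau /\ u tau^-1%g.
  move=> Px xB u; have [vt tv] := fixv x Px xB.
  have uE g : u g = v x (r * q * g)%g by rewrite /v -/u /gshift mulKg.
  have u1 : u 1%g by apply: spectrum1; exact: spectrum_unshift.
  have tvE g : v x (t * g)%g = v x g by rewrite -[in RHS]tv.
  have tauV : (tau^-1 = (r * q)^-1 * (t^-1 * (r * q)))%g.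
    by rewrite /tau invgM [((r * q)^-1 * t)^-1%g]invgM invgK.
  split; first by rewrite uE /tau -(mulgA _ t) mulVKg tvE -[(r * q)%g]mulg1 -uE.
  by rewrite uE tauV mulVKg -tvE mulVKg -[(r * q)%g]mulg1 -uE.
have tau1 : tau <> 1%g.
  move=> tau1; apply: t1; apply: (@mulIg _ (r * q)%g).
  by apply: (@mulgI _ (r * q)^-1%g); rewrite mulgA -/tau tau1 mul1g mulVg.
have c1 : forall s0, 0 < ab s0 (1%g : G) -> ~ vertices B s0.
  by move=> s0; rewrite /ab raag_deg1.
have Pone := @raag_pos1 _ e.
(* The element [a] is $1\vee\tau$, or $\tau^{-1}$ if that join is trivial. By uniqueness of joins,
   the same [a] serves all [x]. *)
have [a [Pa a1 au]] : exists a : G, [/\ P a, a <> 1%g &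
    forall x, P x -> (forall s, 0 < ab s x -> ~ vertices B s) ->
      gshift x^-1 (gshift r w) a].
  have [z jz _] := spectrum_bound (spectrum_unshift Ow' Pone)
    (spectrum1 (spectrum_unshift Ow' Pone)) (fixu _ Pone c1).1.
  have [z1|z1] := pselect (z = 1%g).
    exists tau^-1%g; split=> [|tauV1|x Px xB]; last exact: (fixu x Px xB).2.
      by have [_ + _] := jz; rewrite z1 /qle mulg1.
    by apply: tau1; rewrite -[tau]invgK tauV1 invg1.
  exists z; split=> // [|x Px xB]; first by have [+ _ _] := jz; rewrite qle1.
  have Ou := spectrum_unshift Ow' Px.
  have [z' jz' uz'] := spectrum_bound Ou (spectrum1 Ou) (fixu _ Px xB).1.
  by rewrite (is_join_uniq jz jz').
have [//|[s [y [Py aE]]]] := raag_pos_case Pa.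
have sa : le (gen s) a by rewrite aE; exact: qle_mulr.
have sB : ~ vertices B s.
  move=> Bs; apply: (avB _ Bs); apply: (spectrum_le Ow' _ sa).
  have := au 1%g (@raag_pos1 _ e) c1; by rewrite /gshift invg1 mul1g.
(* Taking [x] to be a generator that does not commute with [s], the point $x\,r^{-1}w$ contains both
   generators, which have no common bound. *)
have [s' ss'] := no_isol s.
have s'B : ~ vertices B s'.
  move=> Bs'; have := satB _ _ Bs' sB; rewrite e_sym.
  by move: ss' => /andP[_ /negPf->].
have c' : forall s0, 0 < ab s0 (gen s') -> ~ vertices B s0.
  by move=> s0; rewrite ab_gen; case: (s' =P s0) => // <-.
have Ou := spectrum_unshift Ow' (@raag_pos_gen _ e s').
have us' : gshift (gen s')^-1 (gshift r w) (gen s') by rewrite /gshift mulVg mulg1.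
have us := spectrum_le Ou (au _ (@raag_pos_gen _ e s') c') sa.
have [z [sz s'z _] _] := spectrum_bound Ou us us'.
have /andP[nss' /negPf] := ss'.
by have [->] := gen_le2 e_sym e_irr nss' sz s'z.
Qed.

End Freeness.

(** * Largest elements of bounded degree *)

Section Box.
Variables (S : choiceType) (e : rel S).
Hypotheses (e_sym : symmetric e) (e_irr : irreflexive e).
Local Notation G := (raag e).
Local Notation P := (@raag_pos S e).
Local Notation Om := (nica_spectrum P).
Local Notation le := (qle P).
Local Notation subsets := {ptws G -> bool}.

Definition finsupp_nat (k : S -> int) : Prop :=
  (forall s, 0 <= k s) /\ exists F : seq S, forall s, s \notin F -> k s = 0.

Definition box (k : S -> int) : set G := [set p | P p /\ forall s, ab s p <= k s].

Lemma finite_box k : finsupp_nat k -> exists L : seq G, forall p : G, box k p -> p \in L.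
Proof.
move=> [k0 [F kF]]; pose n := (\sum_(s <- undup F) `|k s|)%N.
pose words := fix words m : seq (seq S) :=
  if m is m'.+1 then [::] :: [seq s :: u | s <- F, u <- words m'] else [:: [::]].
have wordsP m (u : seq S) : (size u <= m)%N -> {subset u <= F} -> u \in words m.
  elim: m u => [|m IHm] [|s u] //= um uF.
  rewrite inE; apply/orP; right; apply/allpairsP; exists (s, u) => /=; split=> //.
    by apply: uF; exact: mem_head.
  by apply: IHm => // t tu; apply: uF; rewrite inE tu orbT.
exists [seq raag_word e (pos_word u) | u <- words n] => p [/raag_posP[u ->] uk].
have uF : {subset u <= F}.
  move=> s su; apply: contraTT su => /kF ks; have := uk s; rewrite ab_word ks.
  by rewrite -has_pred1 has_count -leqNgt.
apply: map_f; apply: wordsP => //.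
have -> : size u = (\sum_(s <- undup F) count_mem s u)%N.
  elim: u uF {uk} => [_|t u IHu uF]; first by rewrite big1.
  rewrite /= big_split /= -IHu => [|s su]; last by apply: uF; rewrite inE su orbT.
  rewrite (eq_bigr (fun s => if s == t then 1%N else 0%N)) => [|s _]; last by rewrite eq_sym; case: eqP.
  by rewrite -big_mkcond /= sum1_count count_uniq_mem ?undup_uniq // mem_undup uF ?mem_head.
apply: leq_sum => s _; move: (uk s) (k0 s); rewrite ab_word.
by move: (k s) (count_mem s u) => z m; lia.
Qed.

Definition is_top (k : S -> int) (w : subsets) (p : G) : Prop :=
  [/\ box k p, w p & forall q, box k q -> w q -> le q p].

Definition top (k : S -> int) (w : subsets) : G := xget 1%g [set p | is_top k w p].

Lemma is_top_uniq k w p q : is_top k w p -> is_top k w q -> p = q.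
Proof. by move=> [bp wp mp] [bq wq mq]; apply: qle_anti; [exact: mq|exact: mp]. Qed.

Lemma is_top_exists k w : finsupp_nat k -> Om w -> exists p, is_top k w p.
Proof.
move=> kfin Ow; have [L LP] := finite_box kfin.
have : exists2 p, box k p /\ w p & forall q : G, q \in L -> box k q -> w q -> le q p.
  elim: L {LP} => [|x L [p [bp wp] pL]].
    exists 1%g => //; split; last exact: spectrum1 Ow.
    split; first exact: raag_pos1.
    by move=> s; rewrite /ab raag_deg1; case: kfin.
  have [[bx wx]|nx] := pselect (box k x /\ w x); last first.
    exists p => // q; rewrite inE => /predU1P[->|]; last exact: pL.
    by move=> bx wx; case: nx.
  have [z jz wz] := spectrum_bound Ow wx wp.
  have [[Px xk] [Pp pk]] := (bx, bp).
  exists z.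
    split=> //; split; first exact: join_pos jz Px.
    by move=> s; rewrite (join_ab e_sym e_irr s Px Pp jz) ge_max xk pk.
  have [xz pz _] := jz; move=> q; rewrite inE => /predU1P[->//|/pL qp bq wq].
  exact: qle_trans (qp bq wq) pz.
by move=> [p [bp wp] pL]; exists p; split=> // q bq; apply: pL => //; exact: LP.
Qed.

Lemma topP k w : finsupp_nat k -> Om w -> is_top k w (top k w).
Proof.
move=> kfin Ow; have [p ptop] := is_top_exists kfin Ow.
exact: (@xgetPex _ 1%g [set p | is_top k w p] (ex_intro _ p ptop)).
Qed.

(** Both tops dominate the corresponding translate of $1\vee t$, so translating them by [t] or its
    inverse keeps them positive and within the other box. *)
Lemma top_shift k k' w t q : finsupp_nat k -> finsupp_nat k' -> Om w -> w t ->
  is_join P 1%g t q -> (forall s, ab s q <= k s) -> (forall s, k' s = k s - ab s t) ->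
  top k w = (t * top k' (gshift t w))%g.
Proof.
move=> kfin k'fin Ow wt [q1 tq qm] qk k'E.
have Pq : P q by rewrite -qle1.
have Ow' := spectrum_shift Ow wt.
have [[Pp pk] wp ptop] := topP kfin Ow.
have [[Pp' pk'] wp' ptop'] := topP k'fin Ow'.
set p := top k w in Pp pk wp ptop *; set p' := top k' _ in Pp' pk' wp' ptop' *.
have wq : w q.
  have [z [z1 tz _] wz] := spectrum_bound Ow (spectrum1 Ow) wt.
  by apply: spectrum_le Ow wz _; exact: qm.
have qp : le q p by apply: ptop.
have tp : P (t^-1 * p)%g by exact: qle_trans tq qp.
have rp' : le (t^-1 * q)%g p'.
  apply: ptop'; last by rewrite /gshift mulVKg.
  by split=> [|s]; [exact: tq|rewrite abM abV k'E addrC lerB].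
have tp' : P (t * p')%g.
  have [y Py ->] := qle_exists rp'.
  by rewrite mulgA mulVKg; exact: raag_posM.
apply: qle_anti.
  rewrite -[p](mulVKg t) qleM2l; apply: ptop'; last by rewrite /gshift mulVKg.
  by split=> // s; rewrite abM abV k'E addrC lerB.
apply: ptop => //; split=> // s.
by have := pk' s; rewrite k'E abM; move: (ab s t) (ab s p') => k1 k2; lia.
Qed.

End Box.

(** * Points that separate the finite sets of factors *)

Section Witness.
Variables (S : countType) (e : rel S).
Hypotheses (e_sym : symmetric e) (e_irr : irreflexive e).
Local Notation G := (raag e).
Local Notation P := (@raag_pos S e).
Local Notation Om := (nica_spectrum P).
Local Notation le := (qle P).
Local Notation gens u := (raag_word e (pos_word u)).

(* An infinite word in which the generators off [vertices B] all occur        *)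
(* infinitely often.                                                          *)
Lemma spectrum_witness B : factor_sets e B -> exists w,
  [/\ Om w, avoids (vertices B) w &
    forall C, factor_sets e C -> orbit_avoids C w -> C `<=` B].
Proof.
move=> FB; pose blk n := [seq s <- pmap (@unpickle S) (iota 0 n) | `[< ~ vertices B s >]].
pose u n := flatten [seq blk i | i <- iota 0 n].
have uS n : u n.+1 = u n ++ blk n.
  by rewrite /u -addn1 iotaD map_cat flatten_cat /= cats0.
have u_le m n : (m <= n)%N -> exists v, u n = u m ++ v.
  move=> /subnK <-; elim: (n - m)%N => [|j [v vE]]; first by exists [::]; rewrite cats0.
  by exists (v ++ blk (j + m)%N); rewrite addSn uS vE catA.
have uB n s : s \in u n -> ~ vertices B s.
  by move=> /flattenP[b /mapP[i _ ->]]; rewrite mem_filter => /andP[/asboolP].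
pose w : {ptws G -> bool} := fun g => `[< exists n, le g (gens (u n)) >].
have Ow : Om w.
  split.
  - by apply/asboolP; exists 0%N; rewrite qle1; exact: raag_pos_word.
  - move=> x p /asboolP[n xn] Pp; apply/asboolP; exists n; apply: qle_trans xn.
    by rewrite /qle invgM invgK mulgVK.
  - move=> x y /asboolP[n xn] /asboolP[m ym].
    pose k := maxn n m.
    have [v vE] := u_le n k (leq_maxl _ _); have [v' v'E] := u_le m k (leq_maxr _ _).
    have xk : le x (gens (u k)).
      by apply: (qle_trans xn); rewrite vE wd_pos_cat; exact: qle_mulr_word.
    have yk : le y (gens (u k)).
      by apply: (qle_trans ym); rewrite v'E wd_pos_cat; exact: qle_mulr_word.
    have [z jz] := is_join_exists e_sym e_irr xk yk; exists z => //.
    by apply/asboolP; exists k; have [_ _] := jz; apply.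
exists w; split=> //.
  move=> s Bs /asboolP[n sn].
  have : 0 < ab s (gens (u n)) by apply: lt_le_trans (qle_ab s sn); rewrite ab_gen eqxx.
  by rewrite content_word => /uB.
move=> C FC [r [Pr wr avr]] lam Clam; apply: contrapT => nBlam.
have [[s _ lamE] _] := FC.2 _ Clam.
have CF := vertices_saturated e_sym FC.
have sC : vertices C s by exists lam => //; rewrite -lamE; exact: component_refl.
have sB : ~ vertices B s.
  move=> [mu Bmu mus]; apply: nBlam.
  by rewrite -lamE -(factorsE e_sym (FB.2 _ Bmu).1 mus).
move/asboolP: wr => [n rn].
have [r' Pr' rE] := qle_exists rn.
(* The block [blk m] contains [s] and comes after the prefix that dominates [r], so [s] still occurs
   in the part of the word beyond [r]. *)
pose m := maxn n (pickle s).+1.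
have [v vE] := u_le n m (leq_maxl _ _).
have sm : s \in blk m.
  rewrite mem_filter mem_pmap; apply/andP; split; first exact/asboolP.
  apply/mapP; exists (pickle s); last by rewrite pickleK.
  by rewrite mem_iota /= add0n /m leq_maxr.
have xE : gens (u m.+1) = (r * (r' * gens (v ++ blk m)))%g.
  by rewrite uS vE -catA wd_pos_cat rE mulgA.
have Px : P (r' * gens (v ++ blk m))%g by apply: raag_posM => //; exact: raag_pos_word.
have sx : 0 < ab s (r' * gens (v ++ blk m))%g.
  rewrite abM; apply: ltr_wpDl; first exact: ab_ge0.
  by rewrite content_word mem_cat sm orbT.
have [t Ct tx] := content_first CF Px sC sx.
by apply: (avr t Ct); apply/asboolP; exists m.+1; rewrite xE qleM2l.
Qed.

End Witness.

(** * The topology of the spectrum in terms of finitely many coordinates *)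

Section SpectrumTopology.
Variables (R : realType) (G : groupType) (P : set G).
Hypothesis Panti : forall x, P x -> P x^-1%g -> x = 1%g.
Local Notation subsets := {ptws G -> bool}.
Local Notation Om := (nica_spectrum P).

Definition agree (X : seq G) (w v : subsets) : Prop := forall x, x \in X -> v x = w x.

Lemma agree_catl X Y w v : agree (X ++ Y) w v -> agree X w v.
Proof. by move=> a x xX; apply: a; rewrite mem_cat xX. Qed.

Lemma agree_catr X Y w v : agree (X ++ Y) w v -> agree Y w v.
Proof. by move=> a x xX; apply: a; rewrite mem_cat xX orbT. Qed.

Definition cyl_filter (w : subsets) : set_system subsets :=
  [set A | exists X, forall v, agree X w v -> A v].

Lemma cyl_filter_filter w : Filter (cyl_filter w).
Proof.
split; first by exists [::].
- move=> A B [X XA] [Y YB]; exists (X ++ Y) => v a.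
  by split; [apply: XA; exact: agree_catl a|apply: YB; exact: agree_catr a].
- by move=> A B AB [X XA]; exists X => v /XA /AB.
Qed.

Lemma nbhs_agree w X : nbhs w [set v | agree X w v].
Proof.
elim: X => [|x X IHX]; first exact: filterS filterT.
have nx : nbhs w [set v : subsets | v x = w x].
  have /cvg_sup /(_ x) cvx : nbhs w --> w by [].
  apply: cvx; apply: open_nbhs_nbhs; split => //.
  exists [set w x]; first exact: discrete_open.
  by apply/seteqP; split.
apply: filterS (filterI nx IHX) => v [vx vX] y.
by rewrite inE => /predU1P[->//|]; exact: vX.
Qed.

Lemma nbhs_cyl w A : nbhs w A <-> exists X, forall v, agree X w v -> A v.
Proof.
split; last by move=> [X XA]; apply: filterS (nbhs_agree w X) => v /XA.
have Ff := cyl_filter_filter w.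
have : cyl_filter w --> w.
  apply/cvg_sup => x B /=; rewrite (@nbhsE (initial_topology _)) => -[C [[D _ <-] Dw] DB].
  by exists [:: x] => v /(_ x (mem_head _ _)) vx; apply: DB; rewrite /= vx.
by apply.
Qed.

Lemma join_uniq x y z z' : is_join P x y z -> is_join P x y z' -> z = z'.
Proof.
move=> [xz yz zm] [xz' yz' zm']; have /Panti : P (z^-1 * z')%g by exact: zm.
rewrite invgM invgK => /(_ (zm' _ xz yz)) zz'.
by rewrite -[z]mulg1 -zz' mulVKg.
Qed.

(** Joins are unique, so two elements of [w] have the same join in every nearby point of the
    spectrum, and directedness passes to the limit. *)
Lemma spectrum_closed w : ~ Om w -> exists X, forall v, agree X w v -> ~ Om v.
Proof.
move=> nOw; apply: contrapT => noX; apply: nOw.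
have near X : exists2 v, agree X w v & Om v.
  by apply: contrapT => nv; apply: noX; exists X => v a Ov; apply: nv; exists v.
split.
- have [v a Ov] := near [:: 1%g].
  by rewrite -(a 1%g (mem_head _ _)); exact: spectrum1 Ov.
- move=> x p wx Pp; have [v a [_ her _]] := near [:: x; (x * p^-1)%g].
  have ax := a x (mem_head _ _); have axp : v (x * p^-1)%g = w (x * p^-1)%g.
    by apply: a; rewrite !inE eqxx orbT.
  by rewrite -axp; apply: her => //; rewrite ax.
move=> x y wx wy; have [v a Ov] := near [:: x; y].
have ax := a x (mem_head _ _); have ay : v y = w y by apply: a; rewrite !inE eqxx orbT.
have [z jz vz] : exists2 z, is_join P x y z & v z.
  by apply: spectrum_bound Ov _ _; rewrite ?ax ?ay.
exists z => //; have [v' a' Ov'] := near [:: x; y; z].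
have ax' := a' x (mem_head _ _); have ay' : v' y = w y by apply: a'; rewrite !inE eqxx orbT.
have az' : v' z = w z by apply: a'; rewrite !inE eqxx !orbT.
rewrite -az'; have [z' jz' vz'] : exists2 z', is_join P x y z' & v' z'.
  by apply: spectrum_bound Ov' _ _; rewrite ?ax' ?ay'.
by rewrite (join_uniq jz jz').
Qed.

(* Compactness of the spectrum, as an induction principle. *)
Lemma spectrum_compact (Q : set subsets -> Prop) :
  Q set0 -> (forall A B, A `<=` B -> Q B -> Q A) ->
  (forall A B, Q A -> Q B -> Q (A `|` B)) ->
  (forall w, Om w -> exists X, Q [set v | Om v /\ agree X w v]) -> Q Om.
Proof.
move=> Q0 Qsub QU Qloc; apply: contrapT => nQ.
pose F : set_system subsets := [set A | Q (Om `\` A)].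
have FF : ProperFilter F.
  split; first by rewrite /F /= setD0.
  split; first by rewrite /F /= setDT.
  - by move=> A B FA FB; rewrite /F /= setDIr; exact: QU.
  - by move=> A B AB; apply: Qsub; exact: setDS.
have [w [_ clw]] : [set: subsets] `&` cluster F !=set0.
  have cT : compact [set f : subsets | forall i, [set: bool] (f i)].
    by apply: (@tychonoff G (fun=> bool) (fun=> setT)) => _; exact: bool_compact.
  have FT : F [set f : subsets | forall i, [set: bool] (f i)].
    by apply: Qsub Q0 => f [_]; apply.
  by have [w [_ clw]] := cT F FF FT; exists w.
have [X QX] : exists X, Q [set v | Om v /\ agree X w v].
  have [/Qloc//|/spectrum_closed[X nX]] := pselect (Om w).
  by exists X; apply: Qsub Q0 => v [Ov /nX].
have FX : F (~` [set v | agree X w v]).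
  by apply: Qsub QX => v [Ov /contrapT].
by have [v [nv]] := clw _ _ FX (nbhs_agree w X).
Qed.

Definition cyl_continuous (f : subsets -> R[i]^o) : Prop :=
  forall w, Om w -> forall eps : R[i], 0 < eps ->
    exists X, forall v, Om v -> agree X w v -> `|f v - f w| < eps.

Lemma within_continuousP (f : subsets -> R[i]^o) :
  {within Om, continuous f} <-> cyl_continuous f.
Proof.
split=> [/subspace_continuousP cf w Ow eps eps0|cf].
  have /cvgrPdist_lt /(_ _ eps0) := cf _ Ow.
  rewrite near_withinE => /nbhs_cyl[X XA]; exists X => v Ov a.
  by rewrite distrC; exact: XA.
apply/subspace_continuousP => w Ow; apply/cvgrPdist_lt => eps eps0.
rewrite near_withinE; apply/nbhs_cyl; have [X XA] := cf _ Ow _ eps0.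
by exists X => v a Ov; rewrite distrC; exact: XA.
Qed.

Lemma cyl_continuous_bounded (f : subsets -> R[i]^o) : cyl_continuous f ->
  exists2 M : R[i], 0 <= M & forall w, Om w -> `|f w| <= M.
Proof.
move=> cf; pose Q (A : set subsets) := exists2 M : R[i], 0 <= M &
  forall w, A w -> `|f w| <= M.
apply: (@spectrum_compact Q).
- by exists 0.
- by move=> A B AB [M M0 BM]; exists M => // w /AB /BM.
- move=> A B [M M0 AM] [N N0 BN]; exists (M + N); first exact: addr_ge0.
  by move=> w [/AM|/BN] fw; apply: (le_trans fw); rewrite ?lerDl ?lerDr.
move=> w Ow; have [X Xf] := cf w Ow 1 ltr01; exists X, (`|f w| + 1).
  by rewrite addr_ge0.
move=> v [Ov /(Xf _ Ov) /ltW fv].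
by rewrite -[f v](subrKC (f w)); apply: (le_trans (ler_normD _ _)); rewrite lerD2l.
Qed.

End SpectrumTopology.

(** * Finite sums and their regular representations *)

Section FiniteSums.
Variables (R : realType) (G : groupType) (P : set G).
Local Notation subsets := {ptws G -> bool}.
Local Notation Om := (nica_spectrum P).
Local Notation fct := (subsets -> R[i]^o).
Local Notation fs := (@finite_sums R G P).
Local Notation cylc := (@cyl_continuous R G P).

Lemma C0E t (f : fct) : C0 P t f <->
  cylc f /\ forall w, f w <> 0 -> Om w /\ w t.
Proof.
split=> [[/within_continuousP cf f0]|[/within_continuousP cf f0]]; split=> // w.
  by move=> fw; apply: contrapT => nw; apply: fw; exact: f0.
by move=> nw; apply: contrapT => /f0.
Qed.

Lemma C0_Om t (f : fct) w : C0 P t f -> f w != 0 -> Om w.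
Proof. by move=> /C0E[_ fw] /eqP /fw[]. Qed.

Lemma C0_mem t (f : fct) w : C0 P t f -> f w != 0 -> w t.
Proof. by move=> /C0E[_ fw] /eqP /fw[]. Qed.

Lemma cyl_continuousD (f g : fct) : cylc f -> cylc g -> cylc (f + g).
Proof.
move=> cf cg w Ow eps eps0; have e2 : 0 < eps / 2 by rewrite divr_gt0.
have [X Xf] := cf _ Ow _ e2; have [Y Yg] := cg _ Ow _ e2.
exists (X ++ Y) => v Ov a.
have := ltrD (Xf v Ov (agree_catl a)) (Yg v Ov (agree_catr a)); rewrite -splitr.
apply: le_lt_trans; rewrite -[(f + g) v]/(f v + g v) -[(f + g) w]/(f w + g w).
by rewrite opprD addrACA; exact: ler_normD.
Qed.

Lemma cyl_continuousM (f g : fct) : cylc f -> cylc g -> cylc (fun w => f w * g w).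
Proof.
move=> cf cg w Ow eps eps0.
pose M : R[i] := `|f w| + `|g w| + 1.
have M0 : 0 < M by apply: ltr_wpDl; [exact: addr_ge0|exact: ltr01].
pose d : R[i] := eps / (M + M + 1).
have N0 : 0 < M + M + 1 by apply: addr_gt0; [exact: addr_gt0|exact: ltr01].
have d0 : 0 < d by exact: divr_gt0.
have [X Xf] := cf _ Ow _ d0; have [Y Yg] := cg _ Ow _ d0; have [Z Zf] := cf _ Ow _ ltr01.
exists (Z ++ X ++ Y) => v Ov a.
have {}Zf := Zf v Ov (agree_catl a).
have {}Xf := Xf v Ov (agree_catl (agree_catr a)).
have {}Yg := Yg v Ov (agree_catr (agree_catr a)).
have -> : f v * g v - f w * g w = f v * (g v - g w) + (f v - f w) * g w.
  by rewrite mulrBr mulrBl addrA subrK.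
have fvM : `|f v| <= M.
  rewrite -[f v](subrKC (f w)); apply: (le_trans (ler_normD _ _)).
  by rewrite /M -addrA lerD2l; apply: (le_trans (ltW Zf)); rewrite lerDr.
have gwM : `|g w| <= M by rewrite /M addrAC lerDr addr_ge0.
apply: (le_lt_trans (ler_normD _ _)); rewrite !normrM.
apply: (@le_lt_trans _ _ (M * d + d * M)).
  by apply: lerD; apply: ler_pM => //; exact: ltW.
rewrite (mulrC d) -mulrDl /d mulrA ltr_pdivrMr // mulrC ltr_pM2l //.
by rewrite ltrDl ltr01.
Qed.

Lemma cyl_continuous_cst (c : R[i]^o) : cylc (fun=> c).
Proof. by move=> w _ eps eps0; exists [::] => v _ _; rewrite subrr normr0. Qed.

Definition cyl_set (V : set subsets) : Prop :=
  exists X, forall w v, Om w -> Om v -> agree X w v -> (V v <-> V w).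

Lemma cyl_continuous_if (V : set subsets) (f g : fct) : cyl_set V -> cylc f -> cylc g ->
  cylc (fun w => if `[< V w >] then f w else g w).
Proof.
move=> [X XV] cf cg w Ow eps eps0.
have [Y Yf] := cf _ Ow _ eps0; have [Z Zg] := cg _ Ow _ eps0.
exists (X ++ Y ++ Z) => v Ov a.
have /asbool_equiv_eq -> := XV _ _ Ow Ov (agree_catl a).
case: asboolP => _; first exact: Yf (agree_catl (agree_catr a)).
exact: Zg (agree_catr (agree_catr a)).
Qed.

Definition chi (V : set subsets) : fct := fun w => if `[< V w >] then 1 else 0.

Lemma cyl_continuous_chi V : cyl_set V -> cylc (chi V).
Proof. by move=> cV; apply: cyl_continuous_if => //; exact: cyl_continuous_cst. Qed.

(* Continuity is only required at the points of the spectrum moved by [t]     *)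
(* inside the spectrum, where [f] does not vanish.                            *)
Lemma cyl_continuous_gshift s (f g : fct) : C0 P s f -> cylc g ->
  cylc (fun w => f w * g (gshift s w)).
Proof.
move=> /C0E[cf f0] cg w Ow; have [ws|nws] := boolP (w s).
  have h : cylc (fun w => f w * (if `[< w s >] then g (gshift s w) else 0)).
    apply: cyl_continuousM => // u Ou eps eps0.
    have [us|nus] := boolP (u s).
      have [X Xg] := cg _ (spectrum_shift Ou us) _ eps0.
      exists (s :: [seq (s * x)%g | x <- X]) => v Ov a.
      have vs : v s by rewrite a ?mem_head.
      rewrite !asboolT //; apply: Xg; first exact: spectrum_shift.
      by move=> x xX; rewrite /gshift; apply: a; rewrite inE map_f ?orbT.
    exists [:: s] => v Ov a; have vs := a s (mem_head _ _).
    by rewrite !asboolF ?vs ?subrr ?normr0 //; exact/negP.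
  move=> eps eps0; have [X Xh] := h w Ow eps eps0; exists (s :: X) => v Ov a.
  have vs : v s by rewrite a ?mem_head.
  have := Xh v Ov (agree_catr (X := [:: s]) a).
  by rewrite !asboolT.
move=> eps eps0; exists [:: s] => v Ov a.
have z u : ~~ u s -> f u = 0 by move=> us; apply: contrapT => /f0[_]; exact/negP.
by rewrite (z w nws) z ?(a s (mem_head _ _)) // !mul0r subrr normr0.
Qed.

Lemma C0D t (f g : fct) : C0 P t f -> C0 P t g -> C0 P t (f + g).
Proof.
move=> /C0E[cf f0] /C0E[cg g0]; apply/C0E; split; first exact: cyl_continuousD.
move=> w fgw; have [/eqP fw|/eqP] := boolP (f w == 0); last exact: f0.
apply: g0 => gw; apply: fgw.
by rewrite -[LHS]/(f w + g w) fw gw addr0.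
Qed.

Lemma C0_mul t (f h : fct) : C0 P t f -> cylc h -> C0 P t (fun w => h w * f w).
Proof.
move=> /C0E[cf f0] ch; apply/C0E; split; first exact: cyl_continuousM.
by move=> w hw; apply: f0 => fw; apply: hw; rewrite fw mulr0.
Qed.

Lemma C00 t : C0 P t (0 : fct).
Proof. by apply/C0E; split=> //; exact: (cyl_continuous_cst 0). Qed.

Lemma C0_shiftM s t (f g : fct) : C0 P s f -> C0 P t g ->
  C0 P (s * t)%g (fun w => f w * g (gshift s w)).
Proof.
move=> Cf /C0E[cg g0]; apply/C0E; split; first exact: cyl_continuous_gshift.
move=> w /eqP; rewrite mulf_eq0 negb_or => /andP[/(C0_Om Cf) Ow /eqP /g0[_]].
by split.
Qed.

Lemma C0_chi t V : cyl_set V -> (forall w, V w -> Om w /\ w t) -> C0 P t (chi V).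
Proof.
move=> cV Vt; apply/C0E; split; first exact: cyl_continuous_chi.
by move=> w; rewrite /chi; case: asboolP => // /Vt.
Qed.

Lemma finite_sumsP (a : G -> fct) : fs a <->
  (exists L : seq G, forall t, t \notin L -> a t = 0) /\ forall t, C0 P t (a t).
Proof.
split=> [[/finite_seqP[L LE] aC]|[[L aL] aC]]; split=> //.
  exists L => t tL; apply: contrapT => at0; have : [set t | a t <> 0] t by [].
  by rewrite LE /= (negPf tL).
apply: (@sub_finite_set _ _ [set` L]); last exact: finite_seq.
by move=> t /= at0; apply: contraPT at0 => tL; rewrite aL //; apply.
Qed.

Lemma finite_sums_C0 a t : fs a -> C0 P t (a t). Proof. by case. Qed.

Lemma finite_sumsD a b : fs a -> fs b -> fs (a + b).
Proof.
move=> /finite_sumsP[[L aL] aC] /finite_sumsP[[M bM] bC].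
apply/finite_sumsP; split=> [|t]; last exact: C0D.
exists (L ++ M) => t; rewrite mem_cat negb_or => /andP[/aL at0 /bM bt0].
by rewrite -[LHS]/(a t + b t) at0 bt0 addr0.
Qed.

Lemma finite_sumsZ (k : R[i]) a : fs a -> fs (k *: a).
Proof.
move=> /finite_sumsP[[L aL] aC]; apply/finite_sumsP; split=> [|t].
  by exists L => t /aL at0; rewrite -[LHS]/(k *: a t) at0 scaler0.
exact: (C0_mul (aC t) (cyl_continuous_cst k)).
Qed.

Lemma finite_sums0 : fs 0.
Proof.
by apply/finite_sumsP; split=> [|t]; [exists [::]|exact: C00].
Qed.

Lemma finite_sums_single t f : C0 P t f -> fs (single t f).
Proof.
move=> Cf; apply/finite_sumsP; split=> [|s].
  by exists [:: t] => s; rewrite inE /single => /negPf->.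
by rewrite /single; case: eqP => [->//|_]; exact: C00.
Qed.

Lemma fsbig_seqT (V : nmodType) (L : seq G) (F : G -> V) : uniq L ->
  (forall t, t \notin L -> F t = 0) -> \sum_(t \in [set: G]) F t = \sum_(t <- L) F t.
Proof.
move=> uL FL; rewrite (@fsbigE _ _ _ _ _ L) // => [|t _]; last exact: FL.
by apply: eq_bigl => t; exact: in_setT.
Qed.

Lemma alphaK s (f : fct) w : Om w -> w s -> alpha P s^-1 f (gshift s w) = f w.
Proof.
move=> Ow ws; rewrite /alpha mem_set ?translate_gshift ?gshiftK //.
by split; [exact: spectrum_shift|rewrite /gshift mulgV; exact: spectrum1 Ow].
Qed.

(** The two partial translations in the definition cancel on their domain, and off it the
    coefficient of [a] vanishes; the formula therefore holds at every [w]. *)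
Lemma sums_mulE a b r w : fs a ->
  sums_mul P a b r w = \sum_(s \in [set: G]) a s w * b (s^-1 * r)%g (gshift s w).
Proof.
move=> fa; apply: eq_fsbigr => s _; rewrite /alpha; case: ifPn => [|/negP ws].
  by rewrite inE => -[Ow ws]; rewrite translate_gshift -/(alpha P s^-1 (a s) _) alphaK.
suff -> : a s w = 0 by rewrite mul0r.
have /C0E[_ a0] := finite_sums_C0 s fa.
by apply: contrapT => /a0 Us; apply: ws; rewrite inE.
Qed.

Lemma sums_starE a t w : fs a ->
  sums_star P a t w = Num.conj (a t^-1%g (gshift t w)).
Proof.
move=> fa; rewrite /sums_star /alpha translate_gshift; case: ifPn => // /negP wt.
have /C0E[_ a0] := finite_sums_C0 t^-1%g fa.
suff -> : a t^-1%g (gshift t w) = 0 by rewrite conjC0.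
apply: contrapT => /a0[Ow' wt']; apply: wt; rewrite inE -[w](gshiftK t).
split; first exact: spectrum_shift.
by rewrite /gshift mulVg; exact: (spectrum1 Ow').
Qed.

Lemma finite_sumsM a b : fs a -> fs b -> fs (sums_mul P a b).
Proof.
move=> fa fb; have /finite_sumsP[[L aL] aC] := fa.
have /finite_sumsP[[M bM] bC] := fb.
have E r w : sums_mul P a b r w =
    \sum_(s <- undup L) a s w * b (s^-1 * r)%g (gshift s w).
  rewrite sums_mulE // (fsbig_seqT (undup_uniq L)) // => s.
  by rewrite mem_undup => /aL->; rewrite mul0r.
apply/finite_sumsP; split=> [|r].
  exists [seq (s * t)%g | s <- undup L, t <- M] => r rLM; apply/funext => w.
  rewrite E big_seq big1 // => s sL; rewrite bM ?mulr0 //.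
  apply: contra rLM => tM; apply/allpairsP; exists (s, (s^-1 * r)%g) => /=.
  by rewrite mulVKg.
have -> : sums_mul P a b r =
    \sum_(s <- undup L) (fun w => a s w * b (s^-1 * r)%g (gshift s w)).
  by apply/funext => w; rewrite E fct_sumE.
elim/big_ind: _ => [|f g|s _]; [exact: C00|exact: C0D|].
by have := C0_shiftM (aC s) (bC (s^-1 * r)%g); rewrite mulVKg.
Qed.

Lemma finite_sums_star a : fs a -> fs (sums_star P a).
Proof.
move=> fa; have /finite_sumsP[[L aL] aC] := fa.
apply/finite_sumsP; split=> [|t].
  exists [seq t^-1%g | t <- L] => t tL; apply/funext => w.
  rewrite sums_starE // aL ?conjC0 //; apply: contra tL => tL.
  by apply/mapP; exists t^-1%g; rewrite ?invgK.
have conj_cyl (f : fct) : cylc f -> cylc (fun w => Num.conj (f w)).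
  move=> cf w Ow eps eps0; have [X Xf] := cf w Ow eps eps0.
  by exists X => v Ov a'; rewrite -rmorphB norm_conjC; exact: Xf.
have C1 : C0 P t (chi [set w | Om w /\ w t]).
  apply: C0_chi => //; exists [:: t] => w v Ow Ov /(_ t (mem_head _ _)) vt.
  by rewrite /= vt; split=> -[].
have -> : sums_star P a t = fun w =>
    chi [set w | Om w /\ w t] w * Num.conj (a t^-1%g (gshift t w)).
  apply/funext => w; rewrite sums_starE // /chi; case: asboolP => [_|nwt].
    by rewrite mul1r.
  have /C0E[_ a0] := aC t^-1%g.
  suff -> : a t^-1%g (gshift t w) = 0 by rewrite conjC0 mulr0.
  apply: contrapT => /a0[Ow' wt']; apply: nwt; rewrite -[w](gshiftK t).
  split; first exact: spectrum_shift.
  by rewrite /gshift mulVg; exact: (spectrum1 Ow').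
apply/C0E; split.
  have /C0E[ct _] := aC t^-1%g.
  exact: (cyl_continuous_gshift C1 (conj_cyl _ ct)).
by move=> w; rewrite /chi; case: asboolP => // _; rewrite mul0r.
Qed.

Lemma sums_mul_single s t (f g : fct) : C0 P s f -> C0 P t g ->
  sums_mul P (single s f) (single t g) = single (s * t)%g (fun w => f w * g (gshift s w)).
Proof.
move=> Cf Cg; apply/funext => r; apply/funext => w.
rewrite sums_mulE; last exact: finite_sums_single.
rewrite (@fsbig_seqT _ [:: s]) // => [|x]; last first.
  by rewrite inE /single => /negPf->; rewrite mul0r.
rewrite big_seq1 /single eqxx -(can_eq (mulKg s)) mulVKg.
by case: eqP => // _; rewrite mulr0.
Qed.

Lemma sums_star_single t (f : fct) : C0 P t f ->
  sums_star P (single t f) = single t^-1%g (fun w => Num.conj (f (gshift t^-1 w))).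
Proof.
move=> Cf; apply/funext => r; apply/funext => w.
rewrite sums_starE; last exact: finite_sums_single.
rewrite /single eqg_invLR; case: eqP => [->//|_].
by rewrite conjC0.
Qed.

Lemma finite_sums_decomp a : fs a -> exists L : seq G,
  uniq L /\ a = \sum_(t <- L) single t (a t).
Proof.
move=> /finite_sumsP[[L aL] _]; exists (undup L); split; first exact: undup_uniq.
apply/funext => t; rewrite fct_sumE /single.
have [tL|tL] := boolP (t \in undup L); last first.
  rewrite aL; last by rewrite -mem_undup.
  rewrite big_seq big1 // => s sL.
  by case: eqP => // ts; rewrite ts sL in tL.
rewrite (bigD1_seq t) ?undup_uniq //= eqxx big1 ?addr0 // => s.
by rewrite eq_sym => /negPf->.
Qed.

End FiniteSums.

(** * Regular representations on the orbits of the spectrum *)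

Section Regular.
Variables (R : realType) (G : groupType) (P : set G).
Hypotheses (P1 : P 1%g) (PM : forall x y, P x -> P y -> P (x * y)%g)
  (Panti : forall x, P x -> P x^-1%g -> x = 1%g).
Local Notation subsets := {ptws G -> bool}.
Local Notation Om := (nica_spectrum P).
Local Notation fct := (subsets -> R[i]^o).
Local Notation fs := (@finite_sums R G P).
Local Notation C := R[i].
Local Notation vec := (G -> C).

Definition fin_vec (x : vec) : Prop := exists L : seq G, forall g, g \notin L -> x g = 0.

(** Finitely supported vectors suffice, without completion. Where the summand has infinite support,
    the sum takes the default value 0, whence the [fin_vec] conditions below. *)
Definition ip (x y : vec) : C := \sum_(g \in [set: G]) Num.conj (x g) * y g.

Definition vnorm (x : vec) : C := sqrtC (ip x x).

Lemma ip_seq (L : seq G) (x y : vec) : uniq L ->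
  (forall g, g \notin L -> y g = 0) -> ip x y = \sum_(g <- L) Num.conj (x g) * y g.
Proof. by move=> uL yL; apply: fsbig_seqT => // g /yL->; rewrite mulr0. Qed.

Lemma fin_vec_seq2 (x y : vec) : fin_vec x -> fin_vec y -> exists L : seq G,
  [/\ uniq L, (forall g, g \notin L -> x g = 0) & forall g, g \notin L -> y g = 0].
Proof.
move=> [L xL] [M yM]; exists (undup (L ++ M)); split; first exact: undup_uniq.
  by move=> g; rewrite mem_undup mem_cat negb_or => /andP[/xL].
by move=> g; rewrite mem_undup mem_cat negb_or => /andP[_ /yM].
Qed.

Lemma fin_vecD (x y : vec) : fin_vec x -> fin_vec y -> fin_vec (x + y).
Proof.
move=> fx fy; have [L [_ xL yL]] := fin_vec_seq2 fx fy; exists L => g gL.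
by rewrite -[LHS]/(x g + y g) xL ?yL ?addr0.
Qed.

Lemma fin_vecZ (k : C) (x : vec) : fin_vec x -> fin_vec (fun g => k * x g).
Proof. by move=> [L xL]; exists L => g /xL->; rewrite mulr0. Qed.

Lemma ipDr (x y z : vec) : fin_vec y -> fin_vec z -> ip x (y + z) = ip x y + ip x z.
Proof.
move=> fy fz; have [L [uL yL zL]] := fin_vec_seq2 fy fz.
rewrite !(@ip_seq L) // => [|g gL].
  by rewrite -big_split /=; apply: eq_bigr => g _; rewrite -mulrDr.
by rewrite -[LHS]/(y g + z g) yL ?zL ?addr0.
Qed.

Lemma ipZr (k : C) (x y : vec) : fin_vec y -> ip x (fun g => k * y g) = k * ip x y.
Proof.
move=> [L yL]; have yL' g : g \notin undup L -> y g = 0 by rewrite mem_undup => /yL.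
rewrite !(@ip_seq (undup L)) ?undup_uniq // => [|g /yL'->]; last exact: mulr0.
by rewrite mulr_sumr; apply: eq_bigr => g _; rewrite mulrCA.
Qed.

Lemma ip_conj (x y : vec) : fin_vec x -> fin_vec y -> ip y x = Num.conj (ip x y).
Proof.
move=> fx fy; have [L [uL xL yL]] := fin_vec_seq2 fx fy.
rewrite !(@ip_seq L) // rmorph_sum; apply: eq_bigr => g _.
by rewrite rmorphM /= conjCK mulrC.
Qed.

Lemma ip_ge0 (x : vec) : fin_vec x -> 0 <= ip x x.
Proof.
move=> fx; have [L [uL xL _]] := fin_vec_seq2 fx fx.
by rewrite (ip_seq _ uL xL) sumr_ge0 // => g _; rewrite mulrC mul_conjC_ge0.
Qed.

Lemma ip_eq0 (x : vec) g : fin_vec x -> ip x x = 0 -> x g = 0.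
Proof.
move=> fx; have [L [uL xL _]] := fin_vec_seq2 fx fx.
rewrite (ip_seq _ uL xL) => /eqP.
rewrite psumr_eq0 => [/allP x0|h _]; last by rewrite mulrC mul_conjC_ge0.
have [gL|/xL//] := boolP (g \in L).
by have := x0 _ gL; rewrite /= mulf_eq0 conjC_eq0 orbb => /eqP.
Qed.

Lemma vnorm_ge0 (x : vec) : fin_vec x -> 0 <= vnorm x.
Proof. by move=> fx; rewrite sqrtC_ge0 ip_ge0. Qed.

Lemma vnorm_sqr (x : vec) : vnorm x ^+ 2 = ip x x.
Proof. exact: sqrtCK. Qed.

Lemma cauchy_schwarz (x y : vec) : fin_vec x -> fin_vec y ->
  `|ip x y| <= vnorm x * vnorm y.
Proof.
move=> fx fy; have [x0|xn0] := eqVneq (ip x x) 0.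
  have -> : ip x y = 0.
    rewrite /ip fsbig1 // => g _.
    by rewrite (ip_eq0 g fx x0) conjC0 mul0r.
  by rewrite normr0 mulr_ge0 ?vnorm_ge0.
have xp : 0 < ip x x by rewrite lt_def xn0 ip_ge0.
pose k := ip x y / ip x x; pose z : vec := y + (fun g => - k * x g).
have fkx := fin_vecZ (- k) fx; have fz : fin_vec z by exact: fin_vecD.
have zx : ip x z = 0.
  by rewrite ipDr // ipZr // mulNr /k divfK // subrr.
have zz : ip z z = ip y y - `|ip x y| ^+ 2 / ip x x.
  rewrite [LHS]ipDr // ipZr // [ip z x](ip_conj fx fz) zx conjC0 mulr0 addr0.
  have xxr := esym (ip_conj fx fx); have yyr := esym (ip_conj fy fy).
  rewrite (ip_conj fy fz) ipDr // ipZr // (ip_conj fx fy).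
  rewrite rmorphD rmorphM rmorphN /= yyr conjCK /k rmorphM fmorphV /= xxr.
  by rewrite mulNr normCK mulrAC (mulrC (_^*)).
have : 0 <= ip z z by exact: ip_ge0.
rewrite zz subr_ge0 ler_pdivrMr // -!vnorm_sqr -exprMn mulrC.
by rewrite ler_pXn2r // nnegrE ?mulr_ge0 ?vnorm_ge0.
Qed.

Variable w : subsets.
Hypothesis Ow : Om w.

(* The regular representation on l^2 of the orbit of [w]. *)
Definition kern (a : G -> fct) (h g : G) : C := a (h^-1 * g)%g (gshift h w).

Definition act (a : G -> fct) (x : vec) : vec :=
  fun h => \sum_(g \in [set: G]) kern a h g * x g.

Lemma act_seq (L : seq G) a (x : vec) h : uniq L ->
  (forall g, g \notin L -> x g = 0) -> act a x h = \sum_(g <- L) kern a h g * x g.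
Proof. by move=> uL xL; apply: fsbig_seqT => // g /xL->; rewrite mulr0. Qed.

Lemma fin_act a x : fs a -> fin_vec x -> fin_vec (act a x).
Proof.
move=> /finite_sumsP[[L aL] _] fx; have [M [uM xM _]] := fin_vec_seq2 fx fx.
exists [seq (g * t^-1)%g | g <- M, t <- L] => h hML.
rewrite (act_seq _ _ uM xM) big_seq big1 // => g gM.
rewrite /kern aL ?mul0r //; apply: contra hML => tL.
by apply/allpairsP; exists (g, (h^-1 * g)%g); split=> //=; rewrite invgM invgK mulVKg.
Qed.

Lemma actD a b x : fin_vec x -> act (a + b) x = act a x + act b x.
Proof.
move=> fx; have [M [uM xM _]] := fin_vec_seq2 fx fx; apply/funext => h.
rewrite -[RHS]/(act a x h + act b x h) !(act_seq _ _ uM xM) -big_split /=.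
by apply: eq_bigr => g _; rewrite -mulrDl.
Qed.

Lemma actZ (k : C) a x : fin_vec x -> act (k *: a) x = (fun g => k * act a x g).
Proof.
move=> fx; have [M [uM xM _]] := fin_vec_seq2 fx fx; apply/funext => h.
rewrite !(act_seq _ _ uM xM) mulr_sumr.
by apply: eq_bigr => g _; rewrite mulrA.
Qed.

Lemma actM a b x : fs a -> fs b -> fin_vec x ->
  act (sums_mul P a b) x = act a (act b x).
Proof.
move=> fa fb fx; have [M [uM xM _]] := fin_vec_seq2 fx fx; apply/funext => h.
have /finite_sumsP[[L aL] _] := fa.
have uhL : uniq [seq (h * t)%g | t <- undup L].
  by rewrite map_inj_uniq ?undup_uniq //; exact: mulgI.
rewrite (act_seq _ _ uM xM) /act (fsbig_seqT uhL); last first.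
  move=> l lL; rewrite /kern aL ?mul0r //; apply: contra lL => lL.
  by apply/mapP; exists (h^-1 * l)%g; rewrite ?mem_undup ?mulVKg.
rewrite [RHS](eq_bigr (fun l => \sum_(g <- M) kern a h l * (kern b l g * x g))); last first.
  by move=> l _; rewrite -mulr_sumr -/(act b x l) (act_seq _ _ uM xM).
rewrite exchange_big /=; apply: eq_bigr => g _.
rewrite {1}/kern sums_mulE // (fsbig_seqT (undup_uniq L)) => [|s]; last first.
  by rewrite mem_undup => /aL->; rewrite mul0r.
rewrite big_map mulr_suml; apply: eq_bigr => s _.
by rewrite /kern mulKg invgM -!mulgA gshiftM mulrA.
Qed.

Lemma act_star a x y : fs a -> fin_vec x -> fin_vec y ->
  ip (act (sums_star P a) y) x = ip y (act a x).
Proof.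
move=> fa fx fy; have [M [uM xM yM]] := fin_vec_seq2 fx fy.
rewrite (ip_seq _ uM xM) /ip (fsbig_seqT uM); last first.
  by move=> g /yM->; rewrite conjC0 mul0r.
under [RHS]eq_bigr => g _ do rewrite (act_seq _ _ uM xM) mulr_sumr.
rewrite exchange_big /=; apply: eq_bigr => h _.
rewrite (act_seq _ _ uM yM) rmorph_sum mulr_suml; apply: eq_bigr => g _ /=.
rewrite /kern sums_starE // rmorphM /= conjCK gshiftM mulVKg invgM invgK.
by rewrite mulrA (mulrC (a _ _)).
Qed.

Definition act_bound (a : G -> fct) (c : C) : Prop := 0 <= c /\
  forall x y, fin_vec x -> fin_vec y -> `|ip y (act a x)| <= c * (vnorm y * vnorm x).

Lemma act_boundD a b c d : fs a -> fs b -> act_bound a c -> act_bound b d ->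
  act_bound (a + b) (c + d).
Proof.
move=> fa fb [c0 ac] [d0 bd]; split=> [|x y fx fy]; first exact: addr_ge0.
rewrite actD // ipDr; [|exact: fin_act..].
rewrite mulrDl; apply: le_trans (ler_normD _ _) _.
by apply: lerD; [exact: ac|exact: bd].
Qed.

(** A single term acts as a weighted shift, whose weights are bounded by compactness of the
    spectrum. *)
Lemma act_bound_single t f : C0 P t f -> exists c, act_bound (single t f) c.
Proof.
move=> Cf; have fS := finite_sums_single Cf.
have /C0E[cf f0] := Cf.
have [M M0 fM] := cyl_continuous_bounded Panti cf.
have {}fM u : `|f u| <= M.
  have [/fM//|nu] := pselect (Om u).
  have [->|/eqP /f0[]//] := eqVneq (f u) 0; by rewrite normr0.
exists M; split=> // x y fx fy.
have [L [uL xL _]] := fin_vec_seq2 fx fx.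
have fax := fin_act fS fx.
apply: (le_trans (cauchy_schwarz fy fax)).
rewrite mulrCA ler_wpM2l ?vnorm_ge0 //.
rewrite -(@ler_pXn2r _ 2) ?nnegrE ?mulr_ge0 ?vnorm_ge0 // exprMn !vnorm_sqr.
have actE h : act (single t f) x h = f (gshift h w) * x (h * t)%g.
  rewrite /act (@fsbig_seqT _ _ [:: (h * t)%g]) // => [|g].
    by rewrite big_seq1 /kern mulKg /single eqxx.
  rewrite inE /kern /single => gt.
  rewrite (_ : (h^-1 * g == t)%g = false) ?mul0r //.
  by apply/negbTE; apply: contra gt => /eqP <-; rewrite mulVKg.
have uLt : uniq [seq (g * t^-1)%g | g <- L] by rewrite map_inj_uniq //; exact: mulIg.
rewrite (@ip_seq [seq (g * t^-1)%g | g <- L]) //; last first.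
  move=> h hL; rewrite actE xL ?mulr0 //; apply: contra hL => hL.
  by apply/mapP; exists (h * t)%g; rewrite ?mulgK.
rewrite (ip_seq _ uL xL) big_map mulr_sumr; apply: ler_sum => g _.
rewrite actE mulgVK rmorphM /= mulrACA ler_wpM2r //.
  by rewrite mulrC mul_conjC_ge0.
by rewrite mulrC -normCK ler_pXn2r // nnegrE.
Qed.

Lemma act_bound_exists a : fs a -> exists c, act_bound a c.
Proof.
move=> fa; have [L [_ ->]] := finite_sums_decomp fa.
suff [] : fs (\sum_(t <- L) single t (a t)) /\
  exists c, act_bound (\sum_(t <- L) single t (a t)) c by [].
elim/big_ind: _ => [|b c [fb [x bx]] [fc [y cy]]|t _].
- split; first exact: finite_sums0.
  exists 0; split=> // x y fx fy.
  have -> : ip y (act 0 x) = 0.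
    rewrite /ip fsbig1 // => g _; rewrite /act fsbig1 ?mulr0 // => h _.
    by rewrite /kern mul0r.
  by rewrite normr0 mul0r.
- split; first exact: finite_sumsD.
  by exists (x + y); exact: act_boundD.
have Ct := finite_sums_C0 t fa.
by split; [exact: finite_sums_single|exact: act_bound_single].
Qed.

Definition act_norm (a : G -> fct) : C :=
  (inf [set c : R | act_bound a c%:C])%:C.

Lemma act_norm_le a c : act_bound a c -> act_norm a <= c.
Proof.
move=> ac; have c0 := ac.1.
have cE : (complex.Re c)%:C = c by apply: RRe_real; rewrite ger0_real.
rewrite -cE lecR; apply: ge_inf; last by rewrite /= cE.
by exists 0 => d [+ _]; rewrite ler0c.
Qed.

Lemma act_norm_bound a : fs a -> act_bound a (act_norm a).
Proof.
move=> fa; have [c ac] := act_bound_exists fa.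
have cE : (complex.Re c)%:C = c by apply: RRe_real; rewrite ger0_real //; case: ac.
have inh : [set c : R | act_bound a c%:C] !=set0 by exists (complex.Re c); rewrite /= cE.
split; first by rewrite ler0c; apply: lb_le_inf => // d [+ _]; rewrite ler0c.
move=> x y fx fy; set r := vnorm y * vnorm x.
have r0 : 0 <= r by rewrite mulr_ge0 ?vnorm_ge0.
have [rE|rn0] := eqVneq r 0.
  by have [_ /(_ x y fx fy)] := ac; rewrite -/r rE !mulr0.
have rp : 0 < r by rewrite lt_def rn0.
rewrite -ler_pdivrMr //; set q := _ / r.
have qE : (complex.Re q)%:C = q by apply: RRe_real; rewrite ger0_real // divr_ge0.
rewrite -qE lecR; apply: lb_le_inf => // d [_ ad].
by rewrite -lecR qE ler_pdivrMr //; exact: ad.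
Qed.

Lemma act_norm_vec a x : fs a -> fin_vec x -> vnorm (act a x) <= act_norm a * vnorm x.
Proof.
move=> fa fx; have fax := fin_act fa fx.
have [n0 /(_ x (act a x) fx fax)] := act_norm_bound fa.
rewrite ger0_norm ?ip_ge0 // -vnorm_sqr => le_n.
have [->|an0] := eqVneq (vnorm (act a x)) 0; first by rewrite mulr_ge0 ?vnorm_ge0.
have ap : 0 < vnorm (act a x) by rewrite lt_def an0 vnorm_ge0.
by rewrite -(ler_pM2l ap) -expr2 mulrCA.
Qed.

(** The C*-identity comes from $\|ax\|^2=\langle x,a^*ax\rangle\le\|a^*a\|\,\|x\|^2$. *)
Lemma act_norm_seminorm : cstar_seminorm P act_norm.
Proof.
have n0 a : fs a -> 0 <= act_norm a by move=> /act_norm_bound[].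
have bM a b : fs a -> fs b -> act_norm (sums_mul P a b) <= act_norm a * act_norm b.
  move=> fa fb; apply: act_norm_le; split; first by rewrite mulr_ge0 ?n0.
  move=> x y fx fy; rewrite actM //; have fbx := fin_act fb fx.
  have [_ /(_ _ _ fbx fy) ub] := act_norm_bound fa; apply: (le_trans ub).
  rewrite -mulrA ler_wpM2l ?n0 // mulrCA ler_wpM2l ?vnorm_ge0 //.
  exact: act_norm_vec.
have bZ k a : fs a -> act_norm (k *: a) <= `|k| * act_norm a.
  move=> fa; apply: act_norm_le; split; first by rewrite mulr_ge0 ?n0.
  move=> x y fx fy; rewrite actZ // ipZr ?normrM; last exact: fin_act.
  by rewrite -mulrA ler_wpM2l //; have [_] := act_norm_bound fa; apply.
have fstar a : fs a -> fs (sums_star P a).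
  exact: finite_sums_star.
have bstar a : fs a -> act_norm (sums_star P a) <= act_norm a.
  move=> fa; apply: act_norm_le; split; first exact: n0.
  move=> x y fx fy.
  rewrite (ip_conj (fin_act (fstar _ fa) fx) fy) norm_conjC act_star //.
  by rewrite (mulrC (vnorm y)); have [_] := act_norm_bound fa; apply.
split=> //.
- move=> a b fa fb; apply: act_norm_le.
  by apply: act_boundD => //; exact: act_norm_bound.
- move=> k a fa; apply/eqP; rewrite eq_le bZ //=.
  have [->|k0] := eqVneq k 0; first by rewrite normr0 mul0r n0 //; exact: finite_sumsZ.
  have kp : 0 < `|k| by rewrite normr_gt0.
  rewrite -ler_pdivlMl // -normfV.
  have {1}-> : a = k^-1 *: (k *: a) by rewrite scalerA mulVf // scale1r.
  by apply: bZ; exact: finite_sumsZ.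
move=> a fa; have fsa := fstar a fa; apply/eqP; rewrite eq_le; apply/andP; split.
  by apply: (le_trans (bM _ _ fsa fa)); rewrite expr2 ler_wpM2r ?n0 ?bstar.
have faa : fs (sums_mul P (sums_star P a) a) by exact: finite_sumsM.
rewrite -[leRHS]sqrtCK ler_pXn2r ?nnegrE ?sqrtC_ge0 ?n0 //.
apply: act_norm_le; split; first by rewrite sqrtC_ge0 n0.
move=> x y fx fy; have fax := fin_act fa fx.
apply: (le_trans (cauchy_schwarz fy fax)); rewrite mulrCA ler_wpM2l ?vnorm_ge0 //.
rewrite -(@ler_pXn2r _ 2) ?nnegrE ?mulr_ge0 ?vnorm_ge0 ?sqrtC_ge0 ?n0 //.
have E : ip (act a x) (act a x) = `|ip x (act (sums_mul P (sums_star P a) a) x)|.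
  rewrite -[LHS]ger0_norm ?ip_ge0 // -(act_star fa fx fax) -actM //.
  by rewrite (ip_conj fx) ?norm_conjC //; exact: fin_act.
rewrite exprMn !vnorm_sqr sqrtCK E.
by have [_ /(_ x x fx fx)] := act_norm_bound faa; rewrite -expr2 vnorm_sqr.
Qed.

Lemma act_norm_coef a : fs a -> `|a 1%g w| <= act_norm a.
Proof.
move=> fa; pose d : vec := fun g => if g == 1%g then 1 else 0.
have d0 g : g \notin [:: 1%g] -> d g = 0 by rewrite inE /d => /negPf->.
have fd : fin_vec d by exists [:: 1%g].
have dd : ip d d = 1 by rewrite (@ip_seq [:: 1%g]) // big_seq1 /d eqxx conjC1 mulr1.
have nd : vnorm d = 1 by rewrite /vnorm dd sqrtC1.
have [_ /(_ d d fd fd)] := act_norm_bound fa; rewrite nd !mulr1.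
rewrite /ip (@fsbig_seqT _ _ [:: 1%g]) // => [|g /d0->]; last by rewrite conjC0 mul0r.
rewrite big_seq1 /act (@fsbig_seqT _ _ [:: 1%g]) // => [|g /d0->]; last by rewrite mulr0.
by rewrite big_seq1 /d eqxx conjC1 mul1r mulr1 /kern invg1 mulg1 gshift1.
Qed.

End Regular.

(** The norm of [E] dominates that of the regular representation at [w], of which the coefficient is
    a matrix entry. This is how elements of [E] are shown to be nonzero. *)
Lemma crossed_product_coef (R : realType) (G : groupType) (P : set G)
    (P1 : P 1%g) (PM : forall x y, P x -> P y -> P (x * y)%g)
    (Panti : forall x, P x -> P x^-1%g -> x = 1%g)
    (E : cstarAlgType R) (iota : (G -> {ptws G -> bool} -> R[i]^o) -> E) a w :
  is_crossed_product P iota -> finite_sums P a -> nica_spectrum P w ->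
  `|a 1%g w| <= `|iota a|.
Proof.
move=> [_ _ _ _ univ] fa Ow; apply: (@le_trans _ _ (act_norm w a)).
  exact: (act_norm_coef (P := P)).
by apply: univ => //; exact: act_norm_seminorm.
Qed.

Lemma exp_half_le (R : realType) (eps : R[i]) : 0 < eps -> exists n, 2^-1 ^+ n.+1 <= eps.
Proof.
move=> eps0; have epsE : (complex.Re eps)%:C = eps by rewrite RRe_real // gtr0_real.
have r0 : 0 < complex.Re eps by rewrite -ltcR epsE.
have /(_ _ (leqnSn _)) := @upper_nthrootP _ (complex.Re eps)^-1.
set n := Num.bound _ => le_n; exists n.
have -> : 2^-1 ^+ n.+1 = ((2^-1 ^+ n.+1 : R)%:C : R[i]).
  by rewrite rmorphXn /= fmorphV rmorph_nat.
by rewrite -epsE lecR exprVn ltW // -[ltRHS]invrK ltf_pV2 // posrE ?invr_gt0 ?exprn_gt0.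
Qed.

(** * The crossed product *)

Section CStar.
Variables (R : realType) (E : cstarAlgType R).
Implicit Types x y z : E.

Lemma cmulBl x y z : cmul (x - y) z = cmul x z - cmul y z.
Proof. by rewrite cmulDl -[- y]scaleN1r cmulZl scaleN1r. Qed.

Lemma cmulBr x y z : cmul x (y - z) = cmul x y - cmul x z.
Proof. by rewrite cmulDr -[- z]scaleN1r cmulZr scaleN1r. Qed.

Lemma cmul0x x : cmul 0 x = 0.
Proof. by apply: (@addrI _ (cmul 0 x)); rewrite -cmulDl !addr0. Qed.

Lemma cmulx0 x : cmul x 0 = 0.
Proof. by apply: (@addrI _ (cmul x 0)); rewrite -cmulDr !addr0. Qed.

Lemma closed_eps (I : set E) x : closed I ->
  (forall eps : R[i], 0 < eps -> exists2 y, I y & `|x - y| <= eps) -> I x.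
Proof.
move=> cI near; apply: cI => B /nbhs_ballP[eps /= eps0 xB].
have e2 : 0 < eps / 2 by rewrite divr_gt0.
have [y Iy xy] := near _ e2; exists y; split=> //; apply: xB.
rewrite -ball_normE /=; apply: le_lt_trans xy _.
by rewrite ltr_pdivrMr // mulr_natr mulr2n ltrDl.
Qed.

Lemma closed_idealB (I : set E) x y : closed_ideal I -> I x -> I y -> I (x - y).
Proof.
move=> [_ _ ID IZ _] Ix Iy; apply: ID => //.
by rewrite -scaleN1r; exact: IZ.
Qed.

(* Products of elements of [h + I] lie in [h + I]. *)
Lemma idempotent_near_ideal (I : set E) h j : closed_ideal I ->
  cmul h h = h -> I j -> `|h - j| <= 2^-1 -> I h.
Proof.
move=> idI hh Ij hj; have [cI I0 ID IZ IM] := idI.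
have near n : exists2 y, I y & `|h - y| <= 2^-1 ^+ n.+1.
  elim: n => [|n [y Iy hy]]; first by exists j => //; rewrite expr1.
  exists (cmul j h + cmul h y - cmul j y).
    apply: closed_idealB => //; last by have [] := IM j y Iy.
    by apply: ID; [have [] := IM h j Ij|have [] := IM h y Iy].
  have -> : h - (cmul j h + cmul h y - cmul j y) = cmul (h - j) (h - y).
    by rewrite cmulBl !cmulBr hh !opprD !opprK !addrA [h - _ - _]addrAC.
  by rewrite exprS; apply: le_trans (cnormM _ _) _; apply: ler_pM.
apply: closed_eps => // eps eps0.
have [n nE] := exp_half_le eps0.
by have [y Iy hy] := near n; exists y => //; exact: le_trans hy nE.
Qed.

End CStar.

(** * The unit of the crossed product and the norms of functions on the spectrum *)

Section Crossed.
Variables (R : realType) (G : groupType) (P : set G).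
Variables (E : cstarAlgType R) (iota : (G -> {ptws G -> bool} -> R[i]^o) -> E).
Hypothesis crossed : is_crossed_product P iota.
Local Notation subsets := {ptws G -> bool}.
Local Notation Om := (nica_spectrum P).
Local Notation fct := (subsets -> R[i]^o).
Local Notation fs := (@finite_sums R G P).
Local Notation cylc := (@cyl_continuous R G P).
Local Notation chi := (@chi R G).
Local Notation C := R[i].

Definition el (f : fct) (t : G) : E := iota (single t f).

Lemma iota_lin k a b : fs a -> fs b -> iota (k *: a + b) = k *: iota a + iota b.
Proof. by case: crossed => + _ _ _ _; apply. Qed.

Lemma iotaM a b : fs a -> fs b -> iota (sums_mul P a b) = cmul (iota a) (iota b).
Proof. by case: crossed => _ + _ _ _; apply. Qed.

Lemma iota_star a : fs a -> iota (sums_star P a) = cstar (iota a).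
Proof. by case: crossed => _ _ + _ _; apply. Qed.

Lemma iotaD a b : fs a -> fs b -> iota (a + b) = iota a + iota b.
Proof. by move=> fa fb; rewrite -[a in LHS]scale1r iota_lin // scale1r. Qed.

Lemma iota0 : iota 0 = 0.
Proof.
apply: (@addrI _ (iota 0)); rewrite -iotaD ?addr0 //; exact: finite_sums0.
Qed.

Lemma iotaZ k a : fs a -> iota (k *: a) = k *: iota a.
Proof.
by move=> fa; rewrite -[k *: a]addr0 iota_lin ?iota0 ?addr0 //; exact: finite_sums0.
Qed.

Lemma finite_sumsB a b : fs a -> fs b -> fs (a - b).
Proof.
move=> fa fb; apply: finite_sumsD => //.
by rewrite -scaleN1r; exact: finite_sumsZ.
Qed.

Lemma iotaB a b : fs a -> fs b -> iota (a - b) = iota a - iota b.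
Proof.
move=> fa fb; rewrite iotaD //; last by rewrite -scaleN1r; exact: finite_sumsZ.
by rewrite -scaleN1r iotaZ // scaleN1r.
Qed.

Lemma iota_dense x (eps : C) : 0 < eps -> exists2 a, fs a & `|iota a - x| < eps.
Proof.
move=> eps0; case: crossed => _ _ _ dense _.
have /(_ (ball x eps)) : closure (iota @` fs) x by rewrite dense.
case=> [|_ [[a fa <-]]]; first exact: nbhsx_ballx.
by rewrite -ball_normE /= distrC; exists a.
Qed.

Lemma iota_ind (Q : E -> Prop) : closed Q -> (forall x y, Q x -> Q y -> Q (x + y)) ->
  Q 0 -> (forall t f, C0 P t f -> Q (el f t)) -> forall x, Q x.
Proof.
move=> cQ QD Q0 Qel x; apply: closed_eps => // eps eps0.
have [a fa ax] := iota_dense x eps0; exists (iota a); last by rewrite distrC ltW.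
have [L [_ ->]] := finite_sums_decomp fa.
have aC t := finite_sums_C0 t fa.
suff [] : fs (\sum_(t <- L) single t (a t)) /\ Q (iota (\sum_(t <- L) single t (a t))) by [].
elim/big_ind: _ => [|b c [fb Qb] [fc Qc]|t _].
- by rewrite iota0; split=> //; exact: finite_sums0.
- by split; [exact: finite_sumsD|rewrite iotaD //; exact: QD].
- by split; [exact: finite_sums_single|exact: Qel].
Qed.

Lemma elM s t f g : C0 P s f -> C0 P t g ->
  cmul (el f s) (el g t) = el (fun w => f w * g (gshift s w)) (s * t)%g.
Proof.
move=> Cf Cg; rewrite -iotaM ?sums_mul_single //; exact: finite_sums_single.
Qed.

Lemma el_star t f : C0 P t f ->
  cstar (el f t) = el (fun w => Num.conj (f (gshift t^-1 w))) t^-1%g.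
Proof.
move=> Cf; rewrite -iota_star ?sums_star_single //; exact: finite_sums_single.
Qed.

Lemma el_eq t f g : C0 P t f -> C0 P t g -> (forall w, Om w -> w t -> f w = g w) ->
  el f t = el g t.
Proof.
move=> Cf Cg fg; congr (iota (single t _)); apply/funext => w.
have [[Ow wt]|nw] := pselect (Om w /\ w t); first exact: fg.
by case: Cf Cg => _ f0 [_ g0]; rewrite f0 ?g0.
Qed.

(** The structure [cstarAlgType] postulates no unit; the indicator of the spectrum is one by density
    of the finite sums. *)
Definition cunit : E := el (chi Om) 1%g.

Lemma cyl_set_Om : @cyl_set G P Om.
Proof. by exists [::] => w v Ow Ov _. Qed.

Lemma C0_Om1 : C0 P 1%g (chi Om : fct).
Proof.
by apply: C0_chi => [|w Ow]; [exact: cyl_set_Om|split=> //; exact: spectrum1 Ow].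
Qed.

Lemma chi1 V w : V w -> chi V w = 1. Proof. by move=> Vw; rewrite /chi asboolT. Qed.

Lemma chi0 V w : ~ V w -> chi V w = 0. Proof. by move=> Vw; rewrite /chi asboolF. Qed.

Lemma cylc_C01 (f : fct) : cylc f -> (forall w, f w <> 0 -> Om w) -> C0 P 1%g f.
Proof. by move=> cf f0; apply/C0E; split=> // w /f0 Ow; split=> //; exact: spectrum1 Ow. Qed.

Lemma elM1 t f g : C0 P 1%g f -> C0 P t g ->
  cmul (el f 1%g) (el g t) = el (fun w => f w * g w) t.
Proof.
move=> Cf Cg; rewrite elM // mul1g; congr (el _ t).
by apply/funext => w; rewrite gshift1.
Qed.

Lemma elMr1 s f g : C0 P s f -> C0 P 1%g g ->
  cmul (el f s) (el g 1%g) = el (fun w => f w * g (gshift s w)) s.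
Proof. by move=> Cf Cg; rewrite elM // mulg1. Qed.

Lemma el_star1 f : C0 P 1%g f -> cstar (el f 1%g) = el (fun w => Num.conj (f w)) 1%g.
Proof.
move=> Cf; rewrite el_star // invg1; congr (el _ 1%g).
by apply/funext => w; rewrite gshift1.
Qed.

Lemma cmul_continuousl x : continuous (fun y : E => cmul x y).
Proof.
move=> y; apply/cvgrPdist_le => eps eps0.
have N0 : 0 < `|x| + 1 by apply: ltr_wpDl => //; exact: ltr01.
apply/nbhs_ballP; exists (eps / (`|x| + 1)); first by rewrite /= divr_gt0.
move=> z; rewrite -ball_normE /= => yz; rewrite -cmulBr.
apply: le_trans (cnormM _ _) _; apply: (@le_trans _ _ ((`|x| + 1) * (eps / (`|x| + 1)))).
  by apply: ler_pM => //; [rewrite lerDl ler01|exact: ltW].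
by rewrite mulrCA divff ?mulr1 // gt_eqF.
Qed.

Lemma cmul_continuousr x : continuous (fun y : E => cmul y x).
Proof.
move=> y; apply/cvgrPdist_le => eps eps0.
have N0 : 0 < `|x| + 1 by apply: ltr_wpDl => //; exact: ltr01.
apply/nbhs_ballP; exists (eps / (`|x| + 1)); first by rewrite /= divr_gt0.
move=> z; rewrite -ball_normE /= => yz; rewrite -cmulBl.
apply: le_trans (cnormM _ _) _; apply: (@le_trans _ _ ((eps / (`|x| + 1)) * (`|x| + 1))).
  by apply: ler_pM => //; [exact: ltW|rewrite lerDl ler01].
by rewrite mulfVK // gt_eqF.
Qed.

Lemma closed_eq_continuous (f g : E -> E) : continuous f -> continuous g ->
  closed [set x | f x = g x].
Proof.
move=> cf cg; have -> : [set x | f x = g x] = (fun x => f x - g x) @^-1` [set 0].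
  apply/seteqP; split=> x /=; first by move=> ->; rewrite subrr.
  by move/eqP; rewrite subr_eq0 => /eqP.
apply: closed_comp; last exact/accessible_closed_set1/hausdorff_accessible/norm_hausdorff.
by move=> x _; apply: cvgB; [exact: cf|exact: cg].
Qed.

Lemma cmul1x x : cmul cunit x = x.
Proof.
move: x; apply: iota_ind.
- by apply: closed_eq_continuous; [exact: cmul_continuousl|move=> x; exact: cvg_id].
- by move=> x y xE yE; rewrite cmulDr xE yE.
- exact: cmulx0.
move=> t f Cf; rewrite elM1 //; last exact: C0_Om1.
apply: (@el_eq t) => //; first by apply: C0_mul => //; case/C0E: C0_Om1.
by move=> w Ow _; rewrite chi1 // mul1r.
Qed.

Lemma cmulx1 x : cmul x cunit = x.
Proof.
move: x; apply: iota_ind.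
- by apply: closed_eq_continuous; [exact: cmul_continuousr|move=> x; exact: cvg_id].
- by move=> x y xE yE; rewrite cmulDl xE yE.
- exact: cmul0x.
move=> t f Cf; rewrite elMr1 //; last exact: C0_Om1.
apply: (@el_eq t) => //.
  by have := C0_shiftM Cf C0_Om1; rewrite mulg1.
by move=> w Ow wt; rewrite chi1 ?mulr1 //; exact: spectrum_shift.
Qed.

Lemma norm_cunit_le1 : `|cunit| <= 1.
Proof.
have sE : cstar cunit = cunit.
  rewrite el_star1; last exact: C0_Om1.
  congr (el _ _); apply/funext => w; rewrite /chi.
  by case: asboolP; rewrite ?conjC1 ?conjC0.
have := cnorm_star cunit; rewrite sE cmul1x expr2 => nE.
have [->//|n0] := eqVneq `|cunit| 0.
by have := mulfI n0 (etrans (mulr1 _) nE) => <-.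
Qed.

Lemma el_unitary_le1 u : cylc u -> (forall w, u w <> 0 -> Om w) ->
  (forall w, Om w -> `|u w| = 1) -> `|el u 1%g| <= 1.
Proof.
move=> cu u0 u1; have Cu := cylc_C01 cu u0.
rewrite -(@ler_pXn2r _ 2) ?nnegrE ?ler01 // expr1n -cnorm_star el_star1 //.
have Cu' : C0 P 1%g (fun w => Num.conj (u w)).
  apply: cylc_C01 => [|w uw].
    move=> w Ow eps eps0; have [X Xu] := cu w Ow eps eps0.
    by exists X => v Ov a; rewrite -rmorphB norm_conjC; exact: Xu.
  by apply: u0 => uw0; apply: uw; rewrite uw0 conjC0.
rewrite elM1 // (@el_eq 1%g _ (chi Om)) //; first exact: norm_cunit_le1.
- by apply: C0_mul => //; case/C0E: Cu'.
- exact: C0_Om1.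
by move=> w Ow _; rewrite chi1 // mulrC -normCK u1 // expr1n.
Qed.

Lemma sqrtC_dist (a b : C) : 0 <= a -> 0 <= b -> `|sqrtC a - sqrtC b| ^+ 2 <= `|a - b|.
Proof.
move=> a0 b0; set x := sqrtC a; set y := sqrtC b.
have x0 : 0 <= x by rewrite sqrtC_ge0.
have y0 : 0 <= y by rewrite sqrtC_ge0.
rewrite -[a]sqrtCK -[b]sqrtCK -/x -/y subr_sqr normrM expr2 ler_wpM2l //.
by rewrite [leRHS]ger0_norm ?addr_ge0 // (le_trans (ler_normB _ _)) // !ger0_norm.
Qed.

(** The function [h] is the mean of the two unitaries $h\pm i\sqrt{1-h^2}$. *)
Lemma el_real_le1 h : cylc h -> (forall w, h w <> 0 -> Om w) ->
  (forall w, 0 <= h w <= 1) -> `|el h 1%g| <= 1.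
Proof.
move=> ch h0 h01; have Ch := cylc_C01 ch h0.
pose g : fct := fun w => if `[< Om w >] then sqrtC (1 - h w ^+ 2) else 0.
have h2 w : 0 <= 1 - h w ^+ 2.
  by have /andP[hw hw1] := h01 w; rewrite subr_ge0 exprn_ile1.
have cg : cylc g.
  have ch2 : cylc (fun w => h w * h w) by exact: cyl_continuousM.
  move=> w Ow eps eps0; have e2 : 0 < eps ^+ 2 by exact: exprn_gt0.
  have [X Xh] := ch2 w Ow _ e2; exists X => v Ov a.
  rewrite /g !asboolT // -(@ltr_pXn2r _ 2) ?nnegrE // ?ltW //.
  apply: le_lt_trans (sqrtC_dist (h2 v) (h2 w)) _.
  by rewrite opprB addrC subrKA distrC !expr2; exact: Xh.
have g0 w : g w <> 0 -> Om w by rewrite /g; case: asboolP.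
have Cg := cylc_C01 cg g0.
pose u (s : C) : fct := fun w => h w + s * g w.
have Cu s : C0 P 1%g (u s).
  by apply: C0D => //; apply: (C0_mul Cg) => //; exact: cyl_continuous_cst.
have nu s : s ^+ 2 = -1 -> Num.conj s = - s -> `|el (u s) 1%g| <= 1.
  move=> s2 sc; apply: el_unitary_le1.
  - by case/C0E: (Cu s).
  - by case/C0E: (Cu s) => _ us w /us[].
  move=> w Ow; apply/eqP; rewrite -sqrp_eq1 // normCK /u rmorphD rmorphM /= sc.
  have hr : Num.conj (h w) = h w by apply/CrealP; rewrite ger0_real //; case/andP: (h01 w).
  have gr : Num.conj (g w) = g w.
    by apply/CrealP; rewrite ger0_real // /g asboolT // sqrtC_ge0.
  rewrite hr gr mulNr mulrC -subr_sqr exprMn s2 mulN1r opprK.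
  by rewrite /g asboolT // sqrtCK addrC subrK.
have hE : el h 1%g = 2^-1 *: (el (u 'i) 1%g + el (u (- 'i)) 1%g).
  rewrite /el -iotaD; [|exact: finite_sums_single..].
  rewrite -iotaZ; last by apply: finite_sumsD; exact: finite_sums_single.
  congr iota; apply/funext => t; apply/funext => w.
  rewrite -[RHS]/(2^-1 * (single 1%g (u 'i) t w + single 1%g (u (- 'i)) t w)).
  rewrite /single; case: eqP => _; last by rewrite addr0 mulr0.
  by rewrite /u mulNr addrACA subrr addr0 -mulr2n -(mulr_natl (h w)) mulKf.
have i2 : (- 'i) ^+ 2 = -1 :> C by rewrite sqrrN sqrCi.
have ic : Num.conj (- 'i) = - - 'i :> C by rewrite rmorphN /= conjCi.
have n1 := nu 'i (sqrCi _) (conjCi _); have n2 := nu (- 'i) i2 ic.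
rewrite hE normrZ normfV normr_nat ler_pdivrMl // mulr1.
by apply: le_trans (ler_normD _ _) _; rewrite (natrD _ 1 1) lerD.
Qed.

(** By the C*-identity it suffices to bound $|f|^2/M^2$, which has values in $[0,1]$. *)
Lemma el_le M f : cylc f -> (forall w, f w <> 0 -> Om w) -> 0 <= M ->
  (forall w, Om w -> `|f w| <= M) -> `|el f 1%g| <= M.
Proof.
move=> cf f0 M0 fM; have Cf := cylc_C01 cf f0.
have fM' w : `|f w| <= M.
  have [->|/eqP /f0 /fM//] := eqVneq (f w) 0; by rewrite normr0.
have [MM|Mn0] := eqVneq M 0.
  have -> : f = 0 by apply/funext => w; apply/eqP; rewrite -normr_le0 -MM.
  have -> : el 0 1%g = 0.
    rewrite -iota0; congr iota; apply/funext => t; rewrite /single.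
    by case: ifP.
  by rewrite normr0.
have Mp : 0 < M by rewrite lt_def Mn0.
pose h : fct := fun w => M^-1 ^+ 2 * (Num.conj (f w) * f w).
have Cf' : C0 P 1%g (fun w => Num.conj (f w)).
  apply: cylc_C01 => [|w fw].
    move=> w Ow eps eps0; have [X Xu] := cf w Ow eps eps0.
    by exists X => v Ov a; rewrite -rmorphB norm_conjC; exact: Xu.
  by apply: f0 => fw0; apply: fw; rewrite fw0 conjC0.
have Cff : C0 P 1%g (fun w => Num.conj (f w) * f w).
  by apply: C0_mul => //; case/C0E: Cf'.
have Ch : C0 P 1%g h by apply: C0_mul => //; exact: cyl_continuous_cst.
have hE : el h 1%g = M^-1 ^+ 2 *: cmul (cstar (el f 1%g)) (el f 1%g).
  rewrite el_star1 // elM1 // /el -iotaZ; last exact: finite_sums_single.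
  congr iota; apply/funext => t; apply/funext => w.
  rewrite -[RHS]/(M^-1 ^+ 2 * (single 1%g (fun w => Num.conj (f w) * f w) t w)).
  by rewrite /single; case: eqP => // _; rewrite mulr0.
have : `|el h 1%g| <= 1.
  apply: el_real_le1.
  - by case/C0E: Ch.
  - by case/C0E: Ch => _ hw w /hw[].
  move=> w; rewrite /h mulrC (mulrC (Num.conj _)) -normCK -exprMn exprn_ge0 /=; last first.
    by rewrite mulr_ge0 // invr_ge0.
  by rewrite exprn_ile1 // ?mulr_ge0 ?invr_ge0 // ler_pdivrMr // mul1r.
rewrite hE normrZ cnorm_star normrX normfV (ger0_norm M0) -exprMn.
rewrite -[X in _ <= X](expr1n _ 2) ler_pXn2r ?nnegrE ?ler01 ?mulr_ge0 ?invr_ge0 //.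
by rewrite mulrC ler_pdivrMr // mul1r.
Qed.

End Crossed.

(** * Contractive multipliers and amenability *)

Section Multipliers.
Variables (R : realType) (G : groupType) (P : set G).
Variables (E : cstarAlgType R) (iota : (G -> {ptws G -> bool} -> R[i]^o) -> E).
Hypothesis crossed : is_crossed_product P iota.
Local Notation subsets := {ptws G -> bool}.
Local Notation Om := (nica_spectrum P).
Local Notation fct := (subsets -> R[i]^o).
Local Notation fs := (@finite_sums R G P).
Local Notation chi := (@chi R G).
Local Notation C := R[i].
Local Notation el := (el iota).

Definition mult (m a : G -> fct) : G -> fct := fun t w => m t w * a t w.

Definition admissible (m : G -> fct) : Prop :=
  forall t f, C0 P t f -> C0 P t (fun w => m t w * f w).

(* Contractive multipliers play the role of positive definite functions. *)
Definition contractive (m : G -> fct) : Prop :=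
  admissible m /\ forall a, fs a -> `|iota (mult m a)| <= `|iota a|.

Lemma finite_sums_mult m a : admissible m -> fs a -> fs (mult m a).
Proof.
move=> adm /finite_sumsP[[L aL] aC]; apply/finite_sumsP; split=> [|t]; last exact: adm.
by exists L => t /aL at0; apply/funext => w; rewrite /mult at0 mulr0.
Qed.

Lemma contractive_mul m n : contractive m -> contractive n ->
  contractive (fun t w => m t w * n t w).
Proof.
move=> [am cm] [an cn]; split=> [t f Cf|a fa].
  have := am t _ (an t f Cf); congr (C0 P t _).
  by apply/funext => w; rewrite mulrA.
have -> : mult (fun t w => m t w * n t w) a = mult m (mult n a).
  by apply/funext => t; apply/funext => w; rewrite /mult mulrA.
by apply: le_trans (cm _ (finite_sums_mult an fa)) _; exact: cn.
Qed.

Lemma contractive1 : contractive (fun _ _ => 1).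
Proof.
split=> [t f Cf|a fa].
  by rewrite (_ : (fun w => _) = f) //; apply/funext => w; rewrite mul1r.
rewrite (_ : mult _ a = a) //; apply/funext => t; apply/funext => w.
by rewrite /mult mul1r.
Qed.

Lemma C0_ext t (f g : fct) : C0 P t f -> (forall w, Om w -> w t -> g w = f w) ->
  (forall w, ~ (Om w /\ w t) -> g w = 0) -> C0 P t g.
Proof.
move=> Cf gf g0; suff -> : g = f by [].
apply/funext => w; have [[Ow wt]|nw] := pselect (Om w /\ w t); first exact: gf.
by rewrite g0 //; case: Cf => _ ->.
Qed.

Lemma C0_off t (f : fct) w : C0 P t f -> ~ (Om w /\ w t) -> f w = 0.
Proof. by case=> _; apply. Qed.

(** A finite sum involves finitely many [t], so [m] may be replaced by any contractive multiplier
    that agrees with it there. *)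
Lemma contractive_local m :
  (forall L : seq G, exists2 m', contractive m' &
     forall t w, t \in L -> Om w -> w t -> m t w = m' t w) -> contractive m.
Proof.
move=> loc.
have adm : admissible m.
  move=> t f Cf; have [m' [am' _] mm'] := loc [:: t].
  apply: (C0_ext (am' t f Cf)) => [w Ow wt|w nw].
    by rewrite mm' ?mem_head.
  by rewrite (C0_off Cf nw) mulr0.
split=> // a fa; have /finite_sumsP[[L aL] aC] := fa.
have [m' [am' cm'] mm'] := loc L.
have -> : mult m a = mult m' a; last exact: cm'.
apply/funext => t; apply/funext => w; rewrite /mult.
have [tL|/aL->] := boolP (t \in L); last by rewrite !mulr0.
have [[Ow wt]|nw] := pselect (Om w /\ w t); first by rewrite mm'.
by rewrite (C0_off (aC t) nw) !mulr0.
Qed.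

Lemma contractive_sum n (c : 'I_n -> C) (m : 'I_n -> G -> fct) :
  \sum_i `|c i| <= 1 -> (forall i, contractive (m i)) ->
  contractive (fun t w => \sum_i c i * m i t w).
Proof.
move=> c1 cm; have CZ t (k : C) f : C0 P t f -> C0 P t (fun w => k * f w).
  by move=> Cf; apply: C0_mul => //; exact: cyl_continuous_cst.
split=> [t f Cf|a fa].
  have -> : (fun w => (\sum_i c i * m i t w) * f w) =
      \sum_i (fun w => c i * (m i t w * f w)).
    apply/funext => w; rewrite fct_sumE mulr_suml.
    by apply: eq_bigr => i _; rewrite mulrA.
  elim/big_ind: _ => [|g h|i _]; [exact: C00|exact: C0D|].
  by apply: CZ; have [am _] := cm i; exact: am.
have -> : mult (fun t w => \sum_i c i * m i t w) a = \sum_i c i *: mult (m i) a.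
  apply/funext => t; apply/funext => w; rewrite !fct_sumE /mult mulr_suml.
  by apply: eq_bigr => i _; rewrite -mulrA.
have fm i : fs (c i *: mult (m i) a).
  by apply: finite_sumsZ; apply: finite_sums_mult => //; case: (cm i).
have sumE : fs (\sum_i c i *: mult (m i) a) /\
    `|iota (\sum_i c i *: mult (m i) a)| <= \sum_i `|c i| * `|iota a|.
  elim/big_ind2: _ => [|x X y Y [fx xX] [fy yY]|i _].
  - by split; [exact: finite_sums0|rewrite (iota0 crossed) normr0].
  - split; first exact: finite_sumsD.
    rewrite (iotaD crossed) //; apply: le_trans (ler_normD _ _) _.
    exact: lerD.
  - split=> //; have [am cmi] := cm i.
    rewrite (iotaZ crossed) ?normrZ; last exact: finite_sums_mult.
    by rewrite ler_wpM2l // cmi.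
apply: le_trans sumE.2 _; rewrite -mulr_suml.
by rewrite -[leRHS]mul1r ler_wpM2r.
Qed.

(** Multiplication by a unitary character respects products and adjoints of finite sums, so the
    twisted norm is again a C*-seminorm; maximality of the norm of [E] bounds it. *)
Lemma contractive_char (th : G -> C) : {morph th : x y / (x * y)%g >-> x * y} ->
  (forall t, `|th t| = 1) -> contractive (fun t _ => th t).
Proof.
move=> thM th1; have th_1 : th 1%g = 1.
  have th0 : th 1%g != 0 by rewrite -normr_eq0 th1 oner_eq0.
  by apply: (mulfI th0); rewrite -thM mulg1 mulr1.
have thV t : Num.conj (th t^-1%g) = th t.
  have tV : th t * th t^-1%g = 1 by rewrite -thM mulgV th_1.
  have nz : th t^-1%g != 0 by rewrite -normr_eq0 th1 oner_eq0.
  by apply: (mulfI nz); rewrite -normCK th1 expr1n mulrC.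
have adm : admissible (fun t _ => th t).
  by move=> t f Cf; apply: C0_mul => //; exact: cyl_continuous_cst.
split=> // a fa; case: crossed => _ _ _ _ univ.
apply: (univ (fun a => `|iota (mult (fun t _ => th t) a)|)) => // {a fa}.
have fm a : fs a -> fs (mult (fun t _ => th t) a) by exact: finite_sums_mult.
have mM a b : fs a -> fs b -> mult (fun t _ => th t) (sums_mul P a b) =
    sums_mul P (mult (fun t _ => th t) a) (mult (fun t _ => th t) b).
  move=> fa fb; apply/funext => r; apply/funext => w.
  have /finite_sumsP[[L aL] _] := fa.
  rewrite /mult !sums_mulE //; last exact: fm.
  rewrite !(fsbig_seqT (undup_uniq L)); try by move=> t; rewrite mem_undup => /aL->; rewrite ?mulr0 ?mul0r.
  rewrite mulr_sumr; apply: eq_bigr => s _.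
  by rewrite -[in LHS](mulVKg s r) thM mulVKg mulrACA.
have mS a : fs a -> mult (fun t _ => th t) (sums_star P a) =
    sums_star P (mult (fun t _ => th t) a).
  move=> fa; apply/funext => t; apply/funext => w.
  by rewrite /mult !sums_starE //; [rewrite rmorphM /= thV|exact: fm].
split=> [a fa|a b fa fb|k a fa|a b fa fb|a fa] //.
- have -> : mult (fun t _ => th t) (a + b) =
      mult (fun t _ => th t) a + mult (fun t _ => th t) b.
    by apply/funext => t; apply/funext => w; rewrite /mult -mulrDr.
  by rewrite (iotaD crossed) ?ler_normD //; exact: fm.
- have -> : mult (fun t _ => th t) (k *: a) = k *: mult (fun t _ => th t) a.
    apply/funext => t; apply/funext => w.
    by rewrite /mult -[(k *: a) t w]/(k * a t w) mulrCA.
  by rewrite (iotaZ crossed) ?normrZ //; exact: fm.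
- by rewrite mM // (iotaM crossed) ?cnormM //; exact: fm.
- have fsa := finite_sums_star fa; have fma := fm _ fa.
  rewrite mM // mS // (iotaM crossed) //; last exact: finite_sums_star.
  by rewrite (iota_star crossed) // cnorm_star.
Qed.

Lemma cyl_sign (V : set subsets) : cyl_set P V ->
  C0 P 1%g (fun w => if `[< Om w >] then (if `[< V w >] then 1 else -1) else 0 : C).
Proof.
move=> cV; apply: (cylc_C01 (P := P)) => [|w]; last by case: asboolP.
apply: cyl_continuous_if; first exact: cyl_set_Om.
  by apply: cyl_continuous_if => //; exact: cyl_continuous_cst.
exact: cyl_continuous_cst.
Qed.

Definition sign_kernel (V V' : set subsets) : G -> fct := fun t w =>
  if `[< V w <-> V' (gshift t w) >] then 1 else 0.

(* Averaging [y] and [u y u'] for two unitaries with values 1, -1. *)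
Lemma contractive_sign V V' : cyl_set P V -> cyl_set P V' ->
  contractive (sign_kernel V V').
Proof.
move=> cV cV'; pose u (W : set subsets) : fct :=
  fun w => if `[< Om w >] then (if `[< W w >] then 1 else -1) else 0.
have Cu W : cyl_set P W -> C0 P 1%g (u W) by exact: cyl_sign.
pose avg t (f : fct) : fct := fun w => 2^-1 * (f w + u V w * f w * u V' (gshift t w)).
have Cuf t f : C0 P t f -> C0 P t (fun w => u V w * f w * u V' (gshift t w)).
  move=> Cf; have := C0_shiftM (C0_shiftM (Cu V cV) Cf) (Cu V' cV').
  rewrite mul1g mulg1; congr (C0 P t _); apply/funext => w.
  by rewrite gshift1.
have half (z : C) : 2^-1 * (z + z) = z.
  by rewrite -mulr2n -[z *+ 2]mulr_natl mulKf // pnatr_eq0.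
have avgE t f w : C0 P t f -> sign_kernel V V' t w * f w = avg t f w.
  move=> Cf; rewrite /avg /sign_kernel.
  have [[Ow wt]|nw] := pselect (Om w /\ w t); last first.
    by rewrite (C0_off Cf nw) !(mulr0, mul0r, addr0).
  have Ow' := spectrum_shift Ow wt.
  rewrite /u (asboolT Ow) (asboolT Ow').
  have [Vw|nVw] := pselect (V w); have [Vw'|nVw'] := pselect (V' (gshift t w)).
  - by rewrite !asboolT // mul1r mulr1 half.
  - rewrite (asboolT Vw) (asboolF nVw') asboolF; last by move=> [/(_ Vw)].
    by rewrite mul1r mulrN1 subrr mulr0 mul0r.
  - rewrite (asboolT Vw') (asboolF nVw) asboolF; last by move=> [_ /(_ Vw')].
    by rewrite mulN1r mulr1 subrr mulr0 mul0r.
  - rewrite (asboolF nVw) (asboolF nVw') asboolT; last by [].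
    by rewrite mulN1r mulrN1 opprK mul1r half.
have CZ t (k : C) f : C0 P t f -> C0 P t (fun w => k * f w).
  by move=> Cf; apply: C0_mul => //; exact: cyl_continuous_cst.
have adm : admissible (sign_kernel V V').
  move=> t f Cf; rewrite (_ : (fun w => _) = avg t f); last first.
    by apply/funext => w; exact: avgE.
  by apply: CZ; exact: (C0D Cf (Cuf _ _ Cf)).
split=> // a fa; have /finite_sumsP[_ aC] := fa.
have nu W : cyl_set P W -> `|el (u W) 1%g| <= 1.
  move=> cW; apply: (el_unitary_le1 crossed).
  - by have /C0E[] := Cu W cW.
  - by move=> w; rewrite /u; case: asboolP.
  - by move=> w Ow; rewrite /u asboolT //; case: asboolP; rewrite ?normrN normr1.
have mE : iota (mult (sign_kernel V V') a) =
    2^-1 *: (iota a + cmul (cmul (el (u V) 1%g) (iota a)) (el (u V') 1%g)).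
  have [L [uL aL]] := finite_sums_decomp fa.
  pose b : G -> fct := fun t w => u V w * a t w * u V' (gshift t w).
  have fb : fs b.
    apply/finite_sumsP; split=> [|t]; last exact: Cuf.
    have /finite_sumsP[[M aM] _] := fa; exists M => t /aM at0.
    by apply/funext => w; rewrite /b at0 mulr0 mul0r.
  have -> : cmul (cmul (el (u V) 1%g) (iota a)) (el (u V') 1%g) = iota b.
    have fu W : cyl_set P W -> fs (single 1%g (u W)).
      by move=> cW; exact/finite_sums_single/Cu.
    have fua : fs (sums_mul P (single 1%g (u V)) a).
      by apply: finite_sumsM => //; exact: fu.
    rewrite -!(iotaM crossed) //; try exact: fu.
    congr iota; apply/funext => t; apply/funext => w.
    have uaE r v : sums_mul P (single 1%g (u V)) a r v = u V v * a r v.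
      rewrite sums_mulE; last exact: fu.
      rewrite (@fsbig_seqT _ _ [:: 1%g]) // => [|s]; last first.
        by rewrite inE /single => /negPf->; rewrite mul0r.
      by rewrite big_seq1 /single eqxx invg1 mul1g gshift1.
    rewrite sums_mulE // (@fsbig_seqT _ _ [:: t]) // => [|s]; last first.
      rewrite inE /single => st; rewrite (_ : (s^-1 * t == 1)%g = false) ?mulr0 //.
      by apply/negbTE; apply: contra st => /eqP st1; rewrite -[s]mulg1 -st1 mulVKg.
    by rewrite big_seq1 uaE /single mulVg eqxx.
  rewrite -(iotaD crossed) // -(iotaZ crossed); last exact: finite_sumsD.
  by congr iota; apply/funext => t; apply/funext => w; rewrite /mult avgE.
rewrite mE normrZ normfV normr_nat ler_pdivrMl //.
apply: le_trans (ler_normD _ _) _; rewrite mulr_natl mulr2n lerD2l.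
apply: le_trans (cnormM _ _) _; rewrite -[leRHS]mulr1; apply: ler_pM => //; last exact: nu.
apply: le_trans (cnormM _ _) _; rewrite -[leRHS]mul1r; apply: ler_pM => //; exact: nu.
Qed.

(** Equality of the labels is the conjunction, over the values [x] in [r], of the conditions that
    both or neither label equals [x]; each of these is a sign kernel. *)
Lemma contractive_label (L : Type) (r : seq L) (l l' : subsets -> L) :
  (forall w, Om w -> List.In (l w) r) ->
  (forall x, cyl_set P [set w | l w = x]) -> (forall x, cyl_set P [set w | l' w = x]) ->
  contractive (fun t w => if `[< l w = l' (gshift t w) >] then 1 else 0).
Proof.
move=> lr cl cl'.
pose k (q : seq L) : G -> fct := fun t w =>
  if `[< forall x, List.In x q -> l w = x <-> l' (gshift t w) = x >] then 1 else 0.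
have ck q : contractive (k q).
  elim: q => [|x q IHq].
    have -> : k [::] = (fun _ _ => 1); last exact: contractive1.
    by apply/funext => t; apply/funext => w; rewrite /k asboolT.
  have -> : k (x :: q) = fun t w =>
      sign_kernel [set w | l w = x] [set w | l' w = x] t w * k q t w.
    apply/funext => t; apply/funext => w; rewrite /k /sign_kernel.
    case: (pselect (l w = x <-> l' (gshift t w) = x)) => h; last first.
      rewrite (asboolF h) mul0r asboolF // => all_q; apply: h; apply: all_q.
      by left.
    rewrite (asboolT (P := [set _ | _] _ <-> _)) // mul1r.
    congr (if _ then _ else _); apply: asbool_equiv_eq; split=> all_q y.
      by move=> yq; apply: all_q; right.
    by move=> [<-//|]; exact: all_q.
  by apply: contractive_mul => //; exact: contractive_sign.
apply: contractive_local => M; exists (k r) => // t w _ Ow wt.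
rewrite /k; congr (if _ then _ else _); apply: asbool_equiv_eq; split.
  by move=> -> x _.
by move=> all_r; apply/esym; apply/all_r => //; exact: lr.
Qed.

End Multipliers.

(** * Roots of unity of dyadic order *)

Section Circle.
Variable R : realType.
Local Notation C := R[i].

Lemma dyadic_root n : exists z : C, (2 ^ n).-primitive_root z.
Proof.
(* The root is obtained from 1 and -1 by iterated square roots; having value -1 at half the exponent
   excludes all smaller orders. *)
have [z z1] : exists z : C, z ^+ (2 ^ n) = 1 /\ forall k, (2 ^ k.+1 %| 2 ^ n)%N -> (k.+1 = n)%N -> z ^+ (2 ^ k) = -1.
  elim: n => [|n [z [z1 zN]]]; first by exists 1; rewrite expr1n.
  case: n zN z1 => [|n] zN z1.
    by exists (-1); split=> [|k _ [->]]; rewrite ?sqrrN ?expr1n ?expr1.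
  exists (sqrtC z); have zE m : sqrtC z ^+ (2 ^ m.+1) = z ^+ (2 ^ m).
    by rewrite expnS exprM sqrtCK.
  split=> [|k _ [->]]; first by rewrite zE.
  by rewrite zE; apply: zN.
have [z2 zN] := z1; have N0 : (0 < 2 ^ n)%N by rewrite expn_gt0.
have [m mz mN] := prim_order_exists N0 z2; exists z.
have [k kn mE] : exists2 k, (k <= n)%N & m = (2 ^ k)%N.
  by have /(dvdn_pfactor _ _ (isT : prime 2)) := mN.
move: kn; rewrite leq_eqVlt => /predU1P[<-|]; first by rewrite -mE.
case: n zN {z1 z2 N0 mN} => // n zN kn.
have : z ^+ (2 ^ n) = 1.
  by rewrite -(subnKC (kn : k <= n)%N) expnD exprM -mE (prim_expr_order mz) expr1n.
rewrite zN // => /eqP; rewrite -subr_eq0 -opprD oppr_eq0.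
by rewrite -(natrD _ 1 1) pnatr_eq0.
Qed.

Lemma prim_root_norm N (z : C) : (0 < N)%N -> z ^+ N = 1 -> `|z| = 1.
Proof.
move=> N0 zN; apply/eqP; rewrite -(@pexpr_eq1 _ _ N) //.
by rewrite -normrX zN normr1.
Qed.

Lemma sum_root_unity N (z : C) (j : int) : (0 < N)%N -> N.-primitive_root z ->
  (`|j| < N)%N -> \sum_(i < N) (z ^+ i) ^ j = if j == 0 then N%:R else 0.
Proof.
move=> N0 zN jN.
have zz0 : z != 0 by rewrite -normr_eq0 (prim_root_norm N0 (prim_expr_order zN)) oner_eq0.
have E i : (z ^+ i) ^ j = (z ^ j) ^+ i.
  by rewrite !exprnP !exprz_exp mulrC.
under eq_bigr => i _ do rewrite E.
have [->|j0] := eqVneq j 0.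
  under eq_bigr => i _ do rewrite expr0z expr1n.
  by rewrite sumr_const card_ord.
have z1 : z ^ j != 1.
  apply: contraNneq j0 => zj1.
  have zabs : z ^+ `|j|%N = 1.
    case: j zj1 {jN E} => k //= /eqP.
    by rewrite -[z ^ Negz k]/((z ^+ k.+1)^-1) invr_eq1 => /eqP.
  have : (N %| `|j|)%N by rewrite (prim_order_dvd zN) zabs.
  rewrite -absz_eq0; case: (`|j|%N) jN => // k kN /dvdn_leq => /(_ isT).
  by rewrite leqNgt kN.
have zjN : (z ^ j) ^+ N = 1.
  by rewrite -E (prim_expr_order zN) exp1rz.
apply/eqP; have := subrX1 (z ^ j) N; rewrite zjN subrr => /esym/eqP.
by rewrite mulf_eq0 subr_eq0 (negPf z1).
Qed.

End Circle.

(** * Multipliers from the gauge action *)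

Section Gauge.
Variables (R : realType) (G : groupType) (P : set G).
Variables (E : cstarAlgType R) (iota : (G -> {ptws G -> bool} -> R[i]^o) -> E).
Hypothesis crossed : is_crossed_product P iota.
Variable f : G -> int.
Hypothesis fM : {morph f : x y / (x * y)%g >-> x + y}.
Local Notation C := R[i].
Local Notation contr := (contractive P iota).

Lemma contractive_root N (z : C) k : (0 < N)%N -> N.-primitive_root z ->
  contr (fun t _ => (z ^+ k) ^ f t).
Proof.
move=> N0 zN; have zk1 : `|z ^+ k| = 1.
  by rewrite normrX (prim_root_norm N0 (prim_expr_order zN)) expr1n.
have zk0 : z ^+ k != 0 by rewrite -normr_eq0 zk1 oner_eq0.
apply: contractive_char => // [x y|t]; first by rewrite fM expfzDr.
have nz (j : int) : `|(z ^+ k) ^ j| = 1.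
  case: j => m; first by rewrite -exprnP normrX zk1 expr1n.
  by rewrite -[_ ^ _]/(((z ^+ k) ^+ m.+1)^-1) normfV normrX zk1 expr1n invr1.
exact: nz.
Qed.

Lemma dyadic_large (L : seq G) M : exists N (z : C),
  [/\ (M <= N)%N, (0 < N)%N, N.-primitive_root z &
    forall t, t \in L -> (M + `|f t| < N)%N].
Proof.
pose n := (M + \sum_(t <- L) `|f t|)%N.
have [z zN] := dyadic_root R n; exists (2 ^ n)%N, z.
have nlt : (n < 2 ^ n)%N by exact: ltn_expl.
split=> //; first by rewrite (leq_trans _ (ltnW nlt)) // leq_addr.
  by rewrite expn_gt0.
move=> t tL; apply: leq_ltn_trans nlt; rewrite leq_add2l.
by rewrite (big_rem t) //= leq_addr.
Qed.

(** A finite Fourier average of characters over the [N]-th roots of unity, with [N] too large for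
    wrap-around on the given list. *)
Lemma contractive_eq (d : int) : contr (fun t _ => (f t == d)%:R).
Proof.
apply: contractive_local => L.
have [N [z [_ N0 zN LN]]] := dyadic_large L `|d|.
have NC0 : (N%:R : C) != 0 by rewrite pnatr_eq0 -lt0n.
pose c (i : 'I_N) : C := N%:R^-1 * (z ^+ i) ^ (- d).
exists (fun t _ => \sum_(i < N) c i * (z ^+ i) ^ f t) => [|t w tL _ _].
  apply: (contractive_sum crossed (m := fun i t _ => (z ^+ i) ^ f t)).
    have zi1 (i : 'I_N) : `|c i| = N%:R^-1.
      have zi : `|z ^+ i| = 1.
        by rewrite normrX (prim_root_norm N0 (prim_expr_order zN)) expr1n.
      rewrite /c normrM normfV normr_nat -[RHS]mulr1; congr (_ * _).
      case: (- d) => m; first by rewrite -exprnP normrX zi expr1n.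
      by rewrite -[_ ^ _]/(((z ^+ i) ^+ m.+1)^-1) normfV normrX zi expr1n invr1.
    under eq_bigr => i _ do rewrite zi1.
    by rewrite sumr_const card_ord -[leLHS]mulr_natr mulVf.
  by move=> i; exact: contractive_root zN.
have zz0 : z != 0 by rewrite -normr_eq0 (prim_root_norm N0 (prim_expr_order zN)) oner_eq0.
under eq_bigr => i _ do rewrite /c -mulrA -expfzDr ?expf_neq0 // addrC.
rewrite -mulr_sumr (sum_root_unity N0 zN); last first.
  by have := LN _ tL; lia.
by rewrite subr_eq0; case: eqP => _; rewrite ?mulr0 ?mulVf.
Qed.

(** This is $\max(0,1-|j|/M)$, written as a count of pairs so that it is visibly a Fourier transform
    of squared Dirichlet sums. *)
Definition fejer (M : nat) (j : int) : C :=
  M%:R^-1 * \sum_(a < M) \sum_(b < M) (a%:Z - b%:Z + j == 0)%:R.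

Lemma fejer_eq0 M j : (M <= `|j|)%N -> fejer M j = 0.
Proof.
move=> Mj; rewrite /fejer big1 ?mulr0 // => a _; rewrite big1 // => b _.
case: eqP => // abj; have := ltn_ord a; have := ltn_ord b; lia.
Qed.

Lemma contractive_fejer M : (0 < M)%N -> contr (fun t _ => fejer M (f t)).
Proof.
move=> M0; apply: contractive_local => L.
(* The extra entry [1] gives [M < N], needed to evaluate the total weight. *)
have [N [z [_ N0 zN LN]]] := dyadic_large (1%g :: L) M.
have NC0 : (N%:R : C) != 0 by rewrite pnatr_eq0 -lt0n.
have MC0 : (M%:R : C) != 0 by rewrite pnatr_eq0 -lt0n.
have zz1 : `|z| = 1 by rewrite (prim_root_norm N0 (prim_expr_order zN)).
have zz0 : z != 0 by rewrite -normr_eq0 zz1 oner_eq0.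
pose D (i : nat) : C := \sum_(a < M) (z ^+ i) ^+ a.
pose c (i : 'I_N) : C := N%:R^-1 * M%:R^-1 * `|D i| ^+ 2.
have cE (j : int) : (M + `|j| < N)%N -> \sum_(i < N) c i * (z ^+ i) ^ j = fejer M j.
  move=> jN.
  have DE i : `|D i| ^+ 2 * (z ^+ i) ^ j =
      \sum_(a < M) \sum_(b < M) (z ^+ i) ^ (a%:Z - b%:Z + j).
    rewrite normCK rmorph_sum /D mulr_suml mulr_suml; apply: eq_bigr => a _.
    rewrite mulr_sumr mulr_suml; apply: eq_bigr => b _.
    have zi1 : `|z ^+ i| = 1 by rewrite normrX zz1 expr1n.
    have zi0 : z ^+ i != 0 by rewrite expf_neq0.
    rewrite !expfzDr // -exprnN; congr (_ * _ * _).
    have zb1 : `|(z ^+ i) ^+ b| = 1 by rewrite normrX zi1 expr1n.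
    apply: (@mulfI _ ((z ^+ i) ^+ b)); first by rewrite expf_neq0.
    by rewrite /= -normCK zb1 expr1n mulfV // expf_neq0.
  rewrite (eq_bigr (fun i : 'I_N => N%:R^-1 * M%:R^-1 *
      \sum_(a < M) \sum_(b < M) (z ^+ i) ^ (a%:Z - b%:Z + j))) => [|i _]; last first.
    by rewrite -DE mulrA.
  rewrite -mulr_sumr exchange_big /= /fejer -mulrA mulrCA; congr (_ * _).
  rewrite mulr_sumr; apply: eq_bigr => a _; rewrite exchange_big /= mulr_sumr.
  apply: eq_bigr => b _; rewrite (sum_root_unity N0 zN); last first.
    by have := ltn_ord a; have := ltn_ord b; lia.
  by case: eqP => _; rewrite ?mulr0 ?mulVf.
exists (fun t _ => \sum_(i < N) c i * (z ^+ i) ^ f t) => [|t w tL _ _].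
  apply: (contractive_sum crossed (m := fun i t _ => (z ^+ i) ^ f t)).
    (* The weights are nonnegative, so the sum of their absolute values is the kernel at 0. *)
    have c0 (i : 'I_N) : `|c i| = c i * (z ^+ i) ^ (0 : int).
      by rewrite expr0z mulr1 ger0_norm // /c mulr_ge0 // ?mulr_ge0 ?invr_ge0 ?exprn_ge0.
    under eq_bigr => i _ do rewrite c0.
    rewrite cE /fejer; last first.
      by have := LN _ (mem_head _ _); lia.
    rewrite mulrC ler_pdivrMr ?ltr0n // mul1r.
    have -> : M%:R = \sum_(a < M) 1 :> C by rewrite sumr_const card_ord.
    apply: ler_sum => a _; rewrite (bigD1 a) //= subrr addr0 eqxx big1 ?addr0 // => b ba.
    rewrite addr0 subr_eq0 eqz_nat; case: eqP => // /ord_inj ab.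
    by rewrite ab eqxx in ba.
  by move=> i; exact: contractive_root zN.
by rewrite cE //; apply: LN; rewrite inE tL orbT.
Qed.

Lemma fejerN M j : fejer M (- j) = fejer M j.
Proof.
congr (_ * _); rewrite exchange_big; apply: eq_bigr => b _; apply: eq_bigr => a _ /=.
by rewrite -oppr_eq0 opprD opprB opprK.
Qed.

Lemma fejer_dist M j : (0 < M)%N -> `|fejer M j - 1| <= `|j|%N%:R / M%:R.
Proof.
move=> M0; wlog: j / exists k : nat, j = k%:Z.
  move=> W; case: j => k; first by apply: W; exists k.
  by rewrite -fejerN NegzE opprK (W k.+1%:Z) //; exists k.+1.
move=> [k ->] {j}; have MC0 : (M%:R : C) != 0 by rewrite pnatr_eq0 -lt0n.
have Mp : 0 < (M%:R : C) by rewrite ltr0n.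
have row (a : 'I_M) :
    \sum_(b < M) (a%:Z - b%:Z + k%:Z == 0)%:R = (a + k < M)%N%:R :> C.
  case: ltnP => akM.
    rewrite (bigD1 (Ordinal akM)) //= PoszD opprD addrA subrr add0r addNr eqxx.
    rewrite big1 ?addr0 // => b /eqP bak; case: eqP => // abk; case: bak.
    by apply: val_inj => /=; lia.
  rewrite big1 // => b _; case: eqP => // abk; have := ltn_ord b; lia.
have fE : fejer M k = 1 - M%:R^-1 * \sum_(a < M) (M <= a + k)%N%:R.
  rewrite /fejer (eq_bigr _ (fun a _ => row a)).
  have e1 : M%:R^-1 * \sum_(a < M) 1 = 1 :> C by rewrite sumr_const card_ord mulVf.
  rewrite -[X in _ = X - _]e1 -mulrBr -sumrB; congr (_ * _); apply: eq_bigr => a _.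
  by rewrite ltnNge; case: leqP => _; rewrite ?subrr ?subr0.
rewrite fE addrC addKr normrN normrM normfV normr_nat mulrC ler_pM2r ?invr_gt0 //.
have -> : \sum_(a < M) (M <= a + k)%N%:R = (\sum_(a < M) (M <= a + k)%N)%N%:R :> C.
  by rewrite natr_sum.
rewrite normr_nat ler_nat.
have count_le n : (\sum_(a < n) (M <= a + k) <= n - (M - k))%N.
  elim: n => [|n IHn]; first by rewrite big_ord0.
  rewrite big_ord_recr /=; move: (\sum_(i < n) _)%N IHn => c.
  by case: leqP => /=; lia.
by apply: leq_trans (count_le M) _; lia.
Qed.

End Gauge.

Lemma In_map (T : eqType) (U : Type) (f : T -> U) (r : seq T) x :
  x \in r -> List.In (f x) [seq f y | y <- r].
Proof.
elim: r => //= y r IHr; rewrite inE => /predU1P[->|/IHr]; [by left|by right].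
Qed.

Lemma In_flatten (T : eqType) (U : Type) (f : T -> seq U) (x : T) (r : seq T) y :
  x \in r -> List.In y (f x) -> List.In y (flatten [seq f z | z <- r]).
Proof.
elim: r => //= z r IHr; rewrite inE => /predU1P[<-|xr] yfx; apply/List.in_or_app.
  by left.
by right; exact: IHr.
Qed.

(** * Multipliers of finite support from truncations of bounded degree *)

Section Psi.
Variables (R : realType) (S : choiceType) (e : rel S).
Hypotheses (e_sym : symmetric e) (e_irr : irreflexive e).
Local Notation G := (raag e).
Local Notation P := (@raag_pos S e).
Local Notation Om := (nica_spectrum P).
Local Notation subsets := {ptws G -> bool}.
Variables (E : cstarAlgType R) (iota : (G -> subsets -> R[i]^o) -> E).
Hypothesis crossed : is_crossed_product P iota.
Local Notation fct := (subsets -> R[i]^o).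
Local Notation contr := (contractive P iota).


Lemma raag_pos_anti x : P x -> P x^-1%g -> x = 1%g.
Proof.
move=> Px PxV; apply: len_eq0 => //; apply/eqP; rewrite eq_le len_ge0 // andbT.
by have := len_ge0 PxV; rewrite /len raag_degV oppr_ge0.
Qed.

Lemma ab_finite (x : G) : exists Q : seq S, forall s, s \notin Q -> ab s x = 0.
Proof.
have [u ->] := raag_word_surj x; exists [seq a.1 | a <- u] => s su.
rewrite /ab raag_deg_word /wdeg big_seq big1 // => a au.
have as_ : (a.1 == s) = false.
  by apply/negbTE; apply: contra su => /eqP <-; rewrite map_f.
by rewrite as_ oppr0; case: ifP.
Qed.

Lemma ab_finite_seq (L : seq G) :
  exists Q : seq S, forall (x : G) s, x \in L -> s \notin Q -> ab s x = 0.
Proof.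
elim: L => [|y L [Q QL]]; first by exists [::].
have [Q' Qy] := ab_finite y; exists (Q' ++ Q) => x s.
rewrite inE mem_cat negb_or => /predU1P[->|xL] /andP[sQ' sQ]; first exact: Qy.
exact: QL.
Qed.

Lemma finsupp_bound (X : seq G) : exists2 K, finsupp_nat K &
  forall (x q : G) s, x \in X -> is_join P 1%g x q -> ab s q <= K s.
Proof.
elim: X => [|x X [K Kfin KX]]; first by exists (fun=> 0) => //; split=> //; exists [::].
have [[q jq]|noq] := pselect (exists q, is_join P 1%g x q); last first.
  exists K => // y q s; rewrite inE => /predU1P[->|]; last exact: KX.
  by move=> jq; case: noq; exists q.
have Pq : P q by have [+ _ _] := jq; rewrite qle1.
have [Q Qq] := ab_finite q; have [K0 [F KF]] := Kfin.
exists (fun s => K s + ab s q).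
  split=> [s|]; first by rewrite addr_ge0 ?ab_ge0.
  by exists (F ++ Q) => s; rewrite mem_cat negb_or => /andP[/KF-> /Qq->].
move=> y q' s; rewrite inE => /predU1P[->|yX] jq'.
  by rewrite (is_join_uniq jq' jq) lerDr.
by rewrite (le_trans (KX _ _ _ yX jq')) // lerDl ab_ge0.
Qed.

Lemma top_agree k w v (L : seq G) : finsupp_nat k ->
  (forall p : G, box k p -> p \in L) -> Om w -> Om v -> agree L w v -> top k v = top k w.
Proof.
move=> kfin LP Ow Ov a.
have [bp wp pm] := topP e_sym e_irr kfin Ow.
apply: is_top_uniq (topP e_sym e_irr kfin Ov) _; split=> //.
  by rewrite (a _ (LP _ bp)).
by move=> q bq vq; apply: pm => //; rewrite -(a _ (LP _ bq)).
Qed.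

Lemma cyl_set_fun (T : Type) (g : subsets -> T) x :
  (exists X : seq G, forall w v, Om w -> Om v -> agree X w v -> g v = g w) ->
  cyl_set P [set w | g w = x].
Proof. by move=> [X gX]; exists X => w v Ow Ov /(gX _ _ Ow Ov) /= ->. Qed.

Definition top2 (k K : S -> int) (w : subsets) : G := top K (gshift (top k w) w).

Lemma top2_agree k K : finsupp_nat k -> finsupp_nat K ->
  exists X : seq G, forall w v, Om w -> Om v -> agree X w v ->
    top k v = top k w /\ top2 k K v = top2 k K w.
Proof.
move=> kfin Kfin; have [L LP] := finite_box e kfin; have [M MP] := finite_box e Kfin.
exists (L ++ [seq (p * x)%g | p <- L, x <- M]) => w v Ow Ov a.
have tE := top_agree kfin LP Ow Ov (agree_catl a).
split=> //; rewrite /top2 tE; have [bp wp _] := topP e_sym e_irr kfin Ow.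
have pL := LP _ bp; apply: (@top_agree K _ _ M) => //.
- exact: spectrum_shift.
- apply: spectrum_shift => //.
  by have [_] := topP e_sym e_irr kfin Ov; rewrite tE.
move=> x xM; rewrite /gshift; apply: (agree_catr a).
by apply/allpairsP; exists (top k w, x).
Qed.

Definition degk (F : seq S) (d : S -> int) : G -> fct := fun t _ =>
  if `[< forall s, s \notin F -> ab s t = d s >] then 1 else 0.

Lemma contractive_degk F d : (exists Q : seq S, forall s, s \notin Q -> d s = 0) ->
  contr (degk F d).
Proof.
move=> [Q dQ]; apply: contractive_local => L.
have [Q' LQ'] := ab_finite_seq L.
pose k (q : seq S) : G -> fct := fun t _ =>
  if `[< forall s, s \in q -> s \notin F -> ab s t = d s >] then 1 else 0.
have ck q : contr (k q).
  elim: q => [|s q IHq].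
    have -> : k [::] = (fun _ _ => 1); last exact: contractive1.
    by apply/funext => t; apply/funext => w; rewrite /k asboolT.
  have [sF|sF] := boolP (s \in F).
    have -> : k (s :: q) = k q; last by [].
    apply/funext => t; apply/funext => w; rewrite /k.
    congr (if _ then _ else _); apply: asbool_equiv_eq; split=> kq u.
      by move=> uq; apply: kq; rewrite inE uq orbT.
    rewrite inE => /predU1P[->|]; last exact: kq.
    by rewrite sF.
  have -> : k (s :: q) = fun t w => (ab s t == d s)%:R * k q t w.
    apply/funext => t; apply/funext => w; rewrite /k.
    case: eqP => h; last first.
      rewrite mul0r asboolF // => kq; apply: h; apply: kq => //; exact: mem_head.
    rewrite mul1r; congr (if _ then _ else _); apply: asbool_equiv_eq; split=> kq u.
      by move=> uq; apply: kq; rewrite inE uq orbT.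
    by rewrite inE => /predU1P[->|]; last exact: kq.
  apply: contractive_mul => //; apply: (contractive_eq crossed (f := ab s)).
  exact: abM.
exists (k (Q ++ Q')) => // t w tL _ _; rewrite /degk /k.
congr (if _ then _ else _); apply: asbool_equiv_eq; split=> kq u; first by move=> _; exact: kq.
have [uQ|uQ] := boolP (u \in Q ++ Q'); first exact: kq.
by move: uQ; rewrite mem_cat negb_or => /andP[/dQ-> /(LQ' _ _ tL)->].
Qed.

(* Exel's approximation property: [psi d k k'] is supported on finitely many  *)
(* [t] and is 1 on any given finite set of elements of degree [d], once [k]   *)
(* is large.                                                                  *)
Definition psi (d k k' : S -> int) : G -> fct := fun t w =>
  degk [::] d t w * (if `[< top k w = (t * top k' (gshift t w))%g >] then 1 else 0).

(** The condition $p=tp'$ on the two tops mentions [t], whereas [contractive_label] compares a label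
    of [w] with one of $t^{-1}w$. For finitely many [t] of degree [d] the condition is equivalent to
    such a comparison: the degrees of [p] and of [p'] must match up to [d], and so must the second
    truncations, taken past [p] and past [p'] with a large bound [K]. *)
Lemma contractive_psi d k k' : (exists Q : seq S, forall s, s \notin Q -> d s = 0) ->
  finsupp_nat k -> finsupp_nat k' -> contr (psi d k k').
Proof.
move=> dfin kfin k'fin; apply: contractive_local => L.
have [B BP] := finite_box e kfin; have [B' B'P] := finite_box e k'fin.
have [K Kfin KX] := finsupp_bound
  [seq (p^-1 * x)%g | p <- B, x <- [seq (t * p')%g | t <- L, p' <- B']].
have [BK BKP] := finite_box e Kfin.
pose l (w : subsets) : G * (S -> int) := (top2 k K w, fun s => ab s (top k w)).
pose l' (w : subsets) : G * (S -> int) := (top2 k' K w, fun s => ab s (top k' w) + d s).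
have Ol k1 w : finsupp_nat k1 -> Om w -> Om (gshift (top k1 w) w).
  by move=> k1fin Ow; apply: spectrum_shift => //; have [] := topP e_sym e_irr k1fin Ow.
have cl x : cyl_set P [set w | l w = x].
  apply: cyl_set_fun; have [X XE] := top2_agree kfin Kfin.
  by exists X => w v Ow Ov a; have [tE t2E] := XE w v Ow Ov a; rewrite /l tE t2E.
have cl' x : cyl_set P [set w | l' w = x].
  apply: cyl_set_fun; have [X XE] := top2_agree k'fin Kfin.
  by exists X => w v Ow Ov a; have [tE t2E] := XE w v Ow Ov a; rewrite /l' tE t2E.
pose r := flatten [seq [seq (q, fun s => ab s p) | p <- B] | q <- BK].
have lr w : Om w -> List.In (l w) r.
  move=> Ow; apply: (@In_flatten _ _ _ (top2 k K w)).
    by apply: BKP; have [] := topP e_sym e_irr Kfin (Ol k w kfin Ow).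
  apply: (@In_map _ _ (fun p : G => (top2 k K w, fun s => ab s p))).
  by apply: BP; have [] := topP e_sym e_irr kfin Ow.
have := contractive_mul (contractive_degk [::] dfin) (contractive_label crossed lr cl cl').
set m := (X in contr X); move=> cm; exists m => // t w tL Ow wt; rewrite /m /psi /degk.
case: asboolP => [td|_]; last by rewrite !mul0r.
have {}td s : ab s t = d s by exact: td.
rewrite !mul1r; congr (if _ then _ else _); apply: asbool_equiv_eq.
have Ow' := spectrum_shift Ow wt.
have [bp wp _] := topP e_sym e_irr kfin Ow.
have [bp' wp' _] := topP e_sym e_irr k'fin Ow'.
rewrite /l /l' /top2; set p := top k w in bp wp *.
set p' := top k' (gshift t w) in bp' wp' *.
split=> [ptp|[topE abE]].
  rewrite gshiftM -ptp; congr (_, _); apply/funext => s.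
  by rewrite ptp abM td addrC.
(* The discrepancy [tau] has degree 0, so [top_shift] with equal bounds says that the second
   truncations differ by the left factor [tau]; equality of labels forces [tau = 1]. *)
pose tau := (p^-1 * (t * p'))%g.
have ptau : (p * tau = t * p')%g by rewrite /tau mulVKg.
have w1tau : gshift p w tau by rewrite /gshift ptau.
have Ow1 := spectrum_shift Ow wp.
have [q jq _] := spectrum_bound Ow1 (spectrum1 Ow1) w1tau.
have qK s : ab s q <= K s.
  apply: KX jq; apply/allpairsP; exists (p, (t * p')%g); split=> //; first exact: BP.
  by apply/allpairsP; exists (t, p'); split=> //; exact: B'P.
have tau0 s : ab s tau = 0.
  have abp : ab s p = ab s p' + d s := congr1 (fun g => g s) abE.
  by rewrite /tau !abM abV td abp [d s + _]addrC addNr.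
have := top_shift e_sym e_irr Kfin Kfin Ow1 w1tau jq qK.
rewrite gshiftM ptau -gshiftM -topE => /(_ _)/wrap[] => [s|].
  by rewrite tau0 subr0.
move=> /esym tauE; have tau1 : tau = 1%g.
  by apply: (@mulIg _ (top K (gshift p w))); rewrite mul1g.
by rewrite -ptau tau1 mulg1.
Qed.

Lemma psi_finite d k k' : finsupp_nat k -> finsupp_nat k' -> exists X : seq G,
  forall t w, t \notin X -> Om w -> w t -> psi d k k' t w = 0.
Proof.
move=> kfin k'fin; have [B BP] := finite_box e kfin; have [B' B'P] := finite_box e k'fin.
exists [seq (p * p'^-1)%g | p <- B, p' <- B'] => t w tX Ow wt.
rewrite /psi; case: asboolP => [tE|_]; last by rewrite mulr0.
case/negP: tX; apply/allpairsP; exists (top k w, top k' (gshift t w)) => /=.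
have [bp _ _] := topP e_sym e_irr kfin Ow.
have [bp' _ _] := topP e_sym e_irr k'fin (spectrum_shift Ow wt).
by split; [exact: BP|exact: B'P|rewrite tE mulgK].
Qed.

(** Let [k] exceed the degrees of the existing $1\vee t$ for [t] in [L], and put [k' = k - d]; the
    condition on tops is then automatic by [top_shift]. *)
Lemma psi_large d (L : seq G) : (exists Q : seq S, forall s, s \notin Q -> d s = 0) ->
  exists k k', [/\ finsupp_nat k, finsupp_nat k' &
    forall t w, t \in L -> Om w -> w t -> psi d k k' t w = degk [::] d t w].
Proof.
move=> [Q dQ]; have [K [K0 [F KF]] KX] := finsupp_bound L.
pose k s := K s + `|d s|; pose k' s := k s - d s.
have kfin : finsupp_nat k.
  split=> [s|]; first by rewrite addr_ge0.
  by exists (F ++ Q) => s; rewrite mem_cat negb_or => /andP[/KF Ks /dQ ds];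
    rewrite /k Ks ds normr0 addr0.
have k'fin : finsupp_nat k'.
  split=> [s|].
    by rewrite /k' /k -addrA addr_ge0 // subr_ge0 ler_norm.
  by exists (F ++ Q) => s; rewrite mem_cat negb_or => /andP[/KF Ks /dQ ds];
    rewrite /k' /k Ks ds normr0 addr0 subr0.
exists k, k'; split=> // t w tL Ow wt; rewrite /psi /degk.
case: asboolP => [td|_]; last by rewrite mul0r.
have [q jq _] := spectrum_bound Ow (spectrum1 Ow) wt.
rewrite asboolT ?mulr1 //; apply: (top_shift e_sym e_irr kfin k'fin Ow wt jq) => s.
  by rewrite (le_trans (KX _ _ _ tL jq)) // lerDl.
by rewrite td.
Qed.

End Psi.

(** * Approximation modulo a closed ideal *)

Section Good.
Variables (R : realType) (G : groupType) (P : set G).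
Hypotheses (P1 : P 1%g) (PM : forall x y, P x -> P y -> P (x * y)%g)
  (Panti : forall x, P x -> P x^-1%g -> x = 1%g).
Variables (E : cstarAlgType R) (iota : (G -> {ptws G -> bool} -> R[i]^o) -> E).
Hypothesis crossed : is_crossed_product P iota.
Local Notation subsets := {ptws G -> bool}.
Local Notation Om := (nica_spectrum P).
Local Notation fct := (subsets -> R[i]^o).
Local Notation fs := (@finite_sums R G P).
Local Notation chi := (@chi R G).
Local Notation C := R[i].
Local Notation el := (el iota).
Local Notation contr := (contractive P iota).
Local Notation adm := (@admissible R G P).

Lemma iota_seq (X : seq G) b : fs b -> uniq X -> (forall t, t \notin X -> b t = 0) ->
  iota b = \sum_(t <- X) el (b t) t.
Proof.
move=> fb uX bX; have bC t := finite_sums_C0 t fb.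
have {1}-> : b = \sum_(t <- X) single t (b t).
  apply/funext => t; rewrite fct_sumE /single.
  have [tX|tX] := boolP (t \in X); last first.
    rewrite bX // big_seq big1 // => s sX.
    by case: eqP => // ts; rewrite ts sX in tX.
  rewrite (bigD1_seq t) //= eqxx big1 ?addr0 // => s.
  by rewrite eq_sym => /negPf->.
suff [] : fs (\sum_(t <- X) single t (b t)) /\
  iota (\sum_(t <- X) single t (b t)) = \sum_(t <- X) el (b t) t by [].
elim: X {uX bX} => [|t X [fX iX]].
  by rewrite !big_nil (iota0 crossed); split=> //; exact: finite_sums0.
rewrite !big_cons; have ft := finite_sums_single (bC t).
by split; [exact: finite_sumsD|rewrite (iotaD crossed) // iX].
Qed.

(* [vanish w x]: the value at [w] of the coefficient of [delta_1] in [x] is 0. *)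
Definition vanish (w : subsets) (x : E) : Prop := forall eps : C, 0 < eps ->
  exists2 a, fs a & `|iota a - x| <= eps /\ `|a 1%g w| <= eps.

(** Testing all products $bxc$ makes this a two-sided ideal; it is the candidate for the ideal
    attached to [W]. *)
Definition residual (W : set subsets) : set E :=
  [set x | forall w, W w -> forall b c, vanish w (cmul (cmul b x) c)].

Variables (W : set subsets) (K : set E).
Hypotheses (W_Om : W `<=` Om) (idK : closed_ideal K).
Hypothesis K_small : forall (f : fct) (eps : C), C0 P 1%g f -> 0 < eps ->
  (forall w, W w -> `|f w| <= eps) -> exists2 k, K k & `|el f 1%g - k| <= eps + eps.

(** The aim is [good] for the constant 1, which says that the residual lies in the closed ideal
    [K]. *)
Definition good (m : G -> fct) : Prop := forall x, residual W x ->
  forall eps : C, 0 < eps -> exists2 dlt : C, 0 < dlt & forall a, fs a ->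
    `|iota a - x| <= dlt -> exists2 k, K k & `|iota (mult m a) - k| <= eps.

Lemma chiU_C0 t : C0 P t (chi [set w | Om w /\ w t]).
Proof.
apply: C0_chi => //; exists [:: t] => w v Ow Ov /(_ t (mem_head _ _)) vt.
by rewrite /= vt; split=> -[].
Qed.

Definition vt (t : G) : E := el (chi [set w | Om w /\ w t]) t.

Lemma vt_le1 t : `|vt t| <= 1.
Proof.
have Ct := chiU_C0 t.
rewrite -(@ler_pXn2r _ 2) ?nnegrE ?ler01 // expr1n -cnorm_star.
have fst_ := finite_sums_single Ct.
rewrite -(iota_star crossed) // -(iotaM crossed) //; last exact: finite_sums_star.
pose f : fct := fun w => Num.conj (chi [set w | Om w /\ w t] (gshift t^-1 w)) *
  chi [set w | Om w /\ w t] (gshift t^-1 w).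
have E1 : sums_mul P (sums_star P (single t (chi [set w | Om w /\ w t])))
    (single t (chi [set w | Om w /\ w t])) = single 1%g f.
  rewrite sums_star_single // sums_mul_single ?mulVg //.
  have := finite_sums_C0 t^-1%g (finite_sums_star fst_).
  by rewrite sums_star_single // /single eqxx.
have fE1 : fs (single 1%g f).
  by rewrite -E1; apply: finite_sumsM => //; exact: finite_sums_star.
have := finite_sums_C0 1%g fE1; rewrite {1}/single eqxx => /C0E[cf f0].
rewrite E1; apply: (el_le crossed cf) => // [w /f0[]//|w _].
rewrite /f /chi; case: asboolP => _; rewrite ?mulr0 ?normr0 ?ler01 //.
by rewrite mulr1 norm_conjC normr1.
Qed.

(** A finite sum near an element of the residual has small coefficients on [W]; [K_small] brings
    each of the finitely many coefficients kept by [m] near [K]. *)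
Lemma good_finite m (X : seq G) : adm m ->
  (forall t w, t \notin X -> Om w -> w t -> m t w = 0) ->
  (forall t w, Om w -> w t -> `|m t w| <= 1) -> good m.
Proof.
move=> am mX m1 x Lx eps eps0.
(* Each coefficient is at most [3 dl] on [W], which [K_small] doubles to [6 dl]; there are [size Y]
   of them. *)
pose Y := undup X; pose n : C := (6 * (size Y).+1)%:R.
have n0 : 0 < n by rewrite ltr0n.
pose dl := eps / n; have dl0 : 0 < dl by rewrite divr_gt0.
exists dl => // a fa ax; have fma := finite_sums_mult am fa.
have term t : exists2 k, K k & `|el (mult m a t) t - k| <= dl *+ 6.
  have Ct := finite_sums_C0 t fma; have Cta := finite_sums_C0 t fa.
  have Ct1 : C0 P 1%g (mult m a t).
    by case/C0E: Ct => cf f0; apply: cylc_C01 => // w /f0[].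
  have small w : W w -> `|mult m a t w| <= dl *+ 3.
    move=> Ww; have Ow := W_Om Ww.
    apply: (@le_trans _ _ `|a t w|).
      have [[_ wt]|nw] := pselect (Om w /\ w t).
        by rewrite /mult normrM -[leRHS]mul1r ler_wpM2r // m1.
      by rewrite /mult (C0_off Cta nw) mulr0.
    have [c fc [cx cw]] := Lx w Ww (cunit P iota) (vt t^-1%g) dl dl0.
    rewrite (cmul1x crossed) in cx.
    have Cv := chiU_C0 t^-1%g; have fv := finite_sums_single Cv.
    (* Multiplying by $\delta_{t^{-1}}$ turns the coefficient at [t] into the coefficient at 1,
       where the residual gives information. *)
    pose b := sums_mul P a (single t^-1%g (chi [set w | Om w /\ w t^-1%g])).
    have fb : fs b by exact: finite_sumsM.
    have bE : b 1%g w = a t w.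
      rewrite /b sums_mulE // (@fsbig_seqT _ _ [:: t]) // => [|s]; last first.
        rewrite inE /single mulg1 => st.
        by rewrite (inj_eq invg_inj) (negPf st) mulr0.
      rewrite big_seq1 /single mulg1 eqxx.
      have [[_ wt]|nw] := pselect (Om w /\ w t); last by rewrite (C0_off Cta nw) mul0r.
      rewrite chi1 ?mulr1 //; split; first exact: spectrum_shift.
      by rewrite /gshift mulgV; exact: spectrum1 Ow.
    have bc : `|b 1%g w - c 1%g w| <= dl *+ 2.
      have := crossed_product_coef P1 PM Panti crossed (finite_sumsB fb fc) Ow.
      rewrite -[(b - c) 1%g w]/(b 1%g w - c 1%g w) => /le_trans; apply.
      rewrite (iotaB crossed) // /b (iotaM crossed) //.
      rewrite -[X in `|X|](subrKA (cmul x (vt t^-1%g))) -cmulBl mulr2n.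
      apply: le_trans (ler_normD _ _) _; apply: lerD; last by rewrite distrC.
      apply: le_trans (cnormM _ _) _; rewrite -[leRHS]mulr1.
      by apply: ler_pM => //; exact: vt_le1.
    rewrite -bE -[b 1%g w](subrK (c 1%g w)) mulrSr.
    by apply: le_trans (ler_normD _ _) _; exact: lerD.
  have d3 : 0 < dl *+ 3 by rewrite pmulrn_rgt0.
  have [k Kk fk] := K_small Ct1 d3 small.
  have [_ _ _ _ KM] := idK.
  exists (cmul k (vt t)); first by have [] := KM (vt t) k Kk.
  have -> : el (mult m a t) t = cmul (el (mult m a t) 1%g) (vt t).
    have Cv := chiU_C0 t; rewrite (elM1 crossed) //.
    apply: (@el_eq R G P E iota t) => //.
      by case/C0E: Ct => cf _; exact: C0_mul.
    by move=> w Ow wt; rewrite chi1 // mulr1.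
  rewrite -cmulBl; apply: le_trans (cnormM _ _) _; rewrite -[leRHS]mulr1.
  apply: ler_pM => //; last exact: vt_le1.
  by rewrite -mulrnDr in fk.
have mY t : t \notin Y -> mult m a t = 0.
  rewrite mem_undup => tX; apply/funext => w; rewrite /mult.
  have [[Ow wt]|nw] := pselect (Om w /\ w t); first by rewrite mX // mul0r.
  by rewrite (C0_off (finite_sums_C0 t fa) nw) mulr0.
have [kk Kkk kkE] : exists2 k, K k &
    `|\sum_(t <- Y) el (mult m a t) t - k| <= (dl *+ 6) *+ size Y.
  have [_ K0 KD _ _] := idK.
  elim: Y {mY n n0 dl dl0 ax} (dl *+ 6) term => [|t Y IHY] D term.
    by exists 0; rewrite // big_nil subrr normr0.
  have [k Kk kE] := IHY D term; have [k' Kk' kE'] := term t.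
  exists (k' + k); first exact: KD.
  rewrite big_cons opprD addrACA /= mulrS.
  by apply: le_trans (ler_normD _ _) _; exact: lerD.
exists kk => //; rewrite (iota_seq fma (undup_uniq _) mY).
apply: le_trans kkE _; rewrite -mulrnA -mulr_natr /dl -mulrA.
rewrite -[leRHS]mulr1 ler_pM2l // mulrC ler_pdivrMr // mul1r ler_nat.
by rewrite leq_mul2l leqnSn orbT.
Qed.

Lemma half_min (d d' : C) : 0 < d -> 0 < d' ->
  exists2 dl : C, 0 < dl & dl <= d /\ dl <= d'.
Proof.
move=> d0 d'0; have s0 : 0 < d + d' by exact: addr_gt0.
exists (d * d' / (d + d')); first by rewrite divr_gt0 // mulr_gt0.
split; rewrite ler_pdivrMr //; last rewrite mulrC.
  by rewrite ler_pM2l // lerDr ltW.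
by rewrite ler_pM2l // lerDl ltW.
Qed.

Lemma good_ext m m' : m = m' -> good m -> good m'. Proof. by move=> ->. Qed.

Lemma goodD m m' : adm m -> adm m' -> good m -> good m' ->
  good (fun t w => m t w + m' t w).
Proof.
move=> am am' gm gm' x Lx eps eps0; have e2 : 0 < eps / 2 by rewrite divr_gt0.
have [d d0 md] := gm x Lx _ e2; have [d' d'0 md'] := gm' x Lx _ e2.
have [dl dl0 [dld dld']] := half_min d0 d'0; exists dl => // a fa ax.
have [k Kk ka] := md a fa (le_trans ax dld).
have [k' Kk' ka'] := md' a fa (le_trans ax dld').
have [_ _ KD _ _] := idK; exists (k + k'); first exact: KD.
have -> : mult (fun t w => m t w + m' t w) a = mult m a + mult m' a.
  by apply/funext => t; apply/funext => w; rewrite /mult mulrDl.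
rewrite (iotaD crossed); [|exact: finite_sums_mult..].
rewrite opprD addrACA [leRHS]splitr.
by apply: le_trans (ler_normD _ _) _; exact: lerD.
Qed.

Lemma goodZ (k : C) m : adm m -> good m -> good (fun t w => k * m t w).
Proof.
move=> am gm x Lx eps eps0.
have N0 : 0 < `|k| + 1 by apply: ltr_wpDl => //; exact: ltr01.
have e2 : 0 < eps / (`|k| + 1) by rewrite divr_gt0.
have [d d0 md] := gm x Lx _ e2; exists d => // a fa /(md a fa)[y Ky ya].
have [_ _ _ KZ _] := idK; exists (k *: y); first exact: KZ.
have -> : mult (fun t w => k * m t w) a = k *: mult m a.
  by apply/funext => t; apply/funext => w; rewrite /mult -mulrA.
rewrite (iotaZ crossed); last exact: finite_sums_mult.
rewrite -scalerBr normrZ; apply: (@le_trans _ _ ((`|k| + 1) * (eps / (`|k| + 1)))).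
  by apply: ler_pM => //; rewrite lerDl ler01.
by rewrite mulrCA divff ?mulr1 // gt_eqF.
Qed.

Lemma admissibleZ (k : C) m : adm m -> adm (fun t w => k * m t w).
Proof.
move=> am t f Cf.
have := C0_mul (am t f Cf) (@cyl_continuous_cst R G P k); congr (C0 P t _).
by apply/funext => w; rewrite mulrA.
Qed.

Lemma admissibleD m m' : adm m -> adm m' -> adm (fun t w => m t w + m' t w).
Proof.
move=> am am' t f Cf; have := C0D (am t f Cf) (am' t f Cf); congr (C0 P t _).
by apply/funext => w; rewrite -mulrDl.
Qed.

Lemma admissible_sum n (m : 'I_n -> G -> fct) : (forall i, adm (m i)) ->
  adm (fun t w => \sum_(i < n) m i t w).
Proof.
elim: n m => [|n IHn] m am t f Cf.
  rewrite (_ : (fun w => _) = 0); first exact: C00.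
  by apply/funext => w; rewrite big_ord0 mul0r.
have := admissibleD (IHn _ (fun i => am (widen_ord (leqnSn n) i))) (am ord_max) Cf.
by congr (C0 P t _); apply/funext => w; rewrite big_ord_recr.
Qed.

Lemma good_sum n (m : 'I_n -> G -> fct) : (forall i, adm (m i)) ->
  (forall i, good (m i)) -> good (fun t w => \sum_(i < n) m i t w).
Proof.
elim: n m => [|n IHn] m am gm.
  apply: (@good_finite _ [::]) => [|t w _ _ _|t w _ _]; first exact: admissible_sum.
  - by rewrite big_ord0.
  - by rewrite big_ord0 normr0 ler01.
have ams := admissible_sum (fun i => am (widen_ord (leqnSn n) i)).
have := goodD ams (am ord_max) (IHn _ (fun i => am _) (fun i => gm _)) (gm ord_max).
apply: good_ext; apply/funext => t; apply/funext => w.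
by rewrite big_ord_recr.
Qed.

(** Contractive multipliers are uniformly continuous, so goodness passes to limits taken on each
    finite sum separately. *)
Lemma good_approx m : contr m ->
  (forall a (eps : C), fs a -> 0 < eps -> exists m', [/\ contr m', good m' &
     `|iota (mult m a) - iota (mult m' a)| <= eps]) -> good m.
Proof.
move=> [am cm] app x Lx eps eps0.
pose e4 := eps / 4; have e40 : 0 < e4 by rewrite divr_gt0.
pose e8 := e4 / 2; have e80 : 0 < e8 by rewrite divr_gt0.
have [a0 fa0 /ltW ax0] := iota_dense crossed x e80.
have [m' [[am' cm'] gm' mm']] := app a0 _ fa0 e40.
have [d d0 md] := gm' x Lx _ e40.
have [dl dl0 [dld dle]] := half_min d0 e80.
exists dl => // a fa ax; have [k Kk ka] := md a fa (le_trans ax dld).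
exists k => //.
have aa0 : `|iota (a - a0)| <= e4.
  rewrite (iotaB crossed) // -[X in `|X|](subrKA x) /e4 [leRHS]splitr.
  apply: le_trans (ler_normD _ _) _; rewrite [`|x - _|]distrC.
  by apply: lerD => //; exact: le_trans ax dle.
have multB n : adm n -> iota (mult n (a - a0)) = iota (mult n a) - iota (mult n a0).
  move=> an; rewrite -(iotaB crossed); [|exact: finite_sums_mult..].
  congr iota; apply/funext => t; apply/funext => w.
  by rewrite /mult -[RHS]/(n t w * a t w - n t w * a0 t w) -mulrBr.
have faa := finite_sumsB fa fa0.
have h1 : `|iota (mult m a) - iota (mult m a0)| <= e4.
  by rewrite -multB //; exact: le_trans (cm _ faa) aa0.
have h2 : `|iota (mult m' a0) - iota (mult m' a)| <= e4.
  by rewrite distrC -multB //; exact: le_trans (cm' _ faa) aa0.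
rewrite -[X in `|X|](subrKA (iota (mult m' a))).
rewrite -[X in `|X + _|](subrKA (iota (mult m' a0))).
rewrite -[X in `|X + _ + _|](subrKA (iota (mult m a0))).
have -> : eps = e4 + e4 + e4 + e4.
  rewrite [RHS](_ : _ = e4 *+ 4); last by rewrite !mulrS mulr0n addr0 !addrA.
  by rewrite -mulr_natr /e4 divfK // pnatr_eq0.
do 3!(apply: le_trans (ler_normD _ _) _; apply: lerD => //).
Qed.

Lemma good1_residual x : good (fun _ _ => 1) -> residual W x -> K x.
Proof.
move=> g1 Lx; have [cK _ _ _ _] := idK; apply: closed_eps => // eps eps0.
have e2 : 0 < eps / 2 by rewrite divr_gt0.
have [d d0 md] := g1 x Lx _ e2; have [dl dl0 [dld dle]] := half_min d0 e2.
have [a fa /ltW ax] := iota_dense crossed x dl0.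
have [k Kk ka] := md a fa (le_trans ax dld).
exists k => //; rewrite -[X in `|X|](subrKA (iota a)) [leRHS]splitr.
apply: le_trans (ler_normD _ _) _; apply: lerD.
  by rewrite distrC; exact: le_trans ax dle.
by rewrite -(_ : mult (fun _ _ => 1) a = a) //; apply/funext => t; apply/funext => w; rewrite /mult mul1r.
Qed.

End Good.

(** * The approximation property for right-angled Artin groups *)

Section RaagGood.
Variables (R : realType) (S : choiceType) (e : rel S).
Hypotheses (e_sym : symmetric e) (e_irr : irreflexive e).
Local Notation G := (raag e).
Local Notation P := (@raag_pos S e).
Local Notation Om := (nica_spectrum P).
Local Notation subsets := {ptws G -> bool}.
Variables (E : cstarAlgType R) (iota : (G -> subsets -> R[i]^o) -> E).
Hypothesis crossed : is_crossed_product P iota.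
Local Notation fct := (subsets -> R[i]^o).
Local Notation C := R[i].
Local Notation el := (el iota).
Variables (W : set subsets) (K : set E).
Hypotheses (W_Om : W `<=` Om) (idK : closed_ideal K).
Hypothesis K_small : forall (f : fct) (eps : C), C0 P 1%g f -> 0 < eps ->
  (forall w, W w -> `|f w| <= eps) -> exists2 k, K k & `|el f 1%g - k| <= eps + eps.
Local Notation gd := (good P iota W K).

Let P1 : P 1%g := @raag_pos1 S e.
Let PM x y : P x -> P y -> P (x * y)%g := @raag_posM S e x y.
Let Panti : forall x, P x -> P x^-1%g -> x = 1%g := @raag_pos_anti S e.

Definition finsupp (d : S -> int) : Prop := exists Q : seq S, forall s, s \notin Q -> d s = 0.

Lemma good_degk0 d : finsupp d -> gd (@degk R S e [::] d).
Proof.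
move=> dfin; apply: (good_approx crossed); first exact: contractive_degk.
move=> a eps fa eps0; have /finite_sumsP[[L aL] aC] := fa.
have [k [k' [kfin k'fin psiE]]] := psi_large R e_sym e_irr L dfin.
have cpsi := contractive_psi e_sym e_irr crossed dfin kfin k'fin.
exists (@psi R S e d k k'); split=> //.
  have [X Xpsi] := psi_finite R e_sym e_irr d kfin k'fin.
  apply: (good_finite P1 PM Panti crossed W_Om idK K_small _ Xpsi); first by case: cpsi.
  move=> t w _ _; rewrite /psi /degk.
  by case: asboolP; case: asboolP; rewrite ?mulr0 ?mul0r ?mulr1 ?normr0 ?normr1 ?ler01.
rewrite (_ : mult _ a = mult (@psi R S e d k k') a) ?subrr ?normr0 ?ltW //.
apply/funext => t; apply/funext => w; rewrite /mult.
have [tL|/aL->] := boolP (t \in L); last by rewrite !mulr0.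
have [[Ow wt]|nw] := pselect (Om w /\ w t); first by rewrite psiE.
by rewrite (C0_off (aC t) nw) !mulr0.
Qed.

(** Induction on the list [F] of unconstrained degrees: the condition at [s] is lifted by a Fejer
    mean, a finite combination of multipliers with fixed degree at [s], and the means tend to 1. *)
Lemma good_degk F d : finsupp d -> gd (@degk R S e F d).
Proof.
elim: F d => [|s F IHF] d dfin; first exact: good_degk0.
have [sF|sF] := boolP (s \in F).
  rewrite (_ : @degk R S e (s :: F) d = @degk R S e F d); first exact: IHF.
  apply/funext => t; apply/funext => w; rewrite /degk.
  congr (if _ then _ else _); apply: asbool_equiv_eq; split=> h u uF.
    by apply: h; rewrite inE negb_or uF andbT; apply: contra uF => /eqP->.
  by apply: h; move: uF; rewrite inE negb_or => /andP[].
have cd := contractive_degk crossed (s :: F) dfin.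
apply: (good_approx crossed) => // a eps fa eps0.
have /finite_sumsP[[L aL] aC] := fa.
(* By [fejer_dist], the Fejer mean of order [M] changes [a] by at most [T / M]. *)
pose T : C := \sum_(t <- undup L) `|ab s t|%N%:R * `|el (a t) t|.
have T0 : 0 <= T by apply: sumr_ge0 => t _; rewrite mulr_ge0.
have [M M0 TM] : exists2 M, (0 < M)%N & T / M%:R <= eps.
  have [n nT] := exp_half_le (divr_gt0 eps0 (ltr_wpDl T0 ltr01)).
  exists (2 ^ n.+1)%N; first by rewrite expn_gt0.
  rewrite natrX -exprVn; have T1 : 0 < T + 1 by exact: ltr_wpDl.
  move: nT; rewrite ler_pdivlMr // mulrC => nT.
  apply: le_trans nT; rewrite ler_wpM2r ?exprn_ge0 ?invr_ge0 ?ler0n //.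
  by rewrite lerDl ler01.
pose dd j u : int := if u == s then j else d u.
pose D := M.*2.+1.
(* The indices run over the degrees from [-M] to [M], outside of which the kernel vanishes. *)
pose j (i : 'I_D) : int := i%:Z - M%:Z.
pose m' : G -> fct := fun t w => @degk R S e (s :: F) d t w * fejer R M (ab s t).
have m'E : m' = fun t w => \sum_(i < D) fejer R M (j i) * @degk R S e F (dd (j i)) t w.
  apply/funext => t; apply/funext => w; rewrite /m'.
  have [Mab|abM'] := leqP M `|ab s t|.
    rewrite (fejer_eq0 _ Mab) mulr0 big1 // => i _.
    rewrite /degk; case: asboolP => [h|_]; last by rewrite mulr0.
    have := h s sF; rewrite /dd eqxx => abj.
    by rewrite -abj (fejer_eq0 _ Mab) mul0r.
  have iD : (absz (ab s t + M%:Z)%R < D)%N by move: (ab s t) abM' => z; rewrite /D; lia.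
  rewrite (bigD1 (Ordinal iD)) //= big1 ?addr0 => [|i /eqP ni]; last first.
    rewrite /degk asboolF ?mulr0 // => /(_ s sF); rewrite /dd eqxx => abj.
    apply: ni; apply: val_inj => /=; move: abj; rewrite /j; lia.
  have -> : j (Ordinal iD) = ab s t by rewrite /j /=; lia.
  rewrite mulrC; congr (_ * _); rewrite /degk.
  congr (if _ then _ else _); apply: asbool_equiv_eq; split=> h u uF.
    rewrite /dd; case: eqP => [->//|/eqP us].
    by apply: h; rewrite inE negb_or us.
  move: uF; rewrite inE negb_or => /andP[us uF].
  by have := h u uF; rewrite /dd (negPf us).
have dfin' z : finsupp (dd z).
  have [Q dQ] := dfin; exists (s :: Q) => u; rewrite inE negb_or => /andP[us /dQ].
  by rewrite /dd (negPf us).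
have cj i : contractive P iota (@degk R S e F (dd (j i))).
  exact: (contractive_degk crossed F (dfin' (j i))).
exists m'; split.
- apply: (contractive_mul cd); apply: (contractive_fejer crossed) => //; exact: abM.
- rewrite m'E; apply: (good_sum P1 PM Panti crossed W_Om idK K_small) => i.
    by apply: admissibleZ; case: (cj i).
  by apply: (goodZ crossed idK); [case: (cj i)|exact: IHF].
have am' : admissible P m'.
  have : contractive P iota m'.
    by apply: (contractive_mul cd); apply: (contractive_fejer crossed) => //; exact: abM.
  by case.
have am : admissible P (@degk R S e (s :: F) d) by case: cd.
have aL' m t : t \notin undup L -> mult m a t = 0.
  by rewrite mem_undup => /aL at0; apply/funext => w; rewrite /mult at0 mulr0.
rewrite !(iota_seq crossed _ (undup_uniq L)); try exact: aL'; try exact: finite_sums_mult.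
apply: le_trans TM; rewrite -sumrB mulr_suml; apply: le_trans (ler_norm_sum _ _ _) _.
apply: ler_sum => t _.
pose c : C := if `[< forall u, u \notin s :: F -> ab u t = d u >] then 1 else 0.
have c1 : `|c| <= 1 by rewrite /c; case: asboolP; rewrite ?normr0 ?normr1 ?ler01.
have fat := finite_sums_single (aC t).
have ek (z : C) (g : fct) : (forall w, g w = z * a t w) -> el g t = z *: el (a t) t.
  move=> gE; rewrite /el -(iotaZ crossed) //; congr iota.
  apply/funext => r; apply/funext => w.
  rewrite -[RHS]/(z * single t (a t) r w) /single; case: eqP => // _.
  by rewrite mulr0.
rewrite (ek c (mult (@degk R S e (s :: F) d) a t)) //.
rewrite (ek (c * fejer R M (ab s t)) (mult m' a t)) // -scalerBl normrZ.
rewrite -[X in X - _]mulr1 -mulrBr normrM [leRHS]mulrAC ler_wpM2r // -[leRHS]mul1r.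
by apply: ler_pM => //; rewrite distrC; exact: fejer_dist.
Qed.

(** The elements in the support of a finite sum have nonzero degree at finitely many generators
    only; leaving these degrees free, [degk] acts on the sum as the identity. *)
Lemma residual_sub : residual P iota W `<=` K.
Proof.
move=> x; apply: (good1_residual crossed idK).
apply: (good_approx crossed); first exact: contractive1.
move=> a eps fa eps0; have /finite_sumsP[[L aL] _] := fa.
have [Q LQ] := ab_finite_seq L.
have fin0 : finsupp (fun=> 0) by exists [::].
exists (@degk R S e Q (fun=> 0)); split; [exact: contractive_degk|exact: good_degk|].
rewrite (_ : mult _ a = mult (@degk R S e Q (fun=> 0)) a) ?subrr ?normr0 ?ltW //.
apply/funext => t; apply/funext => w; rewrite /mult.
have [tL|/aL->] := boolP (t \in L); last by rewrite !mulr0.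
by rewrite /degk asboolT // => s sQ; exact: LQ tL sQ.
Qed.

End RaagGood.

Lemma inclusion_exclusion (A : comPzRingType) (a b : A) :
  a + b - a * b = 1 - (1 - a) * (1 - b).
Proof. by ring. Qed.

(** * Ideals of the crossed product *)

Section Ideals.
Variables (R : realType) (S : countType) (e : rel S).
Hypotheses (e_sym : symmetric e) (e_irr : irreflexive e).
Variables (E : cstarAlgType R) (iota : (raag e -> {ptws raag e -> bool} -> R[i]^o) -> E).
Hypothesis crossed : is_crossed_product (@raag_pos S e) iota.
Local Notation G := (raag e).
Local Notation gen := (raag_gen e).
Local Notation P := (@raag_pos S e).
Local Notation Om := (nica_spectrum P).
Local Notation subsets := {ptws G -> bool}.
Local Notation fct := (subsets -> R[i]^o).
Local Notation C := R[i].
Local Notation fs := (@finite_sums R G P).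
Local Notation el := (el iota).
Local Notation chi := (@chi R G).

Let Panti : forall x, P x -> P x^-1%g -> x = 1%g := @raag_pos_anti S e.

Definition avoid_set (B : set (set S)) : set subsets :=
  [set w | Om w /\ avoids (vertices B) w].

Lemma finite_vertices B : factor_sets e B -> finite_set (vertices B).
Proof. by move=> [fB BF]; apply: bigcup_finite => // lam /BF[]. Qed.

Lemma defect_funE B : factor_sets e B -> @defect_fun R S e B = chi (avoid_set B).
Proof.
move=> FB; have fV := finite_vertices FB.
apply/funext => w; rewrite /defect_fun !indicE.
have [Ow|nOw] := pselect (Om w); last first.
  by rewrite memNset // mul0r /chi asboolF // => -[].
rewrite mem_set // mul1r.
have termE s : 1 - @one_gen R S e s w = if w (gen s) then 0 else 1.
  rewrite /one_gen indicE; case: ifP => wg.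
    by rewrite mem_set ?subrr.
  by rewrite memNset ?subr0 // => -[]; rewrite wg.
under eq_fsbigr => s _ do rewrite termE.
rewrite /chi; case: asboolP => [[_ av]|nav].
  by rewrite fsbig1 // => s Vs; case: ifP => // ws; case: (av s Vs).
have [s Vs ws] : exists2 s, vertices B s & w (gen s).
  by apply: contrapT => nos; apply: nav; split=> // s Vs ws; apply: nos; exists s.
by rewrite (fsbigD1 s) ?ws //; exact: mul0r.
Qed.

Lemma avoid_set_C0 B : factor_sets e B -> C0 P 1%g (chi (avoid_set B)).
Proof.
move=> FB; have /finite_seqP[V VE] := finite_vertices FB.
apply: C0_chi => [|w [Ow _]]; last by split=> //; exact: spectrum1 Ow.
exists [seq gen s | s <- V] => w v Ow Ov a.
have aE s : vertices B s -> v (gen s) = w (gen s).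
  by rewrite VE /= => sV; apply: a; exact: map_f.
by split=> -[_ av]; split=> // s Vs; [rewrite -aE|rewrite aE] => //; exact: av.
Qed.

Lemma defectE B : factor_sets e B -> defect iota B = el (chi (avoid_set B)) 1%g.
Proof. by move=> FB; rewrite /defect defect_funE. Qed.

Definition points (I : set (set (set S))) : set subsets :=
  [set w | Om w /\ forall B, I B -> ~ orbit_avoids B w].

Lemma closed_ideal_genP (X : set E) : closed_ideal (closed_ideal_gen X).
Proof.
split.
- by apply: closed_bigI => I [[]].
- by move=> I [[]].
- by move=> x y Ix Iy I II; have [[_ _ ID _ _] _] := II; apply: ID; [exact: Ix|exact: Iy].
- by move=> k x Ix I II; have [[_ _ _ IZ _] _] := II; apply: IZ; exact: Ix.
- move=> a x Ix; split=> I II; have [[_ _ _ _ IM] _] := II.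
    by have [] := IM a x (Ix I II).
  by have [] := IM a x (Ix I II).
Qed.

Lemma closed_ideal_gen_sub (X : set E) : X `<=` closed_ideal_gen X.
Proof. by move=> x Xx I [_ XI]; exact: XI. Qed.

Lemma closed_ideal_gen_min (X J : set E) : closed_ideal J -> X `<=` J ->
  closed_ideal_gen X `<=` J.
Proof. by move=> iJ XJ x; apply; split. Qed.

Lemma defect_sub B D : factor_sets e B -> factor_sets e D -> B `<=` D ->
  defect iota D = cmul (defect iota D) (defect iota B).
Proof.
move=> FB FD BD; rewrite !defectE // (elM1 crossed); [|exact: avoid_set_C0..].
apply: (@el_eq R G P E iota 1%g) => //; first exact: avoid_set_C0.
  by apply: C0_mul; [exact: avoid_set_C0|case/C0E: (avoid_set_C0 FD)].
move=> w Ow _; rewrite /chi; case: asboolP => [[_ avD]|_]; last by rewrite mul0r.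
rewrite asboolT ?mulr1 //; split=> // s [lam Blam lams]; apply: avD.
by exists lam => //; exact: BD.
Qed.

(** Conjugation by the partial isometry [vt] at [r] translates the support of the defect by [r]. *)
Lemma translate_defect (J : set E) B r : closed_ideal J -> factor_sets e B -> P r ->
  J (defect iota B) ->
  C0 P 1%g (chi [set w | [/\ Om w, w r & avoids (vertices B) (gshift r w)]]) /\
  J (el (chi [set w | [/\ Om w, w r & avoids (vertices B) (gshift r w)]]) 1%g).
Proof.
move=> [_ _ _ _ JM] FB Pr; rewrite defectE // => JB.
have CB := avoid_set_C0 FB.
have C1 := C0_shiftM (C0_shiftM (chiU_C0 R P r) CB) (chiU_C0 R P r^-1%g).
set f := (X in C0 P _ X) in C1.
have fE : f = chi [set w | [/\ Om w, w r & avoids (vertices B) (gshift r w)]].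
  apply/funext => w; rewrite /f.
  have [[Ow wr av]|nw] := pselect [/\ Om w, w r & avoids (vertices B) (gshift r w)].
    have Ow' := spectrum_shift Ow wr.
    rewrite [RHS]chi1 // !chi1 ?mulr1 // mulg1.
    by split=> //; rewrite /gshift mulgV; exact: spectrum1 Ow.
  rewrite [RHS]chi0 //; have [[Ow wr]|nwr] := pselect (Om w /\ w r); last first.
    by rewrite [chi [set w | Om w /\ w r] w]chi0 // !mul0r.
  rewrite [chi (avoid_set B) _]chi0 ?mulr0 ?mul0r // => -[_ av].
  by apply: nw.
rewrite fE mulg1 mulgV in C1; split=> //.
have -> : el (chi [set w | [/\ Om w, w r & avoids (vertices B) (gshift r w)]]) 1%g =
    cmul (cmul (vt P iota r) (el (chi (avoid_set B)) 1%g)) (vt P iota r^-1%g).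
  rewrite /vt (elM crossed) ?(elM crossed) //; try exact: chiU_C0.
    by rewrite -fE (_ : (r * 1 * r^-1)%g = 1%g) // mulg1 mulgV.
  by apply: C0_shiftM => //; exact: chiU_C0.
have [Jl _] := JM (vt P iota r) _ JB.
by have [] := JM (vt P iota r^-1%g) _ Jl.
Qed.

Lemma phi_closed_ideal I : closed_ideal (phi iota I).
Proof. exact: closed_ideal_genP. Qed.

(** Near a point of [points I] the function is at most [2 eps]; any other point has a neighbourhood
    whose indicator is a translated defect. Compactness glues finitely many indicators by $h+h'-hh'$
    into one [h] in the ideal, and $f-hf$ is small. *)
Lemma phi_small I (f : fct) (eps : C) : I `<=` factor_sets e -> C0 P 1%g f -> 0 < eps ->
  (forall w, points I w -> `|f w| <= eps) ->
  exists2 k, phi iota I k & `|el f 1%g - k| <= eps + eps.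
Proof.
move=> IF Cf eps0 small; have idK := phi_closed_ideal I.
have [cK K0 KD KZ KM] := idK; have /C0E[cf f0] := Cf.
pose Q (A : set subsets) := exists h : fct,
  [/\ C0 P 1%g h, phi iota I (el h 1%g), (forall w, 0 <= h w <= 1) &
    forall w, Om w -> A w -> h w = 1 \/ `|f w| <= eps + eps].
have Q0 : Q set0.
  exists 0; split=> //; [exact: C00| |by move=> w; rewrite lexx ler01].
  rewrite (_ : el 0 1%g = 0) // -(iota0 crossed); congr iota.
  by apply/funext => t; rewrite /single; case: ifP.
have [h [Ch Kh h01 hE]] : Q Om.
  apply: (spectrum_compact Panti Q0).
  - move=> A B AB [h [Ch Kh h01 hE]]; exists h; split=> // w Ow /AB; exact: hE.
  - move=> A B [h [Ch Kh h01 hE]] [h' [Ch' Kh' h01' hE']].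
    have /C0E[ch _] := Ch.
    pose g : fct := fun w => h w + h' w - h w * h' w.
    have Chh : C0 P 1%g (fun w => h w * h' w) by exact: C0_mul.
    have fh := finite_sums_single Ch; have fh' := finite_sums_single Ch'.
    have fhh := finite_sums_single Chh.
    have gE : single 1%g g = single 1%g h + single 1%g h' - single 1%g (fun w => h w * h' w).
      apply/funext => t; apply/funext => w.
      rewrite -[RHS]/(single 1%g h t w + single 1%g h' t w - single 1%g (fun w => h w * h' w) t w).
      by rewrite /single; case: eqP => // _; rewrite addr0 subr0.
    have fg : fs (single 1%g g).
      by rewrite gE; apply: finite_sumsB => //; exact: finite_sumsD.
    exists g; split.
    + by have := finite_sums_C0 1%g fg; rewrite /single eqxx.
    + rewrite /el gE (iotaB crossed) ?(iotaD crossed) //; last exact: finite_sumsD.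
      apply: (closed_idealB idK); first exact: KD.
      rewrite -/(el (fun w => h w * h' w) 1%g) -(elM1 crossed) //.
      by have [] := KM (el h 1%g) _ Kh'.
    + move=> w; have /andP[h0 h1] := h01 w; have /andP[h0' h1'] := h01' w.
      have -> : g w = 1 - (1 - h w) * (1 - h' w).
        by rewrite /g; apply: inclusion_exclusion.
      rewrite subr_ge0 gerBl; apply/andP; split; last by rewrite mulr_ge0 ?subr_ge0.
      by rewrite mulr_ile1 ?subr_ge0 ?gerBl.
    + move=> w Ow [/(hE _ Ow)|/(hE' _ Ow)] [hw|]; [left|by right|left|by right].
        by rewrite /g hw mul1r addrK.
      by rewrite /g hw mulr1 addrAC subrr add0r.
  move=> w Ow; have [Pw|nPw] := pselect (points I w).
    have [X Xf] := cf w Ow eps eps0; exists X; exists 0.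
    have [h [Ch Kh h01 _]] := Q0; split=> //; first exact: C00.
    - rewrite (_ : el 0 1%g = 0) // -(iota0 crossed); congr iota.
      by apply/funext => t; rewrite /single; case: ifP.
    - by move=> v; rewrite lexx ler01.
    - move=> v Ov [_ a]; right; rewrite -[f v](subrK (f w)).
      by apply: le_trans (ler_normD _ _) _; apply: lerD; [exact/ltW/Xf|exact: small].
  have [B [IB [r [Pr wr av]]]] : exists B, I B /\ orbit_avoids B w.
    by apply: contrapT => nB; apply: nPw; split=> // B IB Bw; apply: nB; exists B.
  have FB := IF _ IB.
  have KB : phi iota I (defect iota B) by apply: closed_ideal_gen_sub; exists B.
  have [Cr Kr] := translate_defect idK FB Pr KB.
  have /finite_seqP[V VE] := finite_vertices FB.
  exists (r :: [seq (r * gen s)%g | s <- V]).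
  exists (chi [set w | [/\ Om w, w r & avoids (vertices B) (gshift r w)]]); split=> //.
    by move=> v; rewrite /chi; case: asboolP; rewrite ?lexx ?ler01.
  move=> v Ov [_ a]; left; rewrite chi1 //; split=> //; first by rewrite (a _ (mem_head _ _)).
  move=> s Vs; have sV : s \in V by move: Vs; rewrite VE.
  rewrite /gshift a; first exact: av.
  by rewrite inE; apply/orP; right; apply/mapP; exists s.
have /C0E[ch _] := Ch.
have Chf : C0 P 1%g (fun w => h w * f w) by exact: C0_mul.
exists (el (fun w => h w * f w) 1%g).
  by rewrite -(elM1 crossed) //; have [] := KM (el f 1%g) _ Kh.
have fC := finite_sums_single Cf; have fhf := finite_sums_single Chf.
rewrite /el -(iotaB crossed) //.
pose g : fct := fun w => f w - h w * f w.
have gE : single 1%g f - single 1%g (fun w => h w * f w) = single 1%g g.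
  apply/funext => t; apply/funext => w.
  rewrite -[LHS]/(single 1%g f t w - single 1%g (fun w => h w * f w) t w).
  by rewrite /single; case: eqP => // _; rewrite subrr.
have Cg : C0 P 1%g g.
  have := finite_sums_C0 1%g (finite_sumsB fC fhf).
  by rewrite gE /single eqxx.
have /C0E[cg g0] := Cg; rewrite gE; apply: (el_le crossed cg) => [w /g0[]//||w Ow].
  by rewrite addr_ge0 ?ltW.
rewrite /g -[X in X - _]mul1r -mulrBl normrM.
have [->|fw] := hE w Ow Ow; first by rewrite subrr normr0 mul0r addr_ge0 ?ltW.
rewrite -[leRHS]mul1r; apply: ler_pM => //.
have /andP[h0 h1] := h01 w.
by rewrite ger0_norm ?subr_ge0 // gerBl.
Qed.

Lemma residual_phi I : I `<=` factor_sets e -> residual P iota (points I) `<=` phi iota I.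
Proof.
move=> IF; apply: (residual_sub e_sym e_irr crossed) => [w []//| |f eps].
  exact: phi_closed_ideal.
exact: phi_small.
Qed.

End Ideals.

Arguments avoid_set {S} e B _.

(** * Elements whose diagonal coefficient vanishes at a point *)

Section Residual.
Variables (R : realType) (G : groupType) (P : set G).
Variables (E : cstarAlgType R) (iota : (G -> {ptws G -> bool} -> R[i]^o) -> E).
Hypothesis crossed : is_crossed_product P iota.
Local Notation C := R[i].
Local Notation van := (vanish P iota).

Lemma vanishD w x y : van w x -> van w y -> van w (x + y).
Proof.
move=> vx vy eps eps0; have e2 : 0 < eps / 2 by rewrite divr_gt0.
have [a fa [ax aw]] := vx _ e2; have [b fb [bx bw]] := vy _ e2.
exists (a + b); first exact: finite_sumsD.
split; rewrite [leRHS]splitr.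
  rewrite (iotaD crossed) // opprD addrACA.
  by apply: le_trans (ler_normD _ _) _; exact: lerD.
rewrite -[(a + b) 1%g w]/(a 1%g w + b 1%g w).
by apply: le_trans (ler_normD _ _) _; exact: lerD.
Qed.

Lemma vanishZ w (k : C) x : van w x -> van w (k *: x).
Proof.
move=> vx eps eps0.
have N0 : 0 < `|k| + 1 by apply: ltr_wpDl => //; exact: ltr01.
have e2 : 0 < eps / (`|k| + 1) by rewrite divr_gt0.
have le_k r : r <= eps / (`|k| + 1) -> 0 <= r -> `|k| * r <= eps.
  move=> re r0; apply: (@le_trans _ _ ((`|k| + 1) * (eps / (`|k| + 1)))).
    by apply: ler_pM => //; rewrite lerDl ler01.
  by rewrite mulrCA divff ?mulr1 // gt_eqF.
have [a fa [ax aw]] := vx _ e2; exists (k *: a); first exact: finite_sumsZ.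
split; first by rewrite (iotaZ crossed) // -scalerBr normrZ le_k.
by rewrite -[(k *: a) 1%g w]/(k * a 1%g w) normrM le_k.
Qed.

Lemma vanish_closed w x :
  (forall eps : C, 0 < eps -> exists2 y, van w y & `|x - y| <= eps) -> van w x.
Proof.
move=> near eps eps0; have e2 : 0 < eps / 2 by rewrite divr_gt0.
have [y vy xy] := near _ e2; have [a fa [ay aw]] := vy _ e2.
have e2e : eps / 2 <= eps by rewrite ler_pdivrMr // mulr_natr mulr2n lerDl ltW.
exists a => //; split; last exact: le_trans aw e2e.
rewrite -[X in `|X|](subrKA y) [leRHS]splitr; apply: le_trans (ler_normD _ _) _.
by apply: lerD => //; rewrite distrC.
Qed.

Lemma vanish0 w : van w 0.
Proof.
move=> eps eps0; exists 0; first exact: finite_sums0.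
by rewrite (iota0 crossed) subrr !normr0 ltW.
Qed.

Lemma vanish_set_closed w : closed [set x | van w x].
Proof.
move=> x clx; apply: vanish_closed => eps eps0.
have [y [vy]] := clx _ (nbhsx_ballx x _ eps0).
by rewrite -ball_normE /= => /ltW xy; exists y.
Qed.

Lemma residual_ideal W : closed_ideal (residual P iota W).
Proof.
split.
- move=> x clx w Ww b c; pose f := fun x => cmul (cmul b x) c.
  have : closed (f @^-1` [set x | van w x]).
    apply: closed_comp; last exact: vanish_set_closed.
    move=> y _; apply: (@continuous_comp _ _ _ (cmul b) (fun x => cmul x c)); first exact: cmul_continuousl.
    exact: cmul_continuousr.
  by apply; apply: closure_subset clx => y Ly; exact: Ly.
- by move=> w _ b c; rewrite cmulx0 cmul0x; exact: vanish0.
- by move=> x y Lx Ly w Ww b c; rewrite cmulDr cmulDl; apply: vanishD; [exact: Lx|exact: Ly].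
- by move=> k x Lx w Ww b c; rewrite cmulZr cmulZl; apply: vanishZ; exact: Lx.
move=> a x Lx; split=> w Ww b c; first by rewrite cmulA; exact: Lx.
by rewrite cmulA -cmulA; exact: Lx.
Qed.

End Residual.

(** * Classification of the closed ideals *)

Section Classification.
Variables (R : realType) (S : countType) (e : rel S).
Hypotheses (e_sym : symmetric e) (e_irr : irreflexive e).
Variables (E : cstarAlgType R) (iota : (raag e -> {ptws raag e -> bool} -> R[i]^o) -> E).
Hypothesis crossed : is_crossed_product (@raag_pos S e) iota.
Hypothesis no_isol : forall s, exists s', opp_graph e s s'.
Local Notation G := (raag e).
Local Notation P := (@raag_pos S e).
Local Notation Om := (nica_spectrum P).
Local Notation subsets := {ptws G -> bool}.
Local Notation fct := (subsets -> R[i]^o).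
Local Notation C := R[i].
Local Notation el := (el iota).
Local Notation chi := (@chi R G).
Local Notation resid I := (residual P iota (@points S e I)).

Let P1 : P 1%g := @raag_pos1 S e.
Let PM x y : P x -> P y -> P (x * y)%g := @raag_posM S e x y.
Let Panti : forall x, P x -> P x^-1%g -> x = 1%g := @raag_pos_anti S e.

(** By linearity and density the outer factors are single terms; a nonzero coefficient at [w] would
    place a translate of [w] among the points avoiding [B]. *)
Lemma defect_residual I B : I B -> factor_sets e B -> resid I (defect iota B).
Proof.
move=> IB FB w [Ow nw] b c; rewrite defectE //.
have CB := avoid_set_C0 R FB.
move: b; apply: (iota_ind crossed).
- apply: (@closed_comp _ _ (fun b => cmul (cmul b _) c)); last exact: vanish_set_closed.
  move=> b _; apply: (@continuous_comp _ _ _ (fun b => cmul b _) (fun x => cmul x c) b);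
    exact: cmul_continuousr.
- by move=> x y vx vy; rewrite !cmulDl; exact: vanishD.
- by rewrite !cmul0x; exact: vanish0.
move=> s f Cf; move: c; apply: (iota_ind crossed).
- apply: (@closed_comp _ _ (fun c => cmul _ c)); last exact: vanish_set_closed.
  by move=> c _; exact: cmul_continuousl.
- by move=> x y vx vy; rewrite !cmulDr; exact: vanishD.
- by rewrite cmulx0; exact: vanish0.
move=> t g Cg; have C1 := C0_shiftM Cf CB.
rewrite (elM crossed Cf CB) (elM crossed C1 Cg) => eps eps0.
have C2 := C0_shiftM C1 Cg.
exists (single (s * 1 * t)%g (fun v => f v * chi (avoid_set e B) (gshift s v) * g (gshift (s * 1) v))).
  exact: finite_sums_single.
split; first by rewrite subrr normr0 ltW.
rewrite /single; case: eqP => _; last by rewrite normr0 ltW.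
have [->|fw] := eqVneq (f w) 0; first by rewrite !mul0r normr0 ltW.
have ws := C0_mem Cf fw.
rewrite chi0 ?mulr0 ?mul0r ?normr0 ?ltW // => -[Os av].
apply: (nw B IB); apply: (orbit_avoids_unshift e_sym FB Ow ws).
by exists 1%g; split=> //; [exact: spectrum1 Os|rewrite gshift1].
Qed.

Lemma elZ t k f : C0 P t f -> k *: el f t = el (fun w => k * f w) t.
Proof.
move=> Cf; rewrite /el -(iotaZ crossed); last exact: finite_sums_single.
congr iota; apply/funext => s; apply/funext => w.
rewrite -[LHS]/(k * single t f s w) /single.
by case: eqP => // _; rewrite mulr0.
Qed.

Lemma elB t f g : C0 P t f -> C0 P t g -> el f t - el g t = el (fun w => f w - g w) t.
Proof.
move=> Cf Cg; rewrite /el -(iotaB crossed); [|exact: finite_sums_single..].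
congr iota; apply/funext => s; apply/funext => w.
rewrite -[LHS]/(single t f s w - single t g s w) /single.
by case: eqP => // _; rewrite subrr.
Qed.

Lemma C0B t (f g : fct) : C0 P t f -> C0 P t g -> C0 P t (fun w => f w - g w).
Proof.
move=> Cf Cg; have := C0D Cf (C0_mul Cg (@cyl_continuous_cst R G P (-1))).
congr (C0 P t _); apply/funext => w.
by rewrite -[LHS]/(f w + -1 * g w) mulN1r.
Qed.

Lemma near_const_norm (V : set subsets) f z (M : C) : C0 P 1%g (chi V) -> C0 P 1%g f ->
  0 <= M -> (forall w, V w -> `|z - f w| <= M) ->
  `|z *: el (chi V) 1%g - el (fun w => chi V w * f w) 1%g| <= M.
Proof.
move=> CV Cf M0 near; have /C0E[cV _] := CV.
have CVf : C0 P 1%g (fun w => chi V w * f w) by exact: C0_mul.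
have CzV : C0 P 1%g (fun w => z * chi V w) by apply: C0_mul => //; exact: cyl_continuous_cst.
have Cd := C0B CzV CVf; have /C0E[cd d0] := Cd.
rewrite elZ // elB //; apply: (el_le crossed cd) => // [w /d0[]//|w Ow].
rewrite mulrC -mulrBr /chi; case: asboolP => [Vw|_]; first by rewrite mul1r near.
by rewrite mul0r normr0.
Qed.

Lemma chi_idem (V : set subsets) : C0 P 1%g (chi V) ->
  cmul (el (chi V) 1%g) (el (chi V) 1%g) = el (chi V) 1%g.
Proof.
move=> CV; rewrite (elM1 crossed) //; congr (el _ 1%g).
by apply/funext => w; rewrite /chi; case: asboolP => _; rewrite ?mulr1 ?mulr0.
Qed.

Lemma near_const_ideal (J : set E) (V : set subsets) (z : C) (y : E) :
  closed_ideal J -> C0 P 1%g (chi V) -> z != 0 -> J y ->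
  `|z *: el (chi V) 1%g - y| <= `|z| / 2 -> J (el (chi V) 1%g).
Proof.
move=> iJ CV z0 Jy near; have [_ _ _ JZ _] := iJ.
apply: (@idempotent_near_ideal _ _ _ _ (z^-1 *: y)) => //; first exact: chi_idem.
  exact: JZ.
have -> : el (chi V) 1%g - z^-1 *: y = z^-1 *: (z *: el (chi V) 1%g - y).
  by rewrite scalerBr scalerA mulVf // scale1r.
rewrite normrZ normfV ler_pdivrMl ?normr_gt0 //.
Qed.

(** Translate [f] as prescribed by [spectrum_core]: on the points avoiding [B] it is then close to
    [f w], so its product with the defect of [B] is near a nonzero multiple of that projection. *)
Lemma ideal_point (J : set E) (f : fct) w : closed_ideal J -> C0 P 1%g f ->
  J (el f 1%g) -> Om w -> f w != 0 ->
  exists B, [/\ factor_sets e B, J (defect iota B) & orbit_avoids B w].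
Proof.
move=> iJ Cf Jf Ow fw0; have /C0E[cf f0] := Cf.
have e2 : 0 < `|f w| / 2 by rewrite divr_gt0 // normr_gt0.
have [X Xf] := cf w Ow _ e2.
have [r [q [B [[Pr Pq wr FB] [avB _ core]]]]] := spectrum_core e_sym e_irr X Ow.
exists B; split=> //; last by exists r.
have Prq : P (r * q)%g := raag_posM Pr Pq.
set t := (r * q)%g in Prq core.
have CB := avoid_set_C0 R FB.
pose A := chi [set v | Om v /\ v t^-1%g].
have CA : C0 P t^-1%g A := chiU_C0 R P t^-1%g.
have C1 := C0_shiftM (C0_shiftM CA Cf) (chiU_C0 R P t).
set g := (X in C0 P _ X) in C1; rewrite mulg1 mulVg in C1.
have gE v : Om v -> g v = f (gshift t^-1 v).
  move=> Ov; have vt := spectrum_inv Ov Prq.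
  have Ov' := spectrum_shift Ov vt.
  rewrite /g [A v]chi1 // mul1r mulg1 chi1 ?mulr1 //; split=> //.
  by rewrite /gshift mulVg; exact: spectrum1 Ov.
have Jg : J (el g 1%g).
  have [_ _ _ _ JM] := iJ.
  have -> : el g 1%g = cmul (cmul (el A t^-1%g) (el f 1%g)) (vt P iota t).
    rewrite /vt (elM crossed) // (elM crossed) //; last exact: chiU_C0.
      by rewrite (_ : (t^-1 * 1 * t)%g = 1%g) // mulg1 mulVg.
    exact: C0_shiftM.
  have [Jl _] := JM (el A t^-1%g) _ Jf.
  by have [] := JM (vt P iota t) _ Jl.
have Jhg : J (el (fun v => chi (avoid_set e B) v * g v) 1%g).
  have [_ _ _ _ JM] := iJ; rewrite -(elM1 crossed) //.
  by have [] := JM (el (chi (avoid_set e B)) 1%g) _ Jg.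
rewrite defectE //; apply: (near_const_ideal iJ CB fw0 Jhg).
apply: (near_const_norm CB C1 (ltW e2)) => v [Ov av]; rewrite gE // distrC; apply/ltW/Xf; last by move=> x; exact: core.
by apply: spectrum_shift => //; exact: spectrum_inv.
Qed.

(** The [t] in [L] are treated one at a time by [spectrum_free]. If the new point omits [t],
    recording [t] suffices; otherwise it differs from its translate at some [g], and recording [g]
    and [t g] separates a whole cylinder from its translate. *)
Lemma free_cylinder (I : set (set (set S))) (L X : seq G) w : I `<=` factor_sets e ->
  points I w -> exists w1 X1,
    [/\ points I w1, forall v, agree X1 w1 v -> agree X w v &
      forall (t : G) v, t \in L -> t <> 1%g -> agree X1 w1 v -> v t ->
        ~ agree X1 w1 (gshift t v)].
Proof.
move=> IF Iw; elim: L => [|t L [w1 [X1 [[Ow1 nw1] X1X free]]]]; first by exists w, X.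
have [t1|t1] := pselect (t = 1%g).
  exists w1, X1; split=> // s v; rewrite inE => /predU1P[->//|]; exact: free.
have [w2 [Ow2 w21 nfix orb]] := spectrum_free e_sym e_irr X1 no_isol Ow1 t1.
have Iw2 : points I w2 by split=> // B IB /(orb _ (IF _ IB)); exact: nw1.
have w12 X2 v : agree (X2 ++ X1) w2 v -> agree X1 w1 v.
  by move=> /agree_catr a x xX; rewrite a // w21.
have [w2t|w2t] := boolP (w2 t); last first.
  exists w2, ([:: t] ++ X1); split=> // [v /w12 /X1X //|s v].
  rewrite inE => /predU1P[-> _ /(_ t (mem_head _ _)) -> w2t'|sL s1 /w12 a vs /w12].
    by rewrite w2t' in w2t.
  exact: free.
have [g ng] : exists g, gshift t w2 g <> w2 g.
  apply: contrapT => ng; apply: nfix; split=> //; apply/funext => g.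
  by apply: contrapT => h; apply: ng; exists g.
exists w2, ([:: g; (t * g)%g] ++ X1); split=> // [v /w12 /X1X //|s v].
rewrite inE => /predU1P[-> _ a _ b|sL s1 /w12 a vs /w12]; last exact: free.
by apply: ng; rewrite /gshift -a ?inE ?eqxx ?orbT // -b ?inE ?eqxx.
Qed.

Definition ideal_sets (J : set E) : set (set (set S)) :=
  [set B | factor_sets e B /\ J (defect iota B)].

Lemma ideal_residual (J : set E) : closed_ideal J -> J `<=` resid (ideal_sets J).
Proof.
move=> iJ y Jy w Iw b c eps eps0; have [_ _ _ _ JM] := iJ.
have Jz : J (cmul (cmul b y) c).
  by have [_] := JM c _ (JM b y Jy).1.
set z := cmul _ c in Jz *.
have e4 : 0 < eps / 4 by rewrite divr_gt0.
have [a fa /ltW az] := iota_dense crossed z e4.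
have [small|big] := boolP (`|a 1%g w| <= eps).
  exists a => //; split=> //; apply: le_trans az _.
  by rewrite ler_pdivrMr // mulr_natr mulrS lerDl mulrn_wge0 // ltW.
exfalso.
have Cf := finite_sums_C0 1%g fa; set f := a 1%g in Cf big.
have Ow : Om w by case: Iw.
have /C0E[cf _] := Cf; have [X Xf] := cf w Ow _ e4.
have /finite_sumsP[[L aL] aC] := fa.
have IF : ideal_sets J `<=` factor_sets e by move=> B [].
have [w1 [X1 [[Ow1 nw1] X1X free]]] := free_cylinder L X IF Iw.
pose V : set subsets := [set v | Om v /\ agree X1 w1 v].
have CV : C0 P 1%g (chi V).
  apply: C0_chi => [|v [Ov _]]; last by split=> //; exact: spectrum1 Ov.
  by exists X1 => v u Ov Ou vu; split=> -[_ h]; split=> // x xX; rewrite -h // vu.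
have /C0E[cV V0] := CV; have fV := finite_sums_single CV.
pose H := el (chi V) 1%g.
have nH : `|H| <= 1.
  apply: (el_le crossed cV) => [v /V0[]//||v _]; first exact: ler01.
  by rewrite /chi; case: asboolP; rewrite ?normr1 ?normr0 ?ler01.
(* The cylinder is moved off itself by every other [t] in the support of [a], so only the
   coefficient of $\delta_1$ survives the compression. *)
have HaH : cmul (cmul H (iota a)) H = el (fun v => chi V v * f v) 1%g.
  rewrite /H /el -(iotaM crossed) // -(iotaM crossed) //; last exact: finite_sumsM.
  congr iota; apply/funext => r; apply/funext => v.
  rewrite sums_mulE; last exact: finite_sumsM.
  rewrite (@fsbig_seqT _ _ [:: r]) // => [|s]; last first.
    rewrite inE eq_sym /single -[(_ * _)%g == _](can_eq (mulKg s)) mulVKg mulg1 => /negPf->.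
    exact: mulr0.
  rewrite big_seq1 mulVg sums_mulE // (@fsbig_seqT _ _ [:: 1%g]) // => [|s]; last first.
    by rewrite inE /single => /negPf ->; rewrite mul0r.
  rewrite big_seq1 /single eqxx invg1 mul1g gshift1.
  case: eqP => [->|r1].
    by rewrite gshift1 /f /chi; case: asboolP; rewrite ?mulr1 // !mul0r.
  have [->|ar] := eqVneq (a r v) 0; first by rewrite mulr0 mul0r.
  have vr := C0_mem (aC r) ar; have Ov := C0_Om (aC r) ar.
  rewrite /chi; case: asboolP => [[_ av]|_]; last by rewrite !mul0r.
  case: asboolP => [[_ arv]|_]; last by rewrite mulr0.
  exfalso; apply: (free r v _ r1 av vr arv).
  by apply: contraNT ar => /aL ->.
(* The element $HzH$ of [J] is within [eps / 2] of $f(w)H$, and [eps] is less than $|f(w)|$. *)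
have JH : J H.
  apply: (@near_const_ideal J V (f w) (cmul (cmul H z) H)) => //.
  - by apply: contraNneq big => ->; rewrite normr0 ltW.
  - by have [_] := JM H _ (JM H z Jz).1.
  rewrite -[X in `|X|](subrKA (el (fun v => chi V v * f v) 1%g)).
  apply: le_trans (ler_normD _ _) _.
  apply: (@le_trans _ _ (eps / 4 + eps / 4)); last first.
    have -> : eps / 4 + eps / 4 = eps / 2 by field.
    rewrite ler_pM2r ?invr_gt0 //; have := big; rewrite -real_ltNge => [/ltW//||].
      exact: gtr0_real.
    exact: normr_real.
  apply: lerD.
    apply: near_const_norm => //; first exact: ltW.
    by move=> v [Ov /X1X av]; rewrite distrC; exact/ltW/Xf.
  rewrite -HaH -cmulBl -cmulBr; apply: le_trans (cnormM _ _) _.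
  rewrite -[leRHS]mulr1; apply: ler_pM => //; apply: le_trans (cnormM _ _) _.
  by rewrite -[leRHS]mul1r; apply: ler_pM.
have V1 : chi V w1 != 0 by rewrite chi1 ?oner_neq0 //; split.
have [B [FB JB orb]] := ideal_point iJ CV JH Ow1 V1.
by apply: (nw1 B) => //; split.
Qed.

Lemma ideal_sets_ideal (J : set E) : closed_ideal J -> factor_ideal e (ideal_sets J).
Proof.
move=> [_ _ _ _ JM]; split=> [B []//|B D [FB JB] FD BD]; split=> //.
by rewrite (defect_sub crossed FB FD BD); have [] := JM (defect iota D) _ JB.
Qed.

Lemma phi_ideal_sets (J : set E) : closed_ideal J -> phi iota (ideal_sets J) = J.
Proof.
move=> iJ; apply/seteqP; split.
  by apply: closed_ideal_gen_min => // _ [B [_ JB] <-].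
apply: subset_trans (ideal_residual iJ) _.
by apply: (residual_phi e_sym e_irr crossed) => B [].
Qed.

Lemma phi_residual I : I `<=` factor_sets e -> phi iota I `<=` resid I.
Proof.
move=> IF; apply: closed_ideal_gen_min; first exact: residual_ideal.
by move=> _ [B IB <-]; apply: defect_residual => //; exact: IF.
Qed.

(** If [B] is in [I] but not in [J], the witness of [B] lies in [points J]: a member of [J] in whose
    orbit it lies would be a subset of [B] and force [B] into [J]. There the defect of [B] has value
    1, which elements of [phi iota J] cannot have. *)
Lemma phi_subset I J : factor_ideal e I -> factor_ideal e J ->
  I `<=` J <-> phi iota I `<=` phi iota J.
Proof.
move=> [IF _] [JF Jdown]; split=> [IJ|pIJ B IB].
  apply: closed_ideal_gen_min; first exact: phi_closed_ideal.
  by move=> _ [B IB <-]; apply: closed_ideal_gen_sub; exists B => //; exact: IJ.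
have FB := IF _ IB; apply: contrapT => nJB.
have [w [Ow av wC]] := spectrum_witness e_sym e_irr FB.
have Jw : points J w.
  split=> // D JD orb; have FD := JF _ JD; apply: nJB.
  by apply: (Jdown D) => //; exact: wC.
have dJ : phi iota J (defect iota B) by apply: pIJ; apply: closed_ideal_gen_sub; exists B.
(* Two errors of 1/4 remain below the value 1 of the defect at [w]. *)
have e4 : 0 < 4^-1 :> C by rewrite invr_gt0.
have [a fa [+ aw]] := phi_residual JF dJ Jw (cunit P iota) (cunit P iota) e4.
rewrite (cmul1x crossed) (cmulx1 crossed) => near.
have CB := avoid_set_C0 R FB; have fB := finite_sums_single CB.
rewrite defectE // /el -(iotaB crossed) // in near.
have fd := finite_sumsB fa fB.
have := le_trans (crossed_product_coef P1 PM Panti crossed fd Ow) near.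
rewrite -[(_ - _) _ _]/(a 1%g w - single 1%g (chi (avoid_set e B)) 1%g w).
rewrite /single eqxx chi1; last by split.
move=> d; have := lerD aw d; apply/negP.
rewrite -real_ltNge ?realD ?normr_real ?gtr0_real //.
apply: (@lt_le_trans _ _ 1).
  have -> : 4^-1 + 4^-1 = 2^-1 :> C by field.
  by rewrite invf_lt1 ?ltr1n.
by have := ler_normB (a 1%g w) (a 1%g w - 1); rewrite opprB addrC subrK normr1.
Qed.

(** The order is reverse inclusion, so every member [D] of the generated ideal contains [B], and by
    [defect_sub] its defect is a multiple of that of [B]. *)
Lemma phi_principal B : factor_sets e B ->
  phi iota (factor_ideal_gen e [set B]) = closed_ideal_gen [set defect iota B].
Proof.
move=> FB; apply/seteqP; split; apply: closed_ideal_gen_min; try exact: closed_ideal_genP.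
  move=> _ [D /(_ [set D | factor_sets e D /\ B `<=` D]) + <-].
  case=> [|FD BD].
    split; last by move=> _ ->; split.
    split=> [D' []//|D1 D2 [F1 B1] F2 D12]; split=> //; exact: subset_trans D12.
  rewrite (defect_sub crossed FB FD BD).
  have [_ _ _ _ JM] := closed_ideal_genP [set defect iota B].
  have [] := JM (defect iota D) (defect iota B) => //.
  exact: closed_ideal_gen_sub.
move=> _ ->; apply: closed_ideal_gen_sub; exists B => // I [_]; exact.
Qed.

End Classification.

Theorem theorem8p3 (R : realType) (S : countType) (e : rel S)
    (e_sym : symmetric e) (e_irr : irreflexive e)
    (E : cstarAlgType R)
    (iota : (raag e -> {ptws raag e -> bool} -> R[i]^o) -> E)
    (E_crossed : is_crossed_product (@raag_pos S e) iota)
    (no_ZN : forall lam, factors e lam ->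
       ~ iso_Z_N (@raag_pos lam (@induced_graph S e lam))) :
  [/\ set_bij (@factor_ideal S e) (@closed_ideal R E) (phi iota),
      (forall I J, factor_ideal e I -> factor_ideal e J ->
         (I `<=` J <-> phi iota I `<=` phi iota J)) &
      (forall B, factor_sets e B ->
         phi iota (factor_ideal_gen e [set B]) =
         closed_ideal_gen [set defect iota B])].
Proof.
have no_isol := no_isolated no_ZN.
have sub := phi_subset e_sym e_irr E_crossed.
split=> //; last exact: phi_principal.
split=> [I _|I J|J iJ]; first exact: phi_closed_ideal.
  rewrite !inE => iI jJ IJ; apply/seteqP.
  by split; apply/sub => //; rewrite IJ.
exists (ideal_sets iota J); first exact: ideal_sets_ideal.
exact: phi_ideal_sets.
Qed.
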